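(* Let $(A,D(A))$ be the generator of a $\tau$-bi-continuous semigroup $(T(t))_{t\ge 0}$ on a Banach space $X$. Let $B:X\to X_{-1}$ be such that $B\in\mathcal{S}^{DS,\tau}_{t_0}$ for some $t_0>0$. Then the operator $(A_{-1}+B)_{|X}$, $x\mapsto A_{-1}x+Bx$, with domain $$D((A_{-1}+B)_{|X}):=\{x\in X:\ A_{-1}x+Bx\in X\}$$ generates a $\tau$-bi-continuous semigroup $(S(t))_{t\ge0}$ on $X$. Moreover, $(S(t))_{t\ge 0}$ satisfies the variation of parameters formula $$S(t)x=T(t)x+\int_0^t T_{-1}(t-r)BS(r)x\,\mathrm{d}r$$ for every $t\ge 0$ and $x\in X$ (the integral being a $\tau_{-1}$-Riemann integral).
   Context: **Setting.** A triple $(X,\|\cdot\|,\tau)$ is fixed, where $X$ is a Banach space and $\tau$ is a Hausdorff locally convex topology on $X$, coarser than the norm topology, such that every norm-bounded $\tau$-Cauchy sequence is $\tau$-convergent, and $\|x\|=\sup\{|\varphi(x)|:\varphi\in(X,\tau)',\ \|\varphi\|\le1\}$ for all $x\in X$. $\mathscr{P}$ denotes a family of $\tau$-continuous seminorms generating $\tau$ with $\|x\|=\sup_{p\in\mathscr P}p(x)$. $\mathscr{L}(X)$ denotes the norm-bounded linear operators. **Bi-continuous semigroups.** A family $\mathcal B\subseteq\mathscr L(X)$ is bi-equicontinuous if for each norm-bounded $\tau$-null sequence $(x_n)$ one has $Bx_n\to0$ in $\tau$ uniformly for $B\in\mathcal B$. A family $(T(t))_{t\ge0}\subseteq\mathscr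 L(X)$ is a $\tau$-bi-continuous semigroup if: $T(t+s)=T(t)T(s)$, $T(0)=I$; $t\mapsto T(t)x$ is $\tau$-continuous on $[0,\infty)$ for each $x$; $\|T(t)\|\le Me^{\omega t}$ for some $M\ge1,\omega\in\mathbb R$ and all $t\ge 0$; and $\{T(t):t\in[0,s]\}$ is bi-equicontinuous for every $s>0$. Its generator is $Ax:=\tau\text{-}\lim_{t\to0}\frac{T(t)x-x}{t}$ with domain $D(A)$ consisting of those $x\in X$ for which this $\tau$-limit exists and $\sup_{t\in(0,1]}\frac{\|T(t)x-x\|}{t}<\infty$. **Extrapolation space.** It is assumed that $0\in\rho(A)$. Let $\underline X_0:=\overline{D(A)}^{\|\cdot\|}$; the restriction of $(T(t))$ to $\underline X_0$ is a $C_0$-semigroup generated by the part $\underline A_0$ of $A$ in $\underline X_0$. Let $\underline X_{-1}$ be the completion of $\underline X_0$ for $\|x\|_{-1}=\|\underline A_0^{-1}x\|$, $\underline A_{-1}:\underline X_0\to\underline X_{-1}$ the isometric extension of $\underline A_0$, and repeat to get $\underline X_{-2}$ and $\underline A_{-2}:\underline X_{-1}\to\underline X_{-2}$. $X$ is regarded as a subspace of $\underline X_{-1}$ (via $x\mapsto\underline A_{-1}A^{-1}x$). Define $X_{-1}:=\underline A_{-2}(X)$, with norm $\|x\|_{-1}:=\|\underline A_{-2}^{-1}x\|$ and locally convex topology $\tau_{-1}$ generated by $\mathscr P_{-1}=\{p_{-1}:p\in\mathscr P\}$, $p_{-1}(x):=p(\underline A_{-2}^{-1}x)$. Put $A_{-1}:=\underline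 A_{-2}|_X:X\to X_{-1}$, an isomorphism both for the norms and for $\tau,\tau_{-1}$, which extends $A$; here $X\subseteq X_{-1}$ through $x=A_{-1}A^{-1}x$. The semigroup $T_{-1}(t):=A_{-1}T(t)A_{-1}^{-1}$ extends $T(t)$ to a $\tau_{-1}$-bi-continuous semigroup on $X_{-1}$ with generator $A_{-1}$, $D(A_{-1})=X$. **Admissibility.** For $t_0>0$ let $\mathfrak X_{t_0}$ be the Banach space of all $F:[0,t_0]\to\mathscr L(X)$ that are $\tau$-strongly continuous, norm bounded, and such that $\{F(t):t\in[0,t_0]\}$ is bi-equicontinuous, with norm $\|F\|=\sup_{t\in[0,t_0]}\|F(t)\|$. For $B\in\mathscr L(X,X_{-1})$ which is also continuous $(X,\tau)\to(X_{-1},\tau_{-1})$, define $(V_BF)(t)x:=\int_0^tT_{-1}(t-r)BF(r)x\,\mathrm dr\in X_{-1}$ ($\tau_{-1}$-Riemann integral), for $F\in\mathfrak X_{t_0}$, $t\in[0,t_0]$, $x\in X$. Then $B\in\mathcal S^{DS,\tau}_{t_0}$ means: $(V_BF)(t)x\in X$ for all $F\in\mathfrak X_{t_0}$, $t\in[0,t_0]$, $x\in X$; $\mathrm{Ran}(V_B)\subseteq\mathfrak X_{t_0}$; and $\|V_B\|<1$ (operator norm on $\mathfrak X_{t_0}$). *)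

(* Defs.v *)
From HB Require Import structures.
From mathcomp Require Import all_boot all_order all_algebra.
From mathcomp Require Import complex.
From mathcomp Require Import all_classical reals ereal topology normedtype.
From mathcomp Require Import interval_inference tvs convex sequences exp.

Set Implicit Arguments.
Unset Strict Implicit.
Unset Printing Implicit Defensive.

Import Order.TTheory GRing.Theory Num.Theory.
Import numFieldNormedType.Exports.

Local Open Scope classical_set_scope.
Local Open Scope ring_scope.

(* The scalar field of X: a numFieldType whose real elements are exactly the
   image of R, so that X may be a real or a complex Banach space (see
   real_scalars and complex_scalars), while time stays in R. *)
Record scalars (R : realType) := Scalars {
  scalar_field :> numFieldType;
  ofR : {rmorphism R -> scalar_field};
  ofR_le : {mono ofR : a b / a <= b};
  ofR_onto : forall z : scalar_field, z \is Num.real -> exists a, z = ofR a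
}.
Arguments ofR {R s}.

Lemma real_scalars_le (R : realType) :
  {mono (idfun : {rmorphism R -> R}) : a b / a <= b}.
Proof. by []. Qed.

Lemma real_scalars_onto (R : realType) (z : R) :
  z \is Num.real -> exists a, z = (idfun : {rmorphism R -> R}) a.
Proof. by exists z. Qed.

Definition real_scalars (R : realType) : scalars R :=
  Scalars (@real_scalars_le R) (@real_scalars_onto R).

Lemma complex_scalars_le (R : realType) :
  {mono (real_complex R : {rmorphism R -> R[i]}) : a b / a <= b}.
Proof. by move=> a b; rewrite /= lecR. Qed.

Lemma complex_scalars_onto (R : realType) (z : R[i]) :
  z \is Num.real -> exists a, z = (real_complex R : {rmorphism R -> R[i]}) a.
Proof. by move=> /RRe_real <-; eexists. Qed.

Definition complex_scalars (R : realType) : scalars R :=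
  Scalars (@complex_scalars_le R) (@complex_scalars_onto R).

Lemma i01_bounds (F : numDomainType) (k : {i01 F}) : 0 <= (k%:num : F) <= 1.
Proof. by apply/andP; split; [exact: ge0|exact: le1]. Qed.

Section seminorm_topology.
Context {R : realType} {K : scalars R}.

Record seminorm (X : lmodType K) := Seminorm {
  seminorm_fun :> X -> R;
  seminormD : forall x y,
    seminorm_fun (x + y) <= seminorm_fun x + seminorm_fun y;
  seminormZ : forall (a : K) x,
    ofR (seminorm_fun (a *: x)) = `|a| * ofR (seminorm_fun x) :> K
}.

Lemma pullD (X Y : lmodType K) (p : seminorm X) (L : {linear Y -> X}) x y :
  p (L (x + y)) <= p (L x) + p (L y).
Proof. by rewrite linearD seminormD. Qed.

Lemma pullZ (X Y : lmodType K) (p : seminorm X) (L : {linear Y -> X})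
    (a : K) x :
  ofR (p (L (a *: x))) = `|a| * ofR (p (L x)) :> K.
Proof. by rewrite linearZ seminormZ. Qed.

Definition seminorm_pull (X Y : lmodType K) (p : seminorm X)
    (L : {linear Y -> X}) : seminorm Y :=
  @Seminorm Y (p \o L) (pullD p L) (pullZ p L).

Lemma seminorm0 (X : lmodType K) (p : seminorm X) : p 0 = 0.
Proof.
apply: (fmorph_inj (@ofR R K)).
by rewrite -(scale0r (0 : X)) seminormZ normr0 mul0r rmorph0.
Qed.

Lemma seminormN (X : lmodType K) (p : seminorm X) x : p (- x) = p x.
Proof.
apply: (fmorph_inj (@ofR R K)).
by rewrite -scaleN1r seminormZ normrN normr1 mul1r.
Qed.

Lemma seminorm_ge0 (X : lmodType K) (p : seminorm X) x : 0 <= p x.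
Proof.
have := seminormD p x (- x); rewrite subrr seminorm0 seminormN -mulr2n.
by rewrite pmulrn_lge0.
Qed.

(* lcs P is X with the locally convex topology generated by P. *)
Definition lcs (X : lmodType K) (P : set (seminorm X)) : Type := X.

HB.instance Definition _ (X : lmodType K) (P : set (seminorm X)) :=
  GRing.Lmodule.on (lcs P).

Section instances.
Variables (X : lmodType K) (P : set (seminorm X)).

(* finitely many seminorms of P, and a radius *)
Definition lcs_index : set (set (seminorm X) * R) :=
  [set i | [/\ finite_set i.1, i.1 `<=` P & 0 < i.2]].

Definition lcs_strip (i : set (seminorm X) * R) : set (lcs P * lcs P) :=
  [set xy | forall p, i.1 p -> p (xy.1 - xy.2) < i.2].

Definition lcs_entourage : set_system (lcs P * lcs P) :=
  filter_from lcs_index lcs_strip.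

Lemma lcs_entourage_filter : Filter lcs_entourage.
Proof.
apply: filter_from_filter.
  by exists (set0, 1); split=> //=; exact: finite_set0.
move=> [s d] [s' d'] [/= sf sP d0] [/= s'f s'P d'0].
exists (s `|` s', Num.min d d').
  split=> /=; first by rewrite finite_setU.
    by rewrite subUset.
  by rewrite lt_min d0.
move=> [x y] /= H; split=> p ps /=.
  by have /H : (s `|` s') p by [left]; rewrite lt_min => /andP[].
by have /H : (s `|` s') p by [right]; rewrite lt_min => /andP[].
Qed.

Lemma lcs_entourage_diagonal (E : set (lcs P * lcs P)) :
  lcs_entourage E -> diagonal `<=` E.
Proof.
move=> [[s d] [/= _ sP d0] sE] [x y] /= xy; apply: sE => p _ /=.
by rewrite (_ : x = y)// subrr seminorm0.
Qed.

Lemma lcs_entourage_inv (E : set (lcs P * lcs P)) :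
  lcs_entourage E -> lcs_entourage E^-1%relation.
Proof.
move=> [i iP iE]; exists i => // -[x y] /= H; apply: iE => p ps /=.
by rewrite -opprB seminormN; exact: H.
Qed.

Lemma lcs_entourage_split (E : set (lcs P * lcs P)) : lcs_entourage E ->
  exists2 B, lcs_entourage B & (B \; B)%relation `<=` E.
Proof.
move=> [[s d] [/= sf sP d0] sE]; exists (lcs_strip (s, d / 2)).
  by exists (s, d / 2) => //; split=> //=; rewrite divr_gt0.
move=> [x z] /= [y H1 H2]; apply: sE => p ps /=.
have -> : (x : X) - z = (x - y) + (y - z) by rewrite addrA subrK.
rewrite (le_lt_trans (seminormD _ _ _))// [ltRHS](splitr d).
by apply: ltrD; [exact: H1|exact: H2].
Qed.

HB.instance Definition _ := isUniform.Build (lcs P)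
  lcs_entourage_filter lcs_entourage_diagonal lcs_entourage_inv
  lcs_entourage_split.

Definition lcs_ball (x : lcs P) (i : set (seminorm X) * R) : set (lcs P) :=
  [set y | forall p, i.1 p -> p (y - x) < i.2].

Lemma nbhs_lcsE (x : lcs P) : nbhs x = filter_from lcs_index (lcs_ball x).
Proof.
have E U : nbhs x U <-> filter_from lcs_entourage (fun A => xsection A x) U.
  by rewrite filter_from_entourageE.
apply/funext => U; apply/propext; rewrite E; split.
  move=> [A [i iP iA] AU]; exists i => // y xy; apply/AU/xsectionP/iA.
  by move=> p ip /=; rewrite -opprB seminormN; exact: xy.
move=> [i iP iU]; exists (lcs_strip i); first by exists i.
move=> y /xsectionP H; apply: iU => p ip.
by rewrite -opprB seminormN; exact: (H p ip).
Qed.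

Lemma seminorm_ltZ (p : seminorm X) (a : K) (c : R) x d :
  `|a| <= ofR c -> c * p x < d -> p (a *: x) < d.
Proof.
move=> ac; apply: le_lt_trans; rewrite -(@ofR_le R K) seminormZ rmorphM.
by rewrite ler_wpM2r// -(rmorph0 (@ofR R K)) ofR_le seminorm_ge0.
Qed.

Lemma lcs_add_continuous : continuous (fun x : lcs P * lcs P => x.1 + x.2).
Proof.
move=> [x y] /= U; rewrite /= nbhs_lcsE => -[[s d] [/= sf sP d0] sU].
have sd : lcs_index (s, d / 2) by split=> //=; rewrite divr_gt0.
exists (lcs_ball x (s, d / 2), lcs_ball y (s, d / 2)).
  by split; rewrite /= nbhs_lcsE; exists (s, d / 2).
move=> [x' y'] /= [xx yy]; apply: sU => p ps /=.
rewrite opprD addrACA (le_lt_trans (seminormD _ _ _))// [ltRHS](splitr d).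
by apply: ltrD; [exact: xx|exact: yy].
Qed.

Lemma finite_seminorm_ub (s : set (seminorm X)) (x : X) : finite_set s ->
  exists2 c : R, 0 < c & forall p, s p -> p x <= c.
Proof.
move=> fs; have := @finite_image _ _ s (fun p : seminorm X => p x) fs.
move=> /finite_seqP[l ls]; exists (1 + \sum_(r <- l) `|r|).
  by rewrite ltr_wpDr// sumr_ge0.
move=> p ps; have : [set r | r \in l] (p x) by rewrite -ls; exists p.
move=> /= pl; rewrite (big_rem _ pl)/= (le_trans (ler_norm _))// addrCA.
by rewrite lerDl addr_ge0// sumr_ge0.
Qed.

Lemma lcs_scale_continuous :
  continuous (fun z : K^o * lcs P => z.1 *: z.2).
Proof.
move=> [a x] /= U; rewrite /= nbhs_lcsE => -[[s d] [/= sf sP d0] sU].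
have [c c0 sc] := finite_seminorm_ub x sf.
have [b ab] := ofR_onto (normr_real a).
have b0 : 0 <= b by rewrite -(@ofR_le R K) -ab rmorph0.
pose e := Num.min 1 (d / 2 / c).
have e0 : 0 < e by rewrite lt_min ltr01/= !divr_gt0.
have b1 : 0 < b + 1 by rewrite ltr_wpDl.
pose h := d / 2 / (b + 1).
have h0 : 0 < h by rewrite !divr_gt0.
have e0K : 0 < ofR e :> K.
  by rewrite lt_neqAle -(rmorph0 (@ofR R K)) ofR_le (ltW e0) andbT (inj_eq (fmorph_inj _)) lt_eqF.
exists (ball (a : K^o) (ofR e), lcs_ball x (s, h)).
  by split; rewrite /=; [exact: nbhsx_ballx|rewrite nbhs_lcsE; exists (s, h)].
move=> [a' x'] /= [aa xx]; apply: sU => p ps /=.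
have {}aa : `|a' - a| <= ofR e by rewrite distrC ltW.
have -> : a' *: (x' : X) - a *: x = a' *: ((x' : X) - x) + (a' - a) *: (x : X).
  by rewrite scalerBr scalerBl addrA subrK.
rewrite (le_lt_trans (seminormD _ _ _))// [ltRHS](splitr d) ltr_leD//.
  apply: (@seminorm_ltZ _ _ (b + 1)).
    rewrite -(subrK a a') (le_trans (ler_normD _ _))// rmorphD addrC lerD ?ab//.
    by rewrite (le_trans aa)// ofR_le ge_min lexx.
  by rewrite mulrC -ltr_pdivlMr//; exact: xx.
rewrite -(@ofR_le R K) seminormZ.
have pc := sc _ ps.
rewrite (@le_trans _ _ (ofR e * ofR c))//.
  apply: ler_pM => //; last by rewrite ofR_le.
  by rewrite -(rmorph0 (@ofR R K)) ofR_le seminorm_ge0.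
rewrite -rmorphM ofR_le -ler_pdivlMr// /e.
by rewrite ge_min lexx orbT.
Qed.

Lemma lcs_locally_convex : exists2 B : set_system (lcs P),
  (forall b, b \in B -> convex_set b) & basis B.
Proof.
exists [set B | exists x i, lcs_index i /\ B = lcs_ball x i].
  move=> B /[!inE] -[x [[s d] [[/= sf sP d0] ->]]] y z k; rewrite !inE => xy xz.
  move=> p /= ps.
  set a := (k%:num : K).
  have a01 : 0 <= a <= 1 by exact: i01_bounds.
  have [c ac] := ofR_onto (ger0_real (andP a01).1).
  have c0 : 0 <= c by rewrite -(@ofR_le R K) -ac rmorph0 (andP a01).1.
  have c1 : c <= 1 by rewrite -(@ofR_le R K) -ac rmorph1 (andP a01).2.
  have -> : conv k (y : convex_lmodType (lcs P)) z - x =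
      a *: ((y : X) - x) + (1 - a) *: ((z : X) - x).
    rewrite !scalerBr addrACA -opprD -scalerDl [a + _]addrC subrK scale1r.
    by [].
  have E (t : R) (u : X) : 0 <= t -> p ((ofR t : K) *: u) = t * p u.
    move=> t0; apply: (fmorph_inj (@ofR R K)); rewrite seminormZ rmorphM.
    by rewrite ger0_norm// -(rmorph0 (@ofR R K)) ofR_le.
  rewrite (le_lt_trans (seminormD _ _ _))// ac.
  have -> : 1 - ofR c = ofR (1 - c) :> K by rewrite rmorphB rmorph1.
  rewrite !E ?subr_ge0//.
  have := xy _ ps; have := xz _ ps => /= hz hy.
  have [->|cn0] := eqVneq c 0; first by rewrite mul0r add0r subr0 mul1r.
  have cp : 0 < c by rewrite lt_def cn0.
  have -> : d = c * d + (1 - c) * d by rewrite -mulrDl subrKC mul1r.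
  by rewrite ltr_leD ?ltr_pM2l// ler_wpM2l ?subr_ge0// ltW.
split=> [B [x [[s d] [[/= sf sP d0] ->]]]|x U].
  rewrite openE => y xy; rewrite /interior nbhs_lcsE.
  have [s0|/set0P[p0 sp0]] := eqVneq s set0.
    by exists (s, d) => //; rewrite /lcs_ball s0 => z _ p.
  have := @finite_image _ _ s (fun p : seminorm X => d - p ((y : X) - x)) sf.
  move=> /finite_seqP[l ls].
  pose e := \big[Num.min/1]_(r <- l) r.
  have e0 : 0 < e.
    rewrite /e big_seq; elim/big_ind: _ => //.
      by move=> u v u0 v0; rewrite lt_min u0.
    move=> r rl; have : [set r | r \in l] r by [].
    by rewrite -ls => -[p ps <-]; rewrite subr_gt0; exact: xy.
  have el r : r \in l -> e <= r.
    rewrite /e; elim: l {ls e0 e} => // u l IH.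
    rewrite inE big_cons ge_min => /orP[/eqP ->|/IH ->]; first by rewrite lexx.
    by rewrite orbT.
  exists (s, e) => // z yz p ps /=.
  have -> : (z : X) - x = (z - y) + ((y : X) - x) by rewrite addrA subrK.
  rewrite (le_lt_trans (seminormD _ _ _))// -ltrBrDr.
  apply: lt_le_trans (yz _ ps) _; apply: el.
  have : ((fun p : seminorm X => d - p ((y : X) - x)) @` s) (d - p ((y : X) - x)).
    by exists p.
  by rewrite ls.
rewrite nbhs_lcsE => -[i iP iU]; exists (lcs_ball x i) => //; split.
  by exists x, i.
by move=> p ip; rewrite subrr seminorm0; case: iP.
Qed.

HB.instance Definition _ :=
  PreTopologicalNmodule_isTopologicalNmodule.Build (lcs P) lcs_add_continuous.
HB.instance Definition _ :=
  TopologicalNmodule_isTopologicalLmodule.Build K (lcs P) lcs_scale_continuous.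
HB.instance Definition _ := Uniform_isTvs.Build K (lcs P) lcs_locally_convex.

End instances.
End seminorm_topology.

Section operators.
Context {R : realType} {K : scalars R}.

(* the norm of x as an element of R (the library's norm is K-valued) *)
Definition normR (X : normedModType K) (x : X) : R :=
  xget 0 [set a : R | ofR a = `|x| :> K].

Lemma normRE (X : normedModType K) (x : X) : ofR (normR x) = `|x| :> K.
Proof.
rewrite /normR; case: xgetP => [a _ //|no].
by have [a ax] := ofR_onto (normr_real x); case: (no a).
Qed.

Definition opnorm (X Y : normedModType K) (f : X -> Y) : \bar R :=
  ereal_sup [set (normR (f x))%:E | x in [set x | normR x <= 1]].

Definition bounded_operator (X Y : normedModType K) (f : X -> Y) : Prop :=
  linear f /\ (opnorm f < +oo)%E.

(* Unbounded operators are given by their graphs: A x y means that x is in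
   D(A) and A x = y. *)
Definition operator (X Y : Type) := X -> Y -> Prop.

Definition domain (X Y : Type) (A : operator X Y) : set X :=
  [set x | exists y, A x y].

Definition resolvent_set (X : normedModType K) (A : operator X X) : set K :=
  [set lambda | exists2 Res : X -> X, bounded_operator Res &
    forall x z, x = Res z <-> exists2 y, A x y & lambda *: x - y = z].

End operators.

Section riemann.
Context {R : realType} {K : scalars R}.

(* s = [:: (xi_1, t_1); ...; (xi_n, t_n)] is a tagged partition
   a = t_0 <= xi_1 <= t_1 <= ... <= xi_n <= t_n = b of mesh < d *)
Fixpoint tagged_partition (d a b : R) (s : seq (R * R)) : Prop :=
  if s is (xi, t) :: s' then
    [/\ a <= xi, xi <= t, t - a < d & tagged_partition d t b s']
  else a = b.

Fixpoint riemann_sum (Y : lmodType K) (f : R -> Y) (a : R)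
    (s : seq (R * R)) : Y :=
  if s is (xi, t) :: s' then
    (ofR (t - a) : K) *: f xi + riemann_sum f t s'
  else 0.

Definition mesh_to0 (a b : R) : set_system (seq (R * R)) :=
  filter_from [set d : R | 0 < d] (fun d => tagged_partition d a b).

(* v is the Riemann integral of f over [a, b] in the topology generated by P *)
Definition is_riemann_integral (Y : lmodType K) (P : set (seminorm Y))
    (f : R -> Y) (a b : R) (v : Y) : Prop :=
  (fun s => riemann_sum f a s : lcs P) @ mesh_to0 a b --> (v : lcs P).

End riemann.

Section bicontinuous.
Context {R : realType} {K : scalars R}.

(* the standing assumptions on (X, ||.||, tau), tau being generated by P *)
Record bicontinuous_setting (X : completeNormedModType K)
    (P : set (seminorm X)) : Prop := {
  tau_hausdorff : hausdorff_space (lcs P);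
  tau_coarser : continuous (id : X -> lcs P);
  tau_complete : forall u : nat -> X,
    (exists C : R, forall n, normR (u n) <= C) ->
    cauchy ((u : nat -> lcs P) @ \oo) ->
    exists l : lcs P, (u : nat -> lcs P) @ \oo --> l;
  tau_norming : forall x : X, (normR x)%:E =
    ereal_sup [set (normR (phi x))%:E | phi in
      [set phi : {linear X -> K^o} |
        continuous (phi : lcs P -> K^o) /\ (opnorm phi <= 1)%E]];
  tau_seminorms : forall x : X,
    (normR x)%:E = ereal_sup [set (p x)%:E | p in P]
}.

Definition bi_equicontinuous (X : normedModType K) (P : set (seminorm X))
    (BB : set (X -> X)) : Prop :=
  forall u : nat -> X, (exists C : R, forall n, normR (u n) <= C) ->
    (u : nat -> lcs P) @ \oo --> (0 : lcs P) ->
    forall U : set (lcs P), nbhs (0 : lcs P) U ->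
      \forall n \near \oo, forall B, BB B -> U (B (u n)).

Record bicontinuous_semigroup (X : normedModType K) (P : set (seminorm X))
    (T : R -> X -> X) : Prop := {
  bcs_bounded : forall t : R, 0 <= t -> bounded_operator (T t);
  bcsD : forall t s : R, 0 <= t -> 0 <= s -> T (t + s) = T t \o T s;
  bcs0 : T 0 = id;
  bcs_continuous : forall x,
    {within `[0, +oo[, continuous (fun t : R => T t x : lcs P)};
  bcs_growth : exists M omega : R, 1 <= M /\
    forall t : R, 0 <= t -> (opnorm (T t) <= (M * expR (omega * t))%:E)%E;
  bcs_equicontinuous : forall s : R, 0 < s ->
    bi_equicontinuous P (T @` `[0, s])
}.

Definition generator (X : normedModType K) (P : set (seminorm X))
    (T : R -> X -> X) : operator X X := fun x y =>
  ((fun t : R => (ofR t : K)^-1 *: (T t x - x) : lcs P) @ 0^'+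
     --> (y : lcs P)) /\
  (ereal_sup [set (normR (T t x - x) / t)%:E |
     t in [set t : R | (0 < t <= 1)%R]] < +oo)%E.

End bicontinuous.

Section extrapolation.
Context {R : realType} {K : scalars R}.

(* Z, with e : Y -> Z, is the completion of Y for the norm ||G^-1 y||, and
   a : Y -> Z is the isometric extension of G. *)
Record extrapolation_step (Y Z : normedModType K) (G : operator Y Y)
    (e a : Y -> Z) : Prop := {
  step_norm : forall x y, G x y -> `|e y| = `|x|;
  step_dense : dense (range e);
  step_isometry : forall x, `|a x| = `|x|;
  step_extends : forall x y, G x y -> a x = e y
}.

(* The extrapolation spaces of an operator A with 0 in its resolvent set. A
   subspace or a completion is a space together with its inclusion, and is thus
   determined up to isometric isomorphism. *)
Record extrapolation (X : completeNormedModType K) (A : operator X X) := {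
  (* X0 is the closure of D(A), inX0 its inclusion *)
  X0 : normedModType K;
  inX0 : {linear X0 -> X};
  inX0_isometry : forall x, `|inX0 x| = `|x|;
  inX0_range : range inX0 = closure (domain A);
  (* U1 and AU1 are underline X_{-1} and underline A_{-1}, from the part of A
     in X0 *)
  U1 : completeNormedModType K;
  inU1 : {linear X0 -> U1};
  AU1 : {linear X0 -> U1};
  step1 : extrapolation_step (fun x y => A (inX0 x) (inX0 y)) inU1 AU1;
  (* U2 and AU2 are underline X_{-2} and underline A_{-2}, from underline A_{-1}
     viewed as an operator in U1 with domain X0 *)
  U2 : completeNormedModType K;
  inU2 : {linear U1 -> U2};
  AU2 : {linear U1 -> U2};
  step2 : extrapolation_step
    (fun u v => exists2 x, u = inU1 x & v = AU1 x) inU2 AU2;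
  (* the inclusion y |-> underline A_{-1} A^-1 y of X in U1 *)
  XinU1 : {linear X -> U1};
  XinU1E : forall (x : X0) y, A (inX0 x) y -> XinU1 y = AU1 x;
  (* Xm1 is the subspace underline A_{-2}(X) of U2, with inclusion Xm1inU2;
     Am1 is the restriction of underline A_{-2} to X and Am1V its inverse *)
  Xm1 : normedModType K;
  Xm1inU2 : {linear Xm1 -> U2};
  Xm1inU2_inj : injective Xm1inU2;
  Xm1inU2_range : range Xm1inU2 = AU2 @` range XinU1;
  Am1 : {linear X -> Xm1};
  Am1E : forall x, Xm1inU2 (Am1 x) = AU2 (XinU1 x);
  Am1V : {linear Xm1 -> X};
  Am1K : cancel Am1 Am1V;
  Am1VK : cancel Am1V Am1;
  Xm1_norm : forall y, `|y| = `|Am1V y|;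
  (* the inclusion y |-> A_{-1} A^-1 y of X in Xm1 *)
  inXm1 : {linear X -> Xm1};
  inXm1E : forall x y, A x y -> inXm1 y = Am1 x
}.

End extrapolation.

Section admissibility.
Context {R : realType} {K : scalars R} {X : completeNormedModType K}.
Context (P : set (seminorm X)) {A : operator X X} (E : extrapolation A).

Definition Pm1 : set (seminorm (Xm1 E)) :=
  [set seminorm_pull p (Am1V E) | p in P].

Definition Tm1 (T : R -> X -> X) (t : R) (y : Xm1 E) : Xm1 E :=
  Am1 E (T t (Am1V E y)).

Section on_interval.
Variable t0 : R.

(* Only the values of F on [0, t0] matter. *)
Definition in_XX (F : R -> X -> X) : Prop :=
  [/\ forall t : R, t \in `[0, t0] -> bounded_operator (F t),
      forall x, {within `[0, t0], continuous (fun t : R => F t x : lcs P)},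
      exists C : R, forall t : R, t \in `[0, t0] -> (opnorm (F t) <= C%:E)%E &
      bi_equicontinuous P (F @` `[0, t0]) ].

Definition XX_norm (F : R -> X -> X) : \bar R :=
  ereal_sup [set opnorm (F t) | t in `[0, t0] ].

(* (V_B F)(t) x = v *)
Definition is_VB (T : R -> X -> X) (B : X -> Xm1 E) (F : R -> X -> X)
    (t : R) (x : X) (v : Xm1 E) : Prop :=
  is_riemann_integral Pm1 (fun r : R => Tm1 T (t - r) (B (F r x))) 0 t v.

(* V_B F = G, X being viewed as a subspace of Xm1 *)
Definition VB_eq (T : R -> X -> X) (B : X -> Xm1 E) (F G : R -> X -> X) :=
  forall t : R, t \in `[0, t0] -> forall x, is_VB T B F t x (inXm1 E (G t x)).

(* Since inXm1 is injective, VB_eq determines G on [0, t0]; the last field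
   therefore bounds the operator norm of V_B on in_XX. *)
Record desch_schappacher (T : R -> X -> X) (B : X -> Xm1 E) : Prop := {
  DS_bounded : bounded_operator B;
  DS_continuous : continuous (B : lcs P -> lcs Pm1);
  DS_values : forall F, in_XX F -> forall t : R, t \in `[0, t0] ->
    forall x, exists y : X, is_VB T B F t x (inXm1 E y);
  DS_range : forall F G, in_XX F -> VB_eq T B F G -> in_XX G;
  DS_norm : (ereal_sup [set XX_norm G | G in
    [set G | exists F, [/\ in_XX F, (XX_norm F <= 1)%E & VB_eq T B F G] ] ]
    < 1)%E
}.

End on_interval.

(* the graph of (A_{-1} + B)|_X; its domain is {x | A_{-1} x + B x \in X} *)
Definition perturbed_generator (B : X -> Xm1 E) : operator X X :=
  fun x y => Am1 E x + B x = inXm1 E y.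

End admissibility.

Arguments Pm1 {R K X} P {A} E.

(* Main.v *)
Require Import Defs.
From mathcomp Require Import all_boot all_order all_algebra.
From mathcomp Require Import all_classical reals ereal topology normedtype.
From mathcomp Require Import sequences exp ring lra.
Import Order.TTheory GRing.Theory Num.Theory.
Import numFieldNormedType.Exports.
Local Open Scope classical_set_scope.
Local Open Scope ring_scope.
Set Implicit Arguments.
Unset Strict Implicit.

(** The isomorphism [A_{-1}] between [X] and the extrapolation space brings the
whole problem back to [X]. With [J = A^-1] and [C = A_{-1}^-1 B], an operator on
[X] that is bounded and continuous for [tau], the Volterra operator sends [F] to
the family [G] with
  [J (G t x) = \int_0^t T (t - r) (C (F r x)) dr],
the perturbed generator consists of the pairs [(x, y)] with [x + C x = J y], and
the variation of parameters formula reads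
  [J (S t x) = J (T t x) + \int_0^t T (t - r) (C (S r x)) dr].

Existence. The Volterra operator is a strict contraction on the families over
[[0, t0]], so Picard iteration solves the equation there ([volterra_solution]).
Applied to rank-one families, the same contraction shows that a vector-valued
solution of the homogeneous equation over a shorter interval vanishes
([volterra_unique]). Since [r |-> S (r + s) x] and [r |-> S r (S s x)] solve the
same equation, uniqueness gives the semigroup law as long as [r + s <= t0], and
[S t = (S (t / n))^n] with [n] large extends [S] to a semigroup on the half-line,
which still satisfies the variation of parameters formula
([extension_semigroup], [extension_volterra]).

Generator. The key fact on [A] is that its graph is closed under bounded
[tau]-convergent sequences ([generator_closed]), a consequence of a mean value
inequality for orbits. If [y] is the derivative at [0] of [S t x], then [J]
applied to the difference quotients of [S] is the sum of the difference quotients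
of [T] at [J x] and of means of the convolution integrand, and therefore tends to
[x + C x]; by closedness [x + C x = J y] ([generator_sub_perturbed]).
Conversely, given [x + C x = J y], put [k t = x + \int_0^t S s y ds]. The inclusion
already proved, applied to the integrated orbit, gives [k r + C (k r) = J (S r y)].
It follows that [r |-> T (t - r) (J (k r))] has right derivative
[T (t - r) (C (k r))], hence that [k] solves the equation satisfied by
[t |-> S t x]. Uniqueness gives [k t = S t x], and differentiating [k] at [0] gives
[y] ([perturbed_sub_generator]). *)

(** * Seminorms and linear operators *)

Section Seminorms.
Context {R : realType} {K : scalars R}.
Implicit Types (Y Z : lmodType K) (X : normedModType K).

Lemma ofR_ge0 (a : R) : (0 <= ofR a :> K) = (0 <= a).
Proof. by rewrite -(rmorph0 (@ofR R K)) ofR_le. Qed.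

Lemma ofR_norm (a : R) : `|ofR a : K| = ofR `|a|.
Proof.
case: (lerP 0 a) => a0; first by rewrite !ger0_norm ?ofR_ge0.
by rewrite -normrN -rmorphN (ltr0_norm a0) ger0_norm // ofR_ge0 oppr_ge0 ltW.
Qed.

Lemma ofR_lt (a b : R) : (ofR a < ofR b :> K) = (a < b).
Proof. by rewrite !lt_neqAle ofR_le (inj_eq (fmorph_inj _)). Qed.

Lemma seminorm_scaleR Y (p : seminorm Y) (a : R) x :
  p ((ofR a : K) *: x) = `|a| * p x.
Proof.
by apply: (fmorph_inj (@ofR R K)); rewrite seminormZ ofR_norm rmorphM.
Qed.

(** The modulus of a scalar lives in [K], the value of a seminorm in [R]; this
moves the homogeneity of seminorms to [R]. *)
Lemma seminorm_scale Y (a : K) :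
  exists2 c : R, 0 <= c & forall (p : seminorm Y) x, p (a *: x) = c * p x.
Proof.
have [c ac] := ofR_onto (normr_real a).
exists c; first by rewrite -(@ofR_le R K) rmorph0 -ac.
by move=> p x; apply: (fmorph_inj (@ofR R K)); rewrite seminormZ ac rmorphM.
Qed.

Lemma seminormC Y (p : seminorm Y) x y : p (x - y) = p (y - x).
Proof. by rewrite -opprB seminormN. Qed.

Lemma seminorm_triangle Y (p : seminorm Y) z x y :
  p (x - y) <= p (x - z) + p (z - y).
Proof. by rewrite -{1}[x](subrK z) -addrA seminormD. Qed.

Lemma seminorm_le_sub Y (p : seminorm Y) x y : p x <= p (x - y) + p y.
Proof. by rewrite -{1}[x](subrK y) seminormD. Qed.

Lemma seminormB Y (p : seminorm Y) x y : p (x - y) <= p x + p y.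
Proof. by rewrite -(seminormN p y) seminormD. Qed.

Lemma normR_ge0 X (x : X) : 0 <= normR x.
Proof. by rewrite -(@ofR_le R K) rmorph0 normRE. Qed.

Lemma normR_subadd X (x y : X) : normR (x + y) <= normR x + normR y.
Proof. by rewrite -(@ofR_le R K) rmorphD !normRE ler_normD. Qed.

Lemma normR_homog X (a : K) (x : X) :
  ofR (normR (a *: x)) = `|a| * ofR (normR x) :> K.
Proof. by rewrite !normRE normrZ. Qed.

(** The norm is itself packed as a seminorm, so that one estimate serves both
for [tau] and for the norm. *)
Definition norm_seminorm X : seminorm X :=
  Seminorm (@normR_subadd X) (@normR_homog X).

Lemma normR_scaleR X (a : R) (x : X) :
  normR ((ofR a : K) *: x) = `|a| * normR x.
Proof. exact: (seminorm_scaleR (norm_seminorm X)). Qed.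

Lemma normR0 X : normR (0 : X) = 0.
Proof. exact: (seminorm0 (norm_seminorm X)). Qed.

Lemma normRN X (x : X) : normR (- x) = normR x.
Proof. exact: (seminormN (norm_seminorm X)). Qed.

Lemma normRC X (x y : X) : normR (x - y) = normR (y - x).
Proof. exact: (seminormC (norm_seminorm X)). Qed.

Lemma normR_triangle X (z x y : X) :
  normR (x - y) <= normR (x - z) + normR (z - y).
Proof. exact: (seminorm_triangle (norm_seminorm X)). Qed.

Lemma normR_le_sub X (x y : X) : normR x <= normR (x - y) + normR y.
Proof. exact: (seminorm_le_sub (norm_seminorm X)). Qed.

Lemma normRB X (x y : X) : normR (x - y) <= normR x + normR y.
Proof. by rewrite -(normRN y) normR_subadd. Qed.

Lemma normR_eq0 X (x : X) : normR x <= 0 -> x = 0.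
Proof.
move=> h; apply/eqP; rewrite -normr_eq0 -normRE.
have -> : normR x = 0 by apply/eqP; rewrite eq_le h normR_ge0.
by rewrite rmorph0.
Qed.

Lemma linear_add Y Z (f : Y -> Z) : linear f -> {morph f : x y / x + y}.
Proof. by move=> h x y; have := h 1 x y; rewrite !scale1r. Qed.

Lemma linear_zero Y Z (f : Y -> Z) : linear f -> f 0 = 0.
Proof.
by move=> h; apply: (addIr (f 0)); rewrite -(linear_add h) !add0r.
Qed.

Lemma linear_scale Y Z (f : Y -> Z) : linear f ->
  forall (a : K) x, f (a *: x) = a *: f x.
Proof.
by move=> h a x; have := h a x 0; rewrite (linear_zero h) !addr0.
Qed.

Lemma linear_opp Y Z (f : Y -> Z) : linear f -> {morph f : x / - x}.
Proof. by move=> h x; rewrite -scaleN1r (linear_scale h) scaleN1r. Qed.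

Lemma linear_sub Y Z (f : Y -> Z) : linear f -> {morph f : x y / x - y}.
Proof. by move=> h x y; rewrite (linear_add h) (linear_opp h). Qed.

Lemma opnorm_ge0 X X' (f : X -> X') : (0 <= opnorm f)%E.
Proof.
apply: (@le_trans _ _ (normR (f 0))%:E); first by rewrite lee_fin normR_ge0.
by apply: ereal_sup_ubound; exists 0 => //=; rewrite normR0.
Qed.

Lemma opnorm_leP X X' (f : X -> X') (c : R) : linear f -> 0 <= c ->
  (opnorm f <= c%:E)%E <-> forall x, normR (f x) <= c * normR x.
Proof.
move=> lf c0; split=> [h x|h].
  have [x0|xn0] := eqVneq (normR x) 0.
    have -> : x = 0 by apply: normR_eq0; rewrite x0.
    by rewrite (linear_zero lf) !normR0 mulr0.
  have xp : 0 < normR x by rewrite lt_neqAle eq_sym xn0 normR_ge0.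
  have : ((normR (f ((ofR (normR x)^-1 : K) *: x)))%:E <= c%:E)%E.
    apply: le_trans h; apply: ereal_sup_ubound; eexists; last reflexivity.
    by rewrite /= normR_scaleR gtr0_norm ?invr_gt0 // mulVf.
  rewrite lee_fin (linear_scale lf) normR_scaleR gtr0_norm ?invr_gt0 //.
  by rewrite mulrC ler_pdivrMr.
apply: ge_ereal_sup => _ [x /= x1 <-]; rewrite lee_fin (le_trans (h x)) //.
by rewrite ler_piMr.
Qed.

Lemma bounded_operatorP X X' (f : X -> X') : bounded_operator f <->
  linear f /\ exists2 c : R, 0 <= c & forall x, normR (f x) <= c * normR x.
Proof.
split=> [[lf ff]|[lf [c c0 h]]]; split=> //.
  have ffin : opnorm f \is a fin_num by rewrite ge0_fin_numE // opnorm_ge0.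
  exists (fine (opnorm f)); first by rewrite fine_ge0 // opnorm_ge0.
  by apply/opnorm_leP; rewrite ?fineK // fine_ge0 // opnorm_ge0.
by apply: (@le_lt_trans _ _ c%:E); [apply/opnorm_leP|rewrite ltry].
Qed.

End Seminorms.

(** * Convergence and continuity, one seminorm at a time *)

Section Convergence.
Context {R : realType} {K : scalars R} {Y : lmodType K}.
Variable P : set (seminorm Y).

Definition tcvg (u : nat -> Y) (l : Y) : Prop :=
  forall p, P p -> forall e : R, 0 < e -> \forall n \near \oo, p (u n - l) < e.

Definition tcont_at (I : set R) (f : R -> Y) (t : R) : Prop :=
  forall p, P p -> forall e : R, 0 < e -> exists2 d : R, 0 < d &
    forall s, I s -> `|s - t| < d -> p (f s - f t) < e.

Definition tcont (I : set R) (f : R -> Y) : Prop :=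
  forall t, I t -> tcont_at I f t.

Lemma tcont_atB (I : set R) (f g : R -> Y) (t : R) : tcont_at I f t ->
  tcont_at I g t -> tcont_at I (fun r => f r - g r) t.
Proof.
move=> cf cg p Pp e e0; have e2 : 0 < e / 2 by rewrite divr_gt0.
have [d d0 hd] := cf p Pp _ e2; have [d' d'0 hd'] := cg p Pp _ e2.
exists (Num.min d d'); first by rewrite lt_min d0.
move=> s Is; rewrite lt_min => /andP[/(hd s Is) h1 /(hd' s Is) h2].
have -> : f s - g s - (f t - g t) = (f s - f t) - (g s - g t).
  by rewrite !opprD addrACA.
by apply: le_lt_trans (seminormB _ _ _) _; lra.
Qed.

Lemma tcont_atD (I : set R) (f g : R -> Y) (t : R) : tcont_at I f t ->
  tcont_at I g t -> tcont_at I (fun r => f r + g r) t.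
Proof.
move=> cf cg p Pp e e0; have e2 : 0 < e / 2 by rewrite divr_gt0.
have [d d0 hd] := cf p Pp _ e2; have [d' d'0 hd'] := cg p Pp _ e2.
exists (Num.min d d'); first by rewrite lt_min d0.
move=> s Is; rewrite lt_min => /andP[/(hd s Is) h1 /(hd' s Is) h2].
have -> : f s + g s - (f t + g t) = (f s - f t) + (g s - g t).
  by rewrite opprD addrACA.
by apply: le_lt_trans (seminormD _ _ _) _; lra.
Qed.

Lemma eq_tcont (I : set R) (f g : R -> Y) : (forall t, I t -> f t = g t) ->
  tcont I f -> tcont I g.
Proof.
move=> fg cf t It p Pp e e0; have [d d0 hd] := cf t It p Pp e e0.
by exists d => // s Is st; rewrite -!fg //; exact: hd.
Qed.

Lemma tcont_restrict (I I' : set R) (f : R -> Y) : (forall r, I' r -> I r) ->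
  tcont I f -> tcont I' f.
Proof.
move=> II' cf r Ir p Pp e e0; have [d d0 hd] := cf r (II' r Ir) p Pp e e0.
by exists d => // s /II'; exact: hd.
Qed.

(** A neighbourhood bounds finitely many seminorms of [P], hence membership in
it follows from one bound at a time. *)
Lemma finite_near (T : Type) (F : set_system T) (S : Type) (s : set S)
    (Q : S -> set T) : Filter F -> finite_set s ->
  (forall i, s i -> F (Q i)) -> F [set x | forall i, s i -> Q i x].
Proof.
elim/Pchoice: S => S in s Q *.
move=> FF /finite_fsetP[D ->] h.
by apply: filterS (@filter_bigI _ _ D Q F FF h) => x hx i; exact: hx.
Qed.

(** Here and in [tcontP], convergence and continuity for the topology of [P]
reduce to estimates on one seminorm at a time. *)
Lemma lcs_cvgP (T : Type) (F : set_system T) (f : T -> Y) (l : Y) :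
  Filter F -> (f : T -> lcs P) @ F --> (l : lcs P) <->
  forall p, P p -> forall e : R, 0 < e -> F [set x | p (f x - l) < e].
Proof.
move=> FF; split=> [h p Pp e e0|h].
  have : nbhs (l : lcs P) (lcs_ball (l : lcs P) ([set p], e)).
    rewrite nbhs_lcsE; exists ([set p], e) => //; split=> //=.
    by move=> _ ->.
  move=> /h; rewrite nbhs_filterE => hF.
  by apply: (@filterS _ _ FF (f @^-1` _) _ _ hF) => x /(_ p erefl).
move=> U; rewrite nbhs_lcsE => -[[s d] [/= sf sP d0] sU].
rewrite nbhs_filterE /=.
apply: filterS (finite_near FF sf (fun p sp => h p (sP _ sp) _ d0)).
by move=> x hx; apply: sU => p ps; exact: hx.
Qed.

Lemma tcvgP u l : (u : nat -> lcs P) @ \oo --> (l : lcs P) <-> tcvg u l.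
Proof. exact: lcs_cvgP. Qed.

Lemma tcontP (I : set R) (f : R -> Y) :
  {within I, continuous (f : R -> lcs P)} <-> tcont I f.
Proof.
split=> [/subspace_continuousP h t It p Pp e e0|h].
  have /lcs_cvgP := h t It; move=> /(_ p Pp e e0).
  rewrite /within /= => /nbhs_ballP[d /= d0 hd]; exists d => // s Is sd.
  by apply: hd => //; rewrite /ball /= distrC.
apply/subspace_continuousP => t It; apply/lcs_cvgP => p Pp e e0.
have [d d0 hd] := h t It p Pp e e0.
rewrite /within /=; apply/nbhs_ballP; exists d => // s; rewrite /ball /= => sd Is.
by apply: hd => //; rewrite distrC.
Qed.

End Convergence.

(** * Intervals and small real numbers *)

Section Reals.
Context {R : realType}.

Definition Icc (a b : R) : set R := [set t | a <= t <= b].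

Lemma near_invn (e : R) : 0 < e -> \forall n \near \oo, n.+1%:R^-1 < e.
Proof.
move=> e0; exists (Num.truncn e^-1) => // n /= hn.
rewrite invf_plt ?posrE ?ltr0n // (lt_le_trans (truncnS_gt _)) //.
by rewrite ler_nat ltnS.
Qed.

Lemma invn_gt0 (n : nat) : 0 < n.+1%:R^-1 :> R.
Proof. by rewrite invr_gt0 ltr0n. Qed.

Lemma near_geometric (c q e : R) : 0 <= q -> q < 1 -> 0 < e ->
  \forall n \near \oo, c * q ^+ n < e.
Proof.
move=> q0 q1 e0.
have /cvgrPdist_lt/(_ _ e0) : geometric c q @ \oo --> 0.
  by apply: cvg_geometric; rewrite ger0_norm.
apply: filterS => n; rewrite sub0r normrN /geometric /=.
exact: le_lt_trans (ler_norm _).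
Qed.

Lemma ler_addeps (a b : R) : (forall e, 0 < e -> a <= b + e) -> a <= b.
Proof. by move=> h; apply/ler_addgt0Pr. Qed.

End Reals.

(** * Sequences in a bi-continuous setting *)

Section Setting.
Context {R : realType} {K : scalars R} {X : completeNormedModType K}.
Variable P : set (seminorm X).
Hypothesis hX : bicontinuous_setting P.
Implicit Types (x y : X) (u v : nat -> X).

Lemma seminorm_le_norm p x : P p -> p x <= normR x.
Proof.
move=> Pp; rewrite -lee_fin (tau_seminorms hX).
by apply: ereal_sup_ubound; exists p.
Qed.

Lemma norm_le_seminorms x (c : R) : (forall p, P p -> p x <= c) -> normR x <= c.
Proof.
move=> h; rewrite -lee_fin (tau_seminorms hX).
by apply: ge_ereal_sup => _ [p Pp <-]; rewrite lee_fin h.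
Qed.

Lemma eq_seminorms x y :
  (forall p, P p -> forall e, 0 < e -> p (x - y) <= e) -> x = y.
Proof.
move=> h; apply/eqP; rewrite -subr_eq0; apply/eqP/normR_eq0.
apply: norm_le_seminorms => p Pp; apply: ler_addeps => e e0.
by rewrite add0r h.
Qed.

Lemma tcvg_unique u x y : tcvg P u x -> tcvg P u y -> x = y.
Proof.
move=> hx hy; apply: eq_seminorms => p Pp e e0.
have e2 : 0 < e / 2 by rewrite divr_gt0.
near \oo => n.
have h1 : p (u n - x) < e / 2 by near: n; exact: hx.
have h2 : p (u n - y) < e / 2 by near: n; exact: hy.
have := seminorm_triangle p (u n) x y; rewrite (seminormC p x (u n)); lra.
Unshelve. all: by end_near. Qed.

Definition bounded_seq u : Prop := exists C : R, forall n, normR (u n) <= C.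

Lemma tau_complete_seq u : bounded_seq u ->
  (forall p, P p -> forall e, 0 < e -> \forall N \near \oo,
     forall m n : nat, (N <= m)%N -> (N <= n)%N -> p (u m - u n) < e) ->
  exists l, tcvg P u l.
Proof.
move=> bu cu.
suff /(tau_complete hX bu)[l /tcvgP hl] : cauchy ((u : nat -> lcs P) @ \oo).
  by exists l.
move=> E [[s d] [/= sf sP d0] sE].
have [N _ hN] := finite_near (_ : Filter \oo) sf (fun p sp => cu p (sP _ sp) _ d0).
have uN : ((u : nat -> lcs P) @ \oo) (u @` [set n | (N <= n)%N]).
  by exists N => // n /= Nn; exists n.
exists (u @` [set n | (N <= n)%N], u @` [set n | (N <= n)%N]) => //.
move=> [x y] [/= [m Nm <-] [n Nn <-]]; apply: sE => p ps /=.
exact: (hN N (leqnn N) p ps).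
Qed.

(** Norm completeness comes from [tau]-completeness: a norm-Cauchy sequence is
bounded and [tau]-Cauchy, and its [tau]-limit is a norm limit because the norm
is the supremum of the seminorms. *)
Lemma geometric_limit u (c q : R) : 0 <= q -> q < 1 ->
  (forall n, normR (u n.+1 - u n) <= c * q ^+ n) ->
  exists l, forall n, normR (u n - l) <= c / (1 - q) * q ^+ n.
Proof.
move=> q0 q1 h; have q1' : 0 < 1 - q by lra.
have c0 : 0 <= c.
  by have := h 0%N; rewrite expr0 mulr1; apply: le_trans; exact: normR_ge0.
pose c' := c / (1 - q).
have c'0 : 0 <= c' by rewrite divr_ge0 // ltW.
have cE : c = c' * (1 - q) by rewrite /c' divfK // gt_eqF.
have hk n k : normR (u (n + k)%N - u n) <= c' * q ^+ n - c' * q ^+ (n + k).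
  elim: k => [|k IH]; first by rewrite addn0 !subrr normR0.
  have := normR_triangle (u (n + k)%N) (u (n + k).+1) (u n).
  rewrite addnS => /le_trans; apply.
  have h1 := h (n + k)%N; apply: (le_trans (lerD h1 IH)).
  by clearbody c'; rewrite cE exprS; lra.
have hmn n m : (n <= m)%N -> normR (u n - u m) <= c' * q ^+ n.
  move=> nm; rewrite normRC -(subnKC nm).
  by apply: (le_trans (hk _ _)); rewrite lerBlDr lerDl mulr_ge0 // exprn_ge0.
have [||l hl] := @tau_complete_seq u.
- exists (c' + normR (u 0%N)) => n.
  have := normR_le_sub (u n) (u 0%N).
  have := hmn 0%N n (leq0n n).
  by rewrite normRC expr0; lra.
- move=> p Pp e e0; have e2 : 0 < e / 2 by lra.
  apply: filterS (near_geometric c' q0 q1 e2) => N hN m n Nm Nn.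
  have := seminorm_triangle p (u N) (u m) (u n).
  have := seminorm_le_norm (u N - u m) Pp.
  have := seminorm_le_norm (u N - u n) Pp.
  have := hmn _ _ Nm; have := hmn _ _ Nn; rewrite (seminormC p (u m) (u N)); lra.
exists l => n; apply: norm_le_seminorms => p Pp; apply: ler_addeps => e e0.
near \oo => m.
have nm : (n <= m)%N by near: m; exists n.
have h1 : p (u m - l) < e by near: m; exact: hl.
have := seminorm_triangle p (u m) (u n) l.
have := seminorm_le_norm (u n - u m) Pp; have := hmn _ _ nm; rewrite -/c'; lra.
Unshelve. all: by end_near. Qed.

End Setting.

(** * Tagged partitions and Riemann sums *)

Section Partitions.
Context {R : realType} {K : scalars R} {Y : lmodType K}.
Implicit Types (f : R -> Y) (p : seminorm Y) (s : seq (R * R)).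

Lemma tagged_partition_le (d a b : R) s : tagged_partition d a b s -> a <= b.
Proof.
elim: s a => [a ->//|[xi t] s IH] a /= [h1 h2 _ /IH]; lra.
Qed.

Lemma tagged_partition_mesh (d d' a b : R) s : d <= d' ->
  tagged_partition d a b s -> tagged_partition d' a b s.
Proof.
move=> dd; elim: s a => [//|[xi t] s IH] a /= [h1 h2 h3 h4].
by split=> //; [lra|exact: IH].
Qed.

Lemma tagged_partition_exists (d a b : R) : 0 < d -> a <= b ->
  exists s, tagged_partition d a b s.
Proof.
move=> d0 ab; have d2 : 0 < d / 2 by rewrite divr_gt0.
have [n] : exists n : nat, b - a <= n%:R * (d / 2).
  exists (Num.truncn ((b - a) / (d / 2))).+1.
  by rewrite -ler_pdivrMr // ltW // truncnS_gt.
elim: n a ab => [|n IH] a ab h; first by exists [::] => /=; lra.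
have [le|lt] := lerP (b - a) (d / 2).
  by exists [:: (a, b)] => /=; split=> //; lra.
have [||s hs] := IH (a + d / 2); [by lra|by rewrite -natr1 in h; lra|].
by exists ((a, a + d / 2) :: s) => /=; split=> //; lra.
Qed.

Lemma tagged_partition_cat (d a b c : R) s s' : tagged_partition d a b s ->
  tagged_partition d b c s' -> tagged_partition d a c (s ++ s').
Proof.
elim: s a => [a -> //|[xi t] s IH] a /= [h1 h2 h3 h4] h'.
by split=> //; exact: IH.
Qed.

Lemma riemann_sum_cat f (d a b : R) s s' : tagged_partition d a b s ->
  riemann_sum f a (s ++ s') = riemann_sum f a s + riemann_sum f b s'.
Proof.
elim: s a => [|[xi t] s IH] a /=; first by move=> ->; rewrite add0r.
by move=> [_ _ _ h]; rewrite (IH _ h) addrA.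
Qed.

Lemma tagged_partition_shift (d a b c : R) s : tagged_partition d a b s ->
  tagged_partition d (a + c) (b + c) [seq (x.1 + c, x.2 + c) | x <- s].
Proof.
elim: s a => [a -> //|[xi t] s IH] a /= [h1 h2 h3 h4].
by split; [lra|lra|lra|exact: IH].
Qed.

Lemma riemann_sum_shift f (a c : R) s :
  riemann_sum f (a + c) [seq (x.1 + c, x.2 + c) | x <- s] =
  riemann_sum (fun r => f (r + c)) a s.
Proof.
elim: s a => [//|[xi t] s IH] a /=.
by rewrite IH opprD addrACA subrr addr0.
Qed.

Lemma riemann_sum_linear {Z : lmodType K} (L : Y -> Z) f (a : R) s : linear L ->
  riemann_sum (fun r => L (f r)) a s = L (riemann_sum f a s).
Proof.
move=> lL; elim: s a => [|[xi t] s IH] a /=; first by rewrite (linear_zero lL).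
by rewrite IH (linear_add lL) (linear_scale lL).
Qed.

Lemma riemann_sumB f g (a : R) s :
  riemann_sum (fun r => f r - g r) a s = riemann_sum f a s - riemann_sum g a s.
Proof.
elim: s a => [|[xi t] s IH] a /=; first by rewrite subrr.
by rewrite IH scalerBr opprD addrACA.
Qed.

Lemma eq_riemann_sum f g (d a b : R) s :
  (forall r, a <= r <= b -> f r = g r) -> tagged_partition d a b s ->
  riemann_sum f a s = riemann_sum g a s.
Proof.
elim: s a => [//|[xi t] s IH] a /= fg [h1 h2 h3 h4].
have tb := tagged_partition_le h4.
rewrite fg; last by apply/andP; split; lra.
by rewrite (IH t) // => r /andP[r1 r2]; apply: fg; apply/andP; split; lra.
Qed.

(** If a function of intervals is additive, an error bound on each cell sums up
to an error bound for the whole Riemann sum. *)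
Lemma riemann_sum_error p f (Phi : R -> Y) (d e a0 a b : R) s :
  a0 <= a ->
  (forall u xi t, a0 <= u -> u <= xi -> xi <= t -> t <= b -> t - u < d ->
     p (Phi t - Phi u - (ofR (t - u) : K) *: f xi) <= e * (t - u)) ->
  tagged_partition d a b s ->
  p (Phi b - Phi a - riemann_sum f a s) <= e * (b - a).
Proof.
move=> + h; elim: s a => [|[xi t] s IH] a aa /= => [->|[h1 h2 h3 h4]].
  by rewrite !subrr seminorm0 mulr0.
have tb := tagged_partition_le h4.
have -> : Phi b - Phi a - ((ofR (t - a) : K) *: f xi + riemann_sum f t s) =
  (Phi t - Phi a - (ofR (t - a) : K) *: f xi) + (Phi b - Phi t - riemann_sum f t s).
  have -> : Phi b - Phi a = (Phi t - Phi a) + (Phi b - Phi t).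
    by rewrite [RHS]addrC addrA subrK.
  by rewrite opprD addrACA.
have := h a xi t aa h1 h2 tb h3; have := IH t _ h4.
have -> : a0 <= t by lra.
move=> /(_ isT) hA hB; apply: le_trans (seminormD _ _ _) _; lra.
Qed.

(** Partitions whose tags are only close to their cells: unlike tagged
partitions, they stay such when a cell is cut in two, so that two of them can
be compared by walking along both. *)
Fixpoint near_partition (a0 b0 d a b : R) s : Prop :=
  if s is (xi, t) :: s' then
    [/\ a0 <= xi <= b0, a <= t, `|xi - a| < d, `|xi - t| < d &
        near_partition a0 b0 d t b s']
  else a = b.

Lemma near_tagged_partition (a0 b0 d a b : R) s : a0 <= a -> b <= b0 ->
  tagged_partition d a b s -> near_partition a0 b0 d a b s.
Proof.
move=> + bb; elim: s a => [//|[xi t] s IH] a aa /= [h1 h2 h3 h4].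
have tb := tagged_partition_le h4.
split; [apply/andP; split; lra|lra| | |apply: IH => //; lra].
  by rewrite ger0_norm; lra.
by rewrite ler0_norm; lra.
Qed.

Lemma near_partition_le (a0 b0 d a b : R) s :
  near_partition a0 b0 d a b s -> a <= b.
Proof. by elim: s a => [a ->//|[xi t] s IH] a /= [_ h _ _ /IH]; lra. Qed.

Lemma riemann_sum_compare p f (a0 b0 d e : R) :
  0 <= e ->
  (forall u v, a0 <= u <= b0 -> a0 <= v <= b0 -> `|u - v| < d + d ->
     p (f u - f v) <= e) ->
  forall n s s' a b, (size s + size s' <= n)%N ->
  near_partition a0 b0 d a b s -> near_partition a0 b0 d a b s' ->
  p (riemann_sum f a s - riemann_sum f a s') <= e * (b - a).
Proof.
move=> e0 h; have trivial_cells s b : near_partition a0 b0 d b b s ->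
    riemann_sum f b s = 0.
  elim: s => [//|[xi t] s IH] /= [_ h1 _ _ h2].
  have := near_partition_le h2 => h3; have tb : t = b by apply/le_anti; rewrite h1 h3.
  by rewrite tb in h2 *; rewrite IH // subrr rmorph0 scale0r addr0.
have step xi eta t u a b s s' n :
    (forall s s' a b, (size s + size s' <= n)%N ->
      near_partition a0 b0 d a b s -> near_partition a0 b0 d a b s' ->
      p (riemann_sum f a s - riemann_sum f a s') <= e * (b - a)) ->
    (size s + (size s').+1 <= n)%N -> t <= u ->
    near_partition a0 b0 d a b ((xi, t) :: s) ->
    near_partition a0 b0 d a b ((eta, u) :: s') ->
    p (riemann_sum f a ((xi, t) :: s) - riemann_sum f a ((eta, u) :: s'))
      <= e * (b - a).
  move=> IH sz tu /= [x1 x2 x3 x4 x5] [y1 y2 y3 y4 y5].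
  have -> : (ofR (t - a) : K) *: f xi + riemann_sum f t s -
      ((ofR (u - a) : K) *: f eta + riemann_sum f u s') =
      (ofR (t - a) : K) *: (f xi - f eta) +
      (riemann_sum f t s - riemann_sum f t ((eta, u) :: s')).
    rewrite /= scalerBr addrACA -opprD addrA -scalerDl -rmorphD.
    by rewrite (_ : t - a + (u - t) = u - a) //; ring.
  apply: le_trans (seminormD _ _ _) _; rewrite seminorm_scaleR.
  have A1 : p (f xi - f eta) <= e.
    apply: h => //; apply: le_lt_trans (ler_distD a _ _) _.
    by rewrite (distrC a); exact: ltrD.
  have A2 : p (riemann_sum f t s - riemann_sum f t ((eta, u) :: s')) <= e * (b - t).
    apply: IH => //=; split=> //.
    by move: y3 y4; rewrite !ltr_norml => /andP[? ?] /andP[? ?]; apply/andP; split; lra.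
  have ta : 0 <= t - a by lra.
  rewrite (ger0_norm ta).
  have := ler_wpM2l ta A1; lra.
elim=> [|n IH] [|[xi t] s] [|[eta u] s'] a b //= sz.
- by move=> -> _; rewrite !subrr seminorm0 mulr0.
- by move=> -> _; rewrite !subrr seminorm0 mulr0.
- move=> -> /(trivial_cells ((eta, u) :: s')) /= ->.
  by rewrite !subrr seminorm0 mulr0.
- move=> /[swap] -> /(trivial_cells ((xi, t) :: s)) /= ->.
  by rewrite !subrr seminorm0 mulr0.
move=> h1 h2; have [tu|ut] := leP t u.
  by apply: (@step xi eta t u a b s s' n).
rewrite seminormC; apply: (@step eta xi u t a b s' s n) => //; last exact: ltW.
by rewrite addnS addnC -addnS -ltnS.
Qed.

End Partitions.

(** * The Riemann integral for a family of seminorms *)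

Section IntegralDefinition.
Context {R : realType} {K : scalars R} {Y : lmodType K}.
Variable P : set (seminorm Y).
Implicit Types (f g : R -> Y).

Definition is_rint f (a b : R) (v : Y) : Prop :=
  forall p, P p -> forall e : R, 0 < e -> exists2 d : R, 0 < d &
    forall s, tagged_partition d a b s -> p (riemann_sum f a s - v) < e.

Lemma riemann_integralP f (a b : R) v :
  is_riemann_integral P f a b v <-> is_rint f a b v.
Proof.
have FF : Filter (mesh_to0 a b).
  apply: filter_from_filter; first by exists 1 => /=.
  move=> d d' /= d0 d'0; exists (Num.min d d'); first by rewrite /= lt_min d0.
  by move=> s h; split; apply: tagged_partition_mesh h; rewrite ge_min lexx ?orbT.
exact: lcs_cvgP.
Qed.

Lemma eq_rint f g (a b : R) v : (forall r, a <= r <= b -> f r = g r) ->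
  is_rint f a b v -> is_rint g a b v.
Proof.
move=> fg h p Pp e e0; have [d d0 hd] := h p Pp e e0.
by exists d => // s hs; rewrite -(eq_riemann_sum fg hs) hd.
Qed.

Lemma rintB f g (a b : R) v w : is_rint f a b v -> is_rint g a b w ->
  is_rint (fun r => f r - g r) a b (v - w).
Proof.
move=> hf hg p Pp e e0; have e2 : 0 < e / 2 by rewrite divr_gt0.
have [d d0 hd] := hf p Pp _ e2; have [d' d'0 hd'] := hg p Pp _ e2.
exists (Num.min d d'); first by rewrite lt_min d0.
move=> s hs; rewrite riemann_sumB.
have -> : riemann_sum f a s - riemann_sum g a s - (v - w) =
  (riemann_sum f a s - v) - (riemann_sum g a s - w) by rewrite !opprD addrACA.
have h1 : p (riemann_sum f a s - v) < e / 2.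
  by apply/hd/(tagged_partition_mesh _ hs); rewrite ge_min lexx.
have h2 : p (riemann_sum g a s - w) < e / 2.
  by apply/hd'/(tagged_partition_mesh _ hs); rewrite ge_min lexx orbT.
by apply: le_lt_trans (seminormB _ _ _) _; lra.
Qed.

Lemma rintZ (k : K) f (a b : R) v : is_rint f a b v ->
  is_rint (fun r => k *: f r) a b (k *: v).
Proof.
move=> h p Pp e e0; have [c c0 hc] := @seminorm_scale _ _ Y k.
have c1 : 0 < c + 1 by lra.
have [d d0 hd] := h p Pp _ (divr_gt0 e0 c1); exists d => // s hs.
have lk : linear (fun y : Y => k *: y).
  by move=> z y y'; rewrite scalerDr !scalerA mulrC.
rewrite (riemann_sum_linear f a s lk) -scalerBr hc.
have := hd _ hs; rewrite ltr_pdivlMr // mulrDr mulr1 (mulrC _ c).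
by have := seminorm_ge0 p (riemann_sum f a s - v); lra.
Qed.

Lemma rint_shift f (a b c : R) v : is_rint f (a + c) (b + c) v ->
  is_rint (fun r => f (r + c)) a b v.
Proof.
move=> h p Pp e e0; have [d d0 hd] := h p Pp e e0.
exists d => // s hs; rewrite -riemann_sum_shift; apply: hd.
exact: tagged_partition_shift.
Qed.

(** If the increments of [Phi] are approximated on every small cell by
length times the value of [f] at the tag, the errors sum up to at most the
length of the interval times the relative precision. *)
Lemma rint_of_increments (Phi : R -> Y) f (a b : R) : a <= b ->
  (forall p, P p -> forall e, 0 < e -> exists2 d : R, 0 < d &
    forall u xi t, a <= u -> u <= xi -> xi <= t -> t <= b -> t - u < d ->
     p (Phi t - Phi u - (ofR (t - u) : K) *: f xi) <= e * (t - u)) ->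
  is_rint f a b (Phi b - Phi a).
Proof.
move=> ab h p Pp e e0.
have ba1 : 0 < b - a + 1 by lra.
have [d d0 hd] := h p Pp _ (divr_gt0 e0 ba1); exists d => // s hs.
rewrite seminormC; apply: le_lt_trans (riemann_sum_error (lexx a) hd hs) _.
by rewrite mulrAC ltr_pdivrMr // ltr_pM2l //; lra.
Qed.

(** Integrals are compared with constants by feeding the affine function
[t |-> t *: c] to [riemann_sum_error]. *)
Lemma rint_seminorm p f (a b : R) v (c : Y) (M : R) : P p -> a <= b ->
  is_rint f a b v -> (forall r, a <= r <= b -> p (f r - c) <= M) ->
  p (v - (ofR (b - a) : K) *: c) <= M * (b - a).
Proof.
move=> Pp ab h hM; apply: ler_addeps => e e0.
have [d d0 hd] := h p Pp e e0.
have [s hs] := tagged_partition_exists d0 ab.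
have := @riemann_sum_error _ _ _ p f (fun t => (ofR t : K) *: c) d M a a b s
  (lexx a) _ hs; rewrite -scalerBl -rmorphB => E.
have {}E : p ((ofR (b - a) : K) *: c - riemann_sum f a s) <= M * (b - a).
  apply: E => u xi t au ux xt tb _.
  rewrite -scalerBl -rmorphB -scalerBr seminorm_scaleR ger0_norm; last by lra.
  rewrite mulrC ler_wpM2r //; first by lra.
  by rewrite seminormC hM //; apply/andP; split; lra.
have := hd _ hs; rewrite seminormC in E.
have := seminorm_triangle p (riemann_sum f a s) v ((ofR (b - a) : K) *: c).
by rewrite (seminormC p v (riemann_sum f a s)); lra.
Qed.

End IntegralDefinition.

(** * Integrals of bounded continuous functions *)

Section Integral.
Context {R : realType} {K : scalars R} {X : completeNormedModType K}.
Variable P : set (seminorm X).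
Hypothesis hX : bicontinuous_setting P.
Implicit Types (f g : R -> X).

Definition bounded_on (I : set R) f : Prop :=
  exists C : R, forall t, I t -> normR (f t) <= C.

Lemma bounded_on_restrict (I I' : set R) f : (forall r, I' r -> I r) ->
  bounded_on I f -> bounded_on I' f.
Proof. by move=> II' [B hB]; exists B => r /II'/hB. Qed.

Lemma bounded_onD (I : set R) f g : bounded_on I f -> bounded_on I g ->
  bounded_on I (fun r => f r + g r).
Proof.
move=> [B hB] [D hD]; exists (B + D) => r Ir; apply: le_trans (normR_subadd _ _) _.
by apply: lerD; [exact: hB|exact: hD].
Qed.

Lemma bounded_onB (I : set R) f g : bounded_on I f -> bounded_on I g ->
  bounded_on I (fun r => f r - g r).
Proof.
move=> [B hB] [D hD]; exists (B + D) => r Ir; apply: le_trans (normRB _ _) _.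
by apply: lerD; [exact: hB|exact: hD].
Qed.

Lemma eq_bounded_on (I : set R) f g : (forall t, I t -> f t = g t) ->
  bounded_on I f -> bounded_on I g.
Proof. by move=> fg [B hB]; exists B => r Ir; rewrite -fg //; exact: hB. Qed.

Lemma uniform_tcont f (a b : R) p (e : R) : tcont P (Icc a b) f -> P p ->
  0 < e -> exists2 d : R, 0 < d & forall u v, a <= u <= b -> a <= v <= b ->
    `|u - v| < d -> p (f u - f v) < e.
Proof.
move=> hf Pp e0; have e2 : 0 < e / 2 by rewrite divr_gt0.
pose Q (d u : R) := forall v, a <= v <= b -> `|v - u| < d -> p (f v - f u) < e.
have /compact_near_coveringP/near_covering_withinP :=
  @segment_compact R a b.
move=> /(_ _ (0^'+ : set_system R) Q _) [].
  move=> u /=; rewrite in_itv /= => Iu.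
  have [d d0 hd] := hf u Iu p Pp _ e2; have d2 : 0 < d / 2 by rewrite divr_gt0.
  exists (ball u (d / 2), [set h : R | h < d / 2]).
    by split; [exact: nbhsx_ballx|exact: nbhs_right_lt].
  move=> [u' h] [/= uu hh] Iu'; rewrite in_itv /= in Iu' => v Iv vh.
  rewrite /ball /= in uu.
  have A1 := hd u' Iu' (_ : `|u' - u| < d).
  have A2 := hd v Iv (_ : `|v - u| < d).
  have {}A1 : p (f u' - f u) < e / 2 by apply: A1; rewrite distrC; lra.
  have {}A2 : p (f v - f u) < e / 2.
    apply: A2; apply: le_lt_trans (ler_distD u' _ _) _.
    by rewrite (distrC u'); lra.
  have := seminorm_triangle p (f u) (f v) (f u').
  by rewrite (seminormC p (f u)); lra.
move=> d /= d0 hd; exists (d / 2); first by rewrite divr_gt0.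
move=> u v Iu Iv uv; apply: (hd (d / 2)) => //=.
- by rewrite /ball_ /= sub0r normrN ger0_norm; lra.
- by rewrite divr_gt0.
Qed.

Lemma riemann_sum_norm f (C d a b : R) s :
  (forall r, a <= r <= b -> normR (f r) <= C) -> tagged_partition d a b s ->
  normR (riemann_sum f a s) <= C * (b - a).
Proof.
move=> hC hs.
have := @riemann_sum_error _ _ _ (norm_seminorm X) f (fun=> 0) d C a a b s
  (lexx a) _ hs; rewrite !sub0r oppr0 add0r /= normRN; apply.
move=> u xi t au ux xt tb _ /=; rewrite sub0r normRN normR_scaleR ger0_norm.
  by rewrite mulrC ler_wpM2r; [|lra|apply: hC; apply/andP; split; lra].
by lra.
Qed.

Lemma rint_unique f (a b : R) v w : a <= b ->
  is_rint P f a b v -> is_rint P f a b w -> v = w.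
Proof.
move=> ab hv hw; apply: (eq_seminorms hX) => p Pp e e0.
have := rint_seminorm Pp ab (rintB hv hw) (c := 0) (M := 0).
rewrite scaler0 subr0 mul0r => h; apply: le_trans (h _) (ltW e0) => r _.
by rewrite subrr subr0 seminorm0.
Qed.

Lemma rint_norm f (a b : R) v (C : R) : a <= b -> is_rint P f a b v ->
  (forall r, a <= r <= b -> normR (f r) <= C) -> normR v <= C * (b - a).
Proof.
move=> ab hv hC; apply: (norm_le_seminorms hX) => p Pp.
have := rint_seminorm Pp ab hv (c := 0) (M := C).
rewrite scaler0 subr0; apply => r hr; rewrite subr0.
by apply: le_trans (hC r hr); exact: (seminorm_le_norm hX).
Qed.

(** The Riemann sums along any sequence of partitions with mesh tending to [0]
form a norm-bounded [tau]-Cauchy sequence. *)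
Lemma rint_exists f (a b : R) : a <= b -> tcont P (Icc a b) f ->
  bounded_on (Icc a b) f -> exists v, is_rint P f a b v.
Proof.
move=> ab hf [C hC].
have /choice[s hs] : forall n, exists s, tagged_partition n.+1%:R^-1 a b s.
  by move=> n; apply: tagged_partition_exists => //; exact: invn_gt0.
have cmp p (e : R) : P p -> 0 < e -> exists2 d : R, 0 < d & forall s s',
    tagged_partition d a b s -> tagged_partition d a b s' ->
    p (riemann_sum f a s - riemann_sum f a s') < e.
  move=> Pp e0; have ba1 : 0 < b - a + 1 by lra.
  have eba : 0 < e / (b - a + 1) by rewrite divr_gt0.
  have [d d0 hd] := uniform_tcont hf Pp eba.
  exists (d / 2); first by rewrite divr_gt0.
  move=> s1 s2 h1 h2.
  have := @riemann_sum_compare _ _ _ p f a b (d / 2) (e / (b - a + 1)) (ltW eba)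
    _ _ s1 s2 a b (leqnn _) (near_tagged_partition (lexx _) (lexx _) h1)
    (near_tagged_partition (lexx _) (lexx _) h2).
  move=> E; apply: le_lt_trans (E _) _; last first.
    by rewrite mulrAC ltr_pdivrMr // ltr_pM2l //; lra.
  by move=> u v Iu Iv uv; apply/ltW/hd => //; lra.
have [||v hv] := @tau_complete_seq _ _ _ _ hX (fun n => riemann_sum f a (s n)).
- by exists (C * (b - a)) => n; exact: riemann_sum_norm hC (hs n).
- move=> p Pp e e0; have [d d0 hd] := cmp p e Pp e0.
  apply: filterS (near_invn d0) => N hN m n Nm Nn.
  have mono k : (N <= k)%N -> k.+1%:R^-1 <= d.
    move=> Nk; apply: le_trans (ltW hN).
    by rewrite lef_pV2 ?posrE ?ltr0n // ler_nat ltnS.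
  by apply: hd; apply: tagged_partition_mesh (hs _); exact: mono.
exists v => p Pp e e0; have e2 : 0 < e / 2 by rewrite divr_gt0.
have [d d0 hd] := cmp p _ Pp e2; exists d => // s' hs'.
near \oo => n.
have h1 : p (riemann_sum f a (s n) - v) < e / 2 by near: n; exact: hv.
have h2 : p (riemann_sum f a s' - riemann_sum f a (s n)) < e / 2.
  apply: hd => //; apply: tagged_partition_mesh (hs n); apply/ltW.
  by near: n; exact: near_invn.
have := seminorm_triangle p (riemann_sum f a (s n)) (riemann_sum f a s') v; lra.
Unshelve. all: by end_near. Qed.

Lemma rint_cat f (a b c : R) v w z : a <= b -> b <= c -> is_rint P f a b v ->
  is_rint P f b c w -> is_rint P f a c z -> z = v + w.
Proof.
move=> ab bc hv hw hz; apply: (eq_seminorms hX) => p Pp e e0.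
have e3 : 0 < e / 3 by rewrite divr_gt0.
have [d1 d10 hd1] := hv p Pp _ e3; have [d2 d20 hd2] := hw p Pp _ e3.
have [d3 d30 hd3] := hz p Pp _ e3.
pose d := Num.min d1 (Num.min d2 d3).
have d0 : 0 < d by rewrite !lt_min d10 d20.
have dd1 : d <= d1 by rewrite ge_min lexx.
have dd2 : d <= d2 by rewrite !ge_min lexx orbT.
have dd3 : d <= d3 by rewrite !ge_min lexx !orbT.
have [s hs] := tagged_partition_exists d0 ab.
have [s' hs'] := tagged_partition_exists d0 bc.
have h1 := hd1 _ (tagged_partition_mesh dd1 hs).
have h2 := hd2 _ (tagged_partition_mesh dd2 hs').
have h3 := hd3 _ (tagged_partition_mesh dd3 (tagged_partition_cat hs hs')).
rewrite (riemann_sum_cat f s' hs) in h3.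
have A1 := seminorm_triangle p (riemann_sum f a s + riemann_sum f b s') z (v + w).
have A2 := seminormD p (riemann_sum f a s - v) (riemann_sum f b s' - w).
rewrite addrACA -opprD in A2; rewrite (seminormC p z (_ + riemann_sum _ _ _)) in A1.
lra.
Qed.

(** Closedness along bounded [tau]-convergent sequences. Operators that are
sequentially [tau]-continuous on bounded sets have it, and so has the inverse of
a generator, merely because the generator is closed. *)
Definition biclosed (L : X -> X) : Prop := forall (u : nat -> X) (l m : X),
  bounded_seq u -> tcvg P u l ->
  bounded_seq (L \o u) -> tcvg P (L \o u) m -> m = L l.

(** Linear maps commute with Riemann sums, and these form bounded convergent
sequences, to which closedness applies. *)
Lemma rint_biclosed (L : X -> X) f (a b : R) v w : linear L -> biclosed L ->
  a <= b -> bounded_on (Icc a b) f -> bounded_on (Icc a b) (L \o f) ->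
  is_rint P f a b v -> is_rint P (L \o f) a b w -> w = L v.
Proof.
move=> lL cL ab [C hC] [D hD] hv hw.
have /choice[s hs] : forall n, exists s, tagged_partition n.+1%:R^-1 a b s.
  by move=> n; apply: tagged_partition_exists => //; exact: invn_gt0.
have cv g z : is_rint P g a b z -> tcvg P (fun n => riemann_sum g a (s n)) z.
  move=> hg p Pp e e0; have [d d0 hd] := hg p Pp e e0.
  apply: filterS (near_invn d0) => n hn; apply: hd.
  exact: tagged_partition_mesh (ltW hn) (hs n).
have E : L \o (fun n => riemann_sum f a (s n)) =
    (fun n => riemann_sum (L \o f) a (s n)).
  by apply/funext => n /=; rewrite -riemann_sum_linear.
apply: (cL (fun n => riemann_sum f a (s n))); first 1 last.
- exact: cv.
- by rewrite E; exists (D * (b - a)) => n; exact: riemann_sum_norm hD (hs n).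
- by rewrite E; exact: cv.
by exists (C * (b - a)) => n; exact: riemann_sum_norm hC (hs n).
Qed.

End Integral.

(** * The mean value inequality *)

Section MeanValue.
Context {R : realType} {K : scalars R} {Y : lmodType K}.

(** The set of times up to which the slope bound [M + e] holds is closed by
continuity, and its supremum can be passed unless it is the right end. *)
Lemma mean_value (p : seminorm Y) (g : R -> Y) (a b M : R) : a <= b -> 0 <= M ->
  (forall t, a <= t <= b -> forall e : R, 0 < e -> exists2 d : R, 0 < d &
     forall s, a <= s <= b -> `|s - t| < d -> p (g s - g t) < e) ->
  (forall s, a <= s -> s < b -> forall e : R, 0 < e -> exists2 d : R, 0 < d &
     forall h : R, 0 < h -> h < d -> s + h <= b ->
       p (g (s + h) - g s) <= (M + e) * h) ->
  p (g b - g a) <= M * (b - a).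
Proof.
move=> ab M0 cg dg.
suff slope e : 0 < e -> p (g b - g a) <= (M + e) * (b - a).
  apply: ler_addeps => e e0; have ba1 : 0 < b - a + 1 by lra.
  apply: le_trans (slope _ (divr_gt0 e0 ba1)) _.
  rewrite mulrDl lerD2l mulrAC ler_pdivrMr // ler_pM2l //; lra.
move=> e0; pose S := [set s | a <= s <= b /\ p (g s - g a) <= (M + e) * (s - a)].
have Sa : S a by split; rewrite ?lexx // !subrr seminorm0 mulr0.
have hS : has_sup S by split; [exists a|exists b => s [/andP[]]].
pose sg := sup S.
have asg : a <= sg by apply: ub_le_sup Sa; case: hS.
have sgb : sg <= b by apply: ge_sup; [exists a|move=> s [/andP[]]].
have Isg : a <= sg <= b by rewrite asg.
have Ssg : p (g sg - g a) <= (M + e) * (sg - a).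
  apply: ler_addeps => eta eta0; have [d d0 hd] := cg sg Isg eta eta0.
  have [s [Is hs] sd] := sup_adherent d0 hS.
  have ssg : s <= sg by apply: ub_le_sup; [case: hS|split].
  have h1 := hd s Is; have := seminorm_triangle p (g s) (g sg) (g a).
  have {}h1 : p (g s - g sg) < eta.
    by apply: h1; rewrite ler0_norm; rewrite -/sg in sd; lra.
  rewrite (seminormC p (g sg) (g s)).
  have : (M + e) * (s - a) <= (M + e) * (sg - a) by apply: ler_wpM2l; lra.
  lra.
have [sgE|sgb'] := eqVneq sg b; first by rewrite -sgE.
have {}sgb' : sg < b by rewrite lt_neqAle sgb'.
have [d d0 hd] := dg sg asg sgb' e e0.
pose h := Num.min (d / 2) (b - sg).
have h0 : 0 < h by rewrite lt_min divr_gt0 // subr_gt0.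
have hle : h <= d / 2 by rewrite ge_min lexx.
have hb : h <= b - sg by rewrite ge_min lexx orbT.
have Sh : S (sg + h).
  split; first by apply/andP; split; lra.
  have := hd h h0; have := seminorm_triangle p (g sg) (g (sg + h)) (g a) => A1.
  move=> /(_ _ _)A2; have {}A2 : p (g (sg + h) - g sg) <= (M + e) * h by apply: A2; lra.
  lra.
have : sg + h <= sg by apply: ub_le_sup Sh; case: hS.
lra.
Qed.

End MeanValue.

(** * Bi-equicontinuous families of operators *)

Section Families.
Context {R : realType} {K : scalars R} {X : completeNormedModType K}.
Variable P : set (seminorm X).
Hypothesis hX : bicontinuous_setting P.
Implicit Types (F G : R -> X -> X) (L : X -> X).

Definition equi_null (b : R) F : Prop := forall u, bounded_seq u -> tcvg P u 0 ->
  forall p, P p -> forall e : R, 0 < e ->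
  \forall n \near \oo, forall t, Icc 0 b t -> p (F t (u n)) < e.

(** The elements of the space on which the Volterra operator acts, with each
condition tested on one seminorm at a time. *)
Record tfamily (b : R) F : Prop := TFamily {
  tfam_linear : forall t, Icc 0 b t -> linear (F t);
  tfam_bounded : exists2 C : R, 0 <= C &
    forall t, Icc 0 b t -> forall x, normR (F t x) <= C * normR x;
  tfam_cont : forall x, tcont P (Icc 0 b) (F^~ x);
  tfam_equi : equi_null b F
}.

Lemma equi_nullP (b : R) F : bi_equicontinuous P (F @` `[0, b]) <-> equi_null b F.
Proof.
split=> [h u bu cu p Pp e e0|h u bu cu U].
  have U0 : nbhs (0 : lcs P) (lcs_ball (0 : lcs P) ([set p], e)).
    by rewrite nbhs_lcsE; exists ([set p], e) => //; split=> //= _ ->.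
  have := h u bu ((tcvgP (P := P) u 0).2 cu) _ U0; apply: filterS => n hn t It.
  have : (F @` `[0, b]) (F t) by exists t => //=; rewrite in_itv.
  by move=> /hn /(_ p erefl); rewrite subr0.
rewrite nbhs_lcsE => -[[s d] [/= sf sP d0] sU].
move/tcvgP in cu.
have := finite_near (_ : Filter \oo) sf (fun p sp => h u bu cu p (sP _ sp) d d0).
move=> /(_ _); apply: filterS => n hn _ [t /= It <-]; apply: sU => p ps /=.
by rewrite subr0; apply: hn => //; rewrite in_itv in It.
Qed.

Lemma in_XXP (b : R) F : in_XX P b F <-> tfamily b F.
Proof.
have I t : t \in `[0, b] <-> Icc 0 b t by rewrite in_itv.
have I' : [set` `[0, b]] = Icc 0 b by apply/seteqP; split=> t /=; rewrite in_itv.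
split=> [[h1 h2 [C h3] /equi_nullP h4]|[h1 [C C0 h2] h3 h4]].
  split=> //.
  - by move=> t /I/h1/bounded_operatorP[].
  - exists (Num.max C 0); first by rewrite le_max lexx orbT.
    move=> t /I It x; have /bounded_operatorP[lF _] := h1 t It.
    move: x; apply/opnorm_leP => //; first by rewrite le_max lexx orbT.
    by apply: le_trans (h3 t It) _; rewrite lee_fin le_max lexx.
  - by move=> x; have /tcontP := h2 x; rewrite I'.
split.
- move=> t /I It; apply/bounded_operatorP; split; first exact: h1.
  by exists C => //; exact: h2.
- by move=> x; apply/tcontP; rewrite I'; exact: h3.
- by exists C => t /I It; apply/opnorm_leP; [exact: h1| |exact: h2].
- exact/equi_nullP.
Qed.

Lemma XX_norm_leP (b c : R) F : tfamily b F -> 0 <= c ->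
  (XX_norm b F <= c%:E)%E <->
  forall t, Icc 0 b t -> forall x, normR (F t x) <= c * normR x.
Proof.
move=> hF c0; split=> h.
  move=> t It; apply/opnorm_leP => //; first exact: tfam_linear hF t It.
  by apply: le_trans h; apply: ereal_sup_ubound; exists t => //=; rewrite in_itv.
apply: ge_ereal_sup => _ [t /= It <-]; rewrite in_itv /= in It.
by apply/opnorm_leP => //; [exact: tfam_linear hF t It|exact: h].
Qed.

(** Joint continuity. Only null sequences are controlled uniformly by a
bi-equicontinuous family, but [R] is first countable, so a failure would be
witnessed along sequences. *)
Lemma tfamily_joint (b : R) F (I : set R) (g : R -> X) (s r : R) p (e : R) :
  tfamily b F -> bounded_on I g -> tcont_at P I g r -> I r -> Icc 0 b s ->
  P p -> 0 < e -> exists2 d : R, 0 < d & forall s' r', Icc 0 b s' -> I r' ->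
    `|s' - s| < d -> `|r' - r| < d -> p (F s' (g r') - F s (g r)) < e.
Proof.
move=> hF [C hC] cg Ir Is Pp e0; apply: contrapT => nd.
have /choice[w hw] : forall n : nat, exists w : R * R,
    [/\ Icc 0 b w.1, I w.2, `|w.1 - s| < n.+1%:R^-1, `|w.2 - r| < n.+1%:R^-1 &
     e <= p (F w.1 (g w.2) - F s (g r))].
  move=> n; apply: contrapT => H; apply: nd; exists n.+1%:R^-1 => //.
  move=> s' r' Is' Ir' hs hr; rewrite ltNge; apply/negP => he; apply: H.
  by exists (s', r').
have e2 : 0 < e / 2 by rewrite divr_gt0.
pose u n := g (w n).2 - g r.
have bu : bounded_seq u.
  exists (C + C) => n; apply: le_trans (normRB _ _) _.
  by apply: lerD; apply: hC => //; case: (hw n).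
have cu : tcvg P u 0.
  move=> q Pq eta eta0; have [d d0 hd] := cg q Pq eta eta0.
  apply: filterS (near_invn d0) => n hn; rewrite subr0.
  by case: (hw n) => _ h2 _ h4 _; apply: hd => //; exact: lt_trans h4 hn.
have [d d0 hd] := tfam_cont hF (g r) Is Pp e2.
near \oo => n.
have h1 : forall t, Icc 0 b t -> p (F t (u n)) < e / 2.
  by near: n; exact: tfam_equi hF u bu cu p Pp _ e2.
have hn : n.+1%:R^-1 < d by near: n; exact: near_invn.
case: (hw n) => A1 A2 A3 A4.
have := h1 _ A1; rewrite /u (linear_sub (tfam_linear hF A1)).
have := hd _ A1 (lt_trans A3 hn).
have := seminorm_triangle p (F (w n).1 (g r)) (F (w n).1 (g (w n).2)) (F s (g r)).
lra.
Unshelve. all: by end_near. Qed.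

Lemma tfamily_biclosed (b : R) F t : tfamily b F -> Icc 0 b t ->
  biclosed P (F t).
Proof.
move=> hF It u l m [C bu] cu _ cm.
suff h : tcvg P (F t \o u) (F t l).
  exact: (tcvg_unique hX cm h).
move=> p Pp e e0.
have b' : bounded_seq (fun n => u n - l).
  by exists (C + normR l) => n; apply: le_trans (normRB _ _) _; rewrite lerD2r.
have c' : tcvg P (fun n => u n - l) 0.
  by move=> q Pq eta eta0; under eq_near do rewrite subr0; exact: cu.
near=> n.
have : forall t, Icc 0 b t -> p (F t (u n - l)) < e.
  by near: n; exact: tfam_equi hF _ b' c' p Pp e e0.
move=> /(_ t It); rewrite (linear_sub (tfam_linear hF It)).
Unshelve. all: by end_near. Qed.

Lemma tfamily_sub F G b : tfamily b F -> tfamily b G ->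
  tfamily b (fun t x => F t x - G t x).
Proof.
move=> hF hG; split.
- move=> t It a x y; rewrite (tfam_linear hF It) (tfam_linear hG It).
  by rewrite scalerBr opprD addrACA.
- have [C C0 hC] := tfam_bounded hF; have [D D0 hD] := tfam_bounded hG.
  exists (C + D); first exact: addr_ge0.
  move=> t It x; apply: le_trans (normRB _ _) _; rewrite mulrDl.
  by apply: lerD; [exact: hC|exact: hD].
- move=> x t It; apply: tcont_atB; first exact: (tfam_cont hF x It).
  exact: (tfam_cont hG x It).
- move=> u bu cu p Pp e e0; have e2 : 0 < e / 2 by rewrite divr_gt0.
  near=> n => t It; apply: le_lt_trans (seminormB _ _ _) _.
  have h1 : forall t, Icc 0 b t -> p (F t (u n)) < e / 2.
    by near: n; exact: tfam_equi hF u bu cu p Pp _ e2.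
  have h2 : forall t, Icc 0 b t -> p (G t (u n)) < e / 2.
    by near: n; exact: tfam_equi hG u bu cu p Pp _ e2.
  by have := h1 t It; have := h2 t It; lra.
Unshelve. all: by end_near. Qed.

Lemma tfamily_scale (c : R) F b : tfamily b F ->
  tfamily b (fun t x => (ofR c : K) *: F t x).
Proof.
move=> hF; have c1 : 0 < `|c| + 1 by rewrite ltr_wpDl.
have small (p : seminorm X) x (e : R) : p x < e / (`|c| + 1) -> p ((ofR c : K) *: x) < e.
  rewrite seminorm_scaleR ltr_pdivlMr // mulrDr mulr1 mulrC => h.
  by have := seminorm_ge0 p x; lra.
split.
- move=> t It a x y; rewrite (tfam_linear hF It) scalerDr !scalerA.
  by rewrite (mulrC (ofR c)).
- have [C C0 hC] := tfam_bounded hF; exists (`|c| * C); first exact: mulr_ge0.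
  by move=> t It x; rewrite normR_scaleR -mulrA ler_wpM2l // hC.
- move=> x t It p Pp e e0.
  have [d d0 hd] := tfam_cont hF x It Pp (divr_gt0 e0 c1).
  by exists d => // s Is /(hd s Is)/small; rewrite scalerBr.
- move=> u bu cu p Pp e e0.
  have := tfam_equi hF bu cu Pp (divr_gt0 e0 c1).
  by apply: filterS => n hn t /hn/small.
Qed.

Lemma tfamily_add F G b : tfamily b F -> tfamily b G ->
  tfamily b (fun t x => F t x + G t x).
Proof.
move=> hF hG; have := tfamily_sub hF (tfamily_scale (-1) hG).
congr (tfamily _ _); apply/funext => t; apply/funext => x.
by rewrite rmorphN rmorph1 scaleN1r opprK.
Qed.

(** If equicontinuity of the composite failed along [u], pick for every [n] a
time [w n] at which the failure occurs whenever it occurs at all: then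
[G (w n) (u n)] is a null sequence along which the equicontinuity of [F] fails. *)
Lemma tfamily_comp F G b : tfamily b F -> tfamily b G ->
  tfamily b (fun t => F t \o G t).
Proof.
move=> hF hG; have [C C0 hC] := tfam_bounded hF; have [D D0 hD] := tfam_bounded hG.
split.
- move=> t It a x y /=.
  by rewrite (tfam_linear hG It) (tfam_linear hF It).
- exists (C * D); first exact: mulr_ge0.
  move=> t It x /=; apply: le_trans (hC t It _) _.
  by rewrite -mulrA ler_wpM2l // hD.
- move=> x t It p Pp e e0.
  have bG : bounded_on (Icc 0 b) (G^~ x).
    by exists (D * normR x) => s Is; exact: hD.
  have [d d0 hd] := tfamily_joint hF bG (tfam_cont hG x It) It It Pp e0.
  by exists d => // s Is st; exact: hd.
- move=> u [B bu] cu p Pp e e0; apply: contrapT => nh.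
  have bad : forall n : nat, exists w : R, Icc 0 b w /\ forall w',
      Icc 0 b w' -> e <= p (F w' (G w' (u n))) -> e <= p (F w (G w (u n))).
    move=> n; have [[w [Iw hw]]|no] :=
      pselect (exists w, Icc 0 b w /\ e <= p (F w (G w (u n)))).
      by exists w.
    have [[w Iw]|no'] := pselect (exists w, Icc 0 b w).
      by exists w; split=> // w' Iw' hw'; case: no; exists w'.
    case: nh; exists 0%N => // m _ t It; by case: no'; exists t.
  have {bad}/choice[w hw] := bad.
  have bGu : bounded_seq (fun n => G (w n) (u n)).
    exists (D * B) => n; apply: le_trans (hD _ (hw n).1 _) _.
    by rewrite ler_wpM2l.
  have cGu : tcvg P (fun n => G (w n) (u n)) 0.
    move=> q Pq eta eta0.
    have := tfam_equi hG (ex_intro _ B bu) cu Pq eta0.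
    by apply: filterS => n hn; rewrite subr0; exact: hn (hw n).1.
  apply: nh; have := tfam_equi hF bGu cGu Pp e0.
  apply: filterS => n hn t It; rewrite ltNge; apply/negP => /= he.
  have := (hw n).2 t It he; have := hn _ (hw n).1; lra.
Qed.

Lemma tfamily_reparam (phi : R -> R) (k : R) F b b' : 0 < k -> tfamily b F ->
  (forall t, Icc 0 b' t -> Icc 0 b (phi t)) ->
  (forall s t, `|phi s - phi t| <= k * `|s - t|) ->
  tfamily b' (fun t => F (phi t)).
Proof.
move=> k0 hF Iphi lip; split.
- by move=> t /Iphi It; exact: tfam_linear hF _ It.
- have [C C0 hC] := tfam_bounded hF; exists C => // t /Iphi It; exact: hC.
- move=> x t It p Pp e e0; have [d d0 hd] := tfam_cont hF x (Iphi t It) Pp e0.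
  exists (d / k) => [|s Is st]; first by rewrite divr_gt0.
  apply: hd; first exact: Iphi.
  by apply: le_lt_trans (lip s t) _; rewrite mulrC -ltr_pdivlMr.
- move=> u bu cu p Pp e e0; have := tfam_equi hF bu cu Pp e0.
  by apply: filterS => n hn t /Iphi; exact: hn.
Qed.

Lemma tfamily_shorten F b b' : b' <= b -> tfamily b F -> tfamily b' F.
Proof.
move=> bb hF; apply: (@tfamily_reparam id 1 F b b') => //.
- by move=> t /andP[t0 tb]; rewrite /Icc /= t0 (le_trans tb bb).
- by move=> s t; rewrite mul1r.
Qed.

Lemma tfamily_orbit_bounded (F : R -> X -> X) (b : R) x : tfamily b F ->
  bounded_on (Icc 0 b) (F^~ x).
Proof.
by move=> hF; have [D _ hD] := tfam_bounded hF; exists (D * normR x) => t /hD.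
Qed.

Lemma eq_tfamily (F G : R -> X -> X) (b : R) : (forall t, Icc 0 b t -> F t = G t) ->
  tfamily b F -> tfamily b G.
Proof.
move=> FG hF; split.
- by move=> t It; rewrite -FG //; exact: tfam_linear hF t It.
- have [D D0 hD] := tfam_bounded hF; exists D => // t It; rewrite -FG //; exact: hD.
- move=> x t It p Pp e e0; have [d d0 hd] := tfam_cont hF x It Pp e0.
  by exists d => // s Is st; rewrite -!FG //; exact: hd.
- move=> u bu cu p Pp e e0; have := tfam_equi hF bu cu Pp e0.
  by apply: filterS => n hn t It; rewrite -FG //; exact: hn.
Qed.

Lemma tfamily_const L b b' : tfamily b (fun=> L) -> 0 <= b ->
  tfamily b' (fun=> L).
Proof.
move=> hL b0; apply: (@tfamily_reparam (fun=> 0) 1 (fun=> L) b b') => //.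
- by move=> t _; rewrite /Icc /= lexx.
- by move=> s t; rewrite subrr normr0 mul1r.
Qed.

Lemma tfamily_id b : tfamily b (fun=> id).
Proof.
split=> //.
- by exists 1 => // t _ x; rewrite mul1r.
- by move=> x t It p Pp e e0; exists 1 => // s _ _; rewrite subrr seminorm0.
- move=> u bu cu p Pp e e0; have := cu p Pp e e0.
  by apply: filterS => n; rewrite subr0.
Qed.

(** Uniform convergence in operator norm dominates every seminorm in [P], so each
condition is inherited from a single term of the sequence. *)
Lemma tfamily_uniform_limit (Fn : nat -> R -> X -> X) F b (c q : R) :
  0 <= q -> q < 1 -> 0 <= c -> (forall n, tfamily b (Fn n)) ->
  (forall n t x, Icc 0 b t -> normR (Fn n t x - F t x) <= c * q ^+ n * normR x) ->
  tfamily b F.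
Proof.
move=> q0 q1 c0 hFn hlim.
have small C e : 0 < e -> exists n, forall t x, Icc 0 b t -> normR x <= C ->
    normR (Fn n t x - F t x) < e.
  move=> e0; near \oo => n; exists n => t x It xC.
  apply: le_lt_trans (hlim n t x It) _; apply: le_lt_trans (_ : _ <= C * c * q ^+ n) _.
    by rewrite mulrC mulrA ler_wpM2r ?exprn_ge0 // ler_wpM2r.
  by near: n; exact: near_geometric.
have pn (p : seminorm X) x : P p -> p x <= normR x.
  by move=> Pp; exact: (seminorm_le_norm hX).
have cv t x : Icc 0 b t -> tcvg P (fun n => Fn n t x) (F t x).
  move=> It p Pp e e0; have := near_geometric (c * normR x) q0 q1 e0.
  apply: filterS => n hn; apply: le_lt_trans (pn _ _ Pp) _.
  by apply: le_lt_trans (hlim n t x It) _; rewrite mulrAC.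
have [C C0 hC] := tfam_bounded (hFn 0%N).
split.
- move=> t It a x y; apply: (tcvg_unique hX (cv t _ It)) => p Pp e e0.
  have [k k0 hk] := @seminorm_scale _ _ X a; have k1 : 0 < k + 1 by lra.
  have e2 : 0 < e / 2 by rewrite divr_gt0.
  near=> n; rewrite (tfam_linear (hFn n) It) opprD addrACA -scalerBr.
  apply: le_lt_trans (seminormD _ _ _) _; rewrite hk.
  have h1 : p (Fn n t x - F t x) < e / 2 / (k + 1).
    by near: n; apply: cv => //; rewrite divr_gt0.
  have h2 : p (Fn n t y - F t y) < e / 2 by near: n; exact: cv.
  rewrite ltr_pdivlMr // mulrDr mulr1 (mulrC _ k) in h1.
  by have := seminorm_ge0 p (Fn n t x - F t x); lra.
- exists (C + c); first exact: addr_ge0.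
  move=> t It x; have := hlim 0%N t x It; have := hC t It x.
  rewrite expr0 mulr1 mulrDl => h1 h2.
  by have := normR_le_sub (F t x) (Fn 0%N t x); rewrite normRC; lra.
- move=> x t It p Pp e e0; have e3 : 0 < e / 3 by rewrite divr_gt0.
  have [n hn] := small (normR x) _ e3.
  have [d d0 hd] := tfam_cont (hFn n) x It Pp e3; exists d => // s Is /(hd s Is) h1.
  have h2 := le_lt_trans (pn _ _ Pp) (hn s x Is (lexx _)).
  have h3 := le_lt_trans (pn _ _ Pp) (hn t x It (lexx _)).
  have A1 := seminorm_triangle p (Fn n s x) (F s x) (F t x).
  have A2 := seminorm_triangle p (Fn n t x) (Fn n s x) (F t x).
  by rewrite (seminormC p (F s x) (Fn n s x)) in A1; lra.
- move=> u [B bu] cu p Pp e e0; have e2 : 0 < e / 2 by rewrite divr_gt0.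
  have [n hn] := small B _ e2.
  have := tfam_equi (hFn n) (ex_intro _ B bu) cu Pp e2.
  apply: filterS => m hm t It; have h1 := hm t It.
  have h2 := le_lt_trans (pn _ _ Pp) (hn t (u m) It (bu m)).
  by have := seminorm_le_sub p (F t (u m)) (Fn n t (u m)); rewrite seminormC; lra.
Unshelve. all: by end_near. Qed.

(** Rank-one operators turn vector-valued functions into families of operators,
so that hypotheses on families have consequences for single orbits. *)
Lemma tfamily_rank_one (phi : X -> K) (g : R -> X) (b D C : R) :
  linear (phi : X -> K^o) -> (forall x, `|phi x| <= ofR (D * normR x)) ->
  0 <= D -> 0 <= C ->
  (forall u, bounded_seq u -> tcvg P u 0 -> forall e : R, 0 < e ->
     \forall n \near \oo, `|phi (u n)| <= ofR e) ->
  tcont P (Icc 0 b) g -> (forall t, Icc 0 b t -> normR (g t) <= C) ->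
  tfamily b (fun t x => phi x *: g t).
Proof.
move=> lphi bphi D0 C0 cphi cg bg.
have pphi (p : seminorm X) x (c : R) y : `|phi x| <= ofR c -> p (phi x *: y) <= c * p y.
  move=> xc; rewrite -(@ofR_le R K) seminormZ rmorphM ler_wpM2r //.
  by rewrite ofR_ge0 seminorm_ge0.
split.
- move=> t It a x y; rewrite (linear_add lphi) (linear_scale lphi) scalerDl.
  by rewrite scalerA.
- exists (D * C); first exact: mulr_ge0.
  move=> t It x; apply: le_trans (pphi (norm_seminorm X) _ _ _ (bphi x)) _ => /=.
  by rewrite mulrAC ler_wpM2r ?normR_ge0 // ler_wpM2l // bg.
- move=> x t It p Pp e e0.
  have [c c0 hc] := @seminorm_scale _ _ X (phi x).
  have c1 : 0 < c + 1 by lra.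
  have [d d0 hd] := cg t It p Pp _ (divr_gt0 e0 c1).
  exists d => // s Is /(hd s Is); rewrite -scalerBr hc ltr_pdivlMr //.
  by rewrite mulrDr mulr1 (mulrC _ c); have := seminorm_ge0 p (g s - g t); lra.
- move=> u bu cu p Pp e e0; have C1 : 0 < C + 1 by lra.
  have := cphi u bu cu _ (divr_gt0 e0 C1).
  apply: filterS => n hn t It; apply: le_lt_trans (pphi p _ _ _ hn) _.
  rewrite mulrAC ltr_pdivrMr // ltr_pM2l //.
  by have := bg t It; have := seminorm_le_norm hX (g t) Pp; lra.
Qed.

End Families.

(** * Difference quotients *)

Section Quotients.
Context {R : realType} {K : scalars R} {X : completeNormedModType K}.
Variable P : set (seminorm X).
Implicit Types (delta : R -> X) (y : X).

(** A difference quotient extended at [0] by its expected limit, so that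
convergence as the increment tends to [0] is continuity at [0]. *)
Definition quotient delta y (h : R) : X :=
  if h == 0 then y else (ofR h^-1 : K) *: delta h.

Lemma quotient0 delta y : quotient delta y 0 = y.
Proof. by rewrite /quotient eqxx. Qed.

Lemma quotientK delta y (h : R) : h != 0 ->
  delta h = (ofR h : K) *: quotient delta y h.
Proof.
move=> h0; rewrite /quotient (negPf h0) scalerA -rmorphM mulfV //.
by rewrite rmorph1 scale1r.
Qed.

Lemma quotient_cont delta y :
  (forall p, P p -> forall e : R, 0 < e -> exists2 d : R, 0 < d &
     forall h : R, 0 < h -> h < d -> p (delta h - (ofR h : K) *: y) <= e * h) ->
  tcont_at P (Icc 0 1) (quotient delta y) 0.
Proof.
move=> H p Pp e e0; have e2 : 0 < e / 2 by rewrite divr_gt0.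
have [d d0 hd] := H p Pp _ e2; exists d => // h /andP[h0 _].
rewrite subr0 ger0_norm // quotient0 => hd'.
have [->|hn0] := eqVneq h 0; first by rewrite quotient0 subrr seminorm0.
have hp : 0 < h by rewrite lt_neqAle eq_sym hn0.
have := hd h hp hd'; rewrite (quotientK delta y hn0) -scalerBr.
by rewrite seminorm_scaleR gtr0_norm // mulrC ler_pM2r //; lra.
Qed.

Lemma quotient_bounded delta y (C : R) :
  (forall h : R, 0 < h -> h <= 1 -> normR (delta h) <= C * h) ->
  bounded_on (Icc 0 1) (quotient delta y).
Proof.
move=> hC; exists (Num.max C (normR y)) => h /andP[h0 h1].
have [->|hn0] := eqVneq h 0; first by rewrite quotient0 le_max lexx orbT.
have hp : 0 < h by rewrite lt_neqAle eq_sym hn0.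
have := hC h hp h1; rewrite (quotientK delta y hn0) normR_scaleR.
by rewrite gtr0_norm // mulrC ler_pM2r // le_max => ->.
Qed.

Lemma tcont_at_tcvg (f : R -> X) : tcont_at P (Icc 0 1) f 0 ->
  tcvg P (fun n => f n.+1%:R^-1) (f 0).
Proof.
move=> cf p Pp e e0; have [d d0 hd] := cf p Pp e e0.
apply: filterS (near_invn d0) => n hn; apply: hd.
  by rewrite /Icc /= invr_ge0 ler0n invf_le1 ?ltr0n // ler1n.
by rewrite subr0 gtr0_norm // invn_gt0.
Qed.

End Quotients.

(** * The generator of a bi-continuous semigroup *)

Section Generators.
Context {R : realType} {K : scalars R} {X : completeNormedModType K}.
Variable P : set (seminorm X).
Hypothesis hX : bicontinuous_setting P.
Variable T : R -> X -> X.
Hypothesis hT : bicontinuous_semigroup P T.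
Implicit Types (x y : X).

Lemma semigroupD (t s : R) x : 0 <= t -> 0 <= s -> T (t + s) x = T t (T s x).
Proof. by move=> t0 s0; rewrite (bcsD hT). Qed.

Lemma semigroup0 x : T 0 x = x.
Proof. by rewrite (bcs0 hT). Qed.

Lemma semigroup_tfamily (b : R) : tfamily P b T.
Proof.
apply: (@tfamily_shorten _ _ _ P T (Num.max b 1) b); first by rewrite le_max lexx.
set c := Num.max b 1; have c0 : 0 < c by rewrite lt_max ltr01 orbT.
have [M [w [M1 hM]]] := bcs_growth hT.
have lT (t : R) : 0 <= t -> linear (T t).
  by move=> t0; have /bounded_operatorP[] := bcs_bounded hT t0.
split.
- by move=> t /andP[t0 _]; exact: lT.
- have M0 : 0 <= M by lra.
  exists (M * expR (`|w| * c)); first by rewrite mulr_ge0 // expR_ge0.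
  move=> t /andP[t0 tc] x.
  have /opnorm_leP : (opnorm (T t) <= (M * expR (w * t))%:E)%E by exact: hM.
  move=> /(_ (lT t t0) _ x) h; apply: le_trans (h _) _.
    by rewrite mulr_ge0 // expR_ge0.
  rewrite ler_wpM2r ?normR_ge0 // ler_wpM2l // ler_expR.
  apply: le_trans (ler_norm _) _; rewrite normrM (ger0_norm t0).
  by rewrite ler_wpM2l.
- move=> x t /andP[t0 tc] p Pp e e0.
  have /tcontP h := @bcs_continuous _ _ _ _ _ hT x.
  have := h t _ p Pp e e0; rewrite /= in_itv /= andbT => /(_ t0)[d d0 hd].
  exists d => // s /andP[s0 _].
  by apply: hd; rewrite /= in_itv /= andbT.
- exact/equi_nullP/(bcs_equicontinuous hT).
Qed.

Definition difference_quotient x : X -> R -> X := quotient (fun h => T h x - x).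

Lemma generatorP x y : generator P T x y <->
  (forall p, P p -> forall e : R, 0 < e -> exists2 d : R, 0 < d &
     forall h : R, 0 < h -> h < d -> p (T h x - x - (ofR h : K) *: y) < e * h) /\
  (exists C : R, forall h : R, 0 < h -> h <= 1 -> normR (T h x - x) <= C * h).
Proof.
have E (p : seminorm X) (h e : R) : 0 < h ->
    (p ((ofR h : K)^-1 *: (T h x - x) - y) < e) =
    (p (T h x - x - (ofR h : K) *: y) < e * h).
  move=> h0; rewrite -ltr_pdivrMr //.
  have -> : T h x - x - (ofR h : K) *: y =
      (ofR h : K) *: ((ofR h : K)^-1 *: (T h x - x) - y).
    rewrite scalerBr scalerA mulfV ?scale1r // fmorph_eq0; lra.
  by rewrite seminorm_scaleR gtr0_norm // mulrC mulKf // gt_eqF.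
split=> [[/lcs_cvgP h1 h2]|[h1 [C h2]]].
  split.
    move=> p Pp e e0; have := h1 p Pp e e0.
    move=> /nbhs_ballP[d /= d0 hd]; exists d => // h h0 hd'.
    rewrite -E //; apply: hd => //.
    by rewrite /ball /= sub0r normrN gtr0_norm.
  set S := ereal_sup _ in h2; have Sge (h : R) : 0 < h -> h <= 1 ->
      ((normR (T h x - x) / h)%:E <= S)%E.
    by move=> h0 h1'; apply: ereal_sup_ubound; exists h => //=; rewrite h0.
  have Sfin : S \is a fin_num.
    by rewrite fin_numElt h2 (lt_le_trans _ (Sge 1 ltr01 (lexx _))) // ltNyr.
  exists (fine S) => h h0 h1'; rewrite -ler_pdivrMr //.
  by rewrite -lee_fin fineK // Sge.
split.
  apply/lcs_cvgP => p Pp e e0; have [d d0 hd] := h1 p Pp e e0.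
  apply/nbhs_ballP; exists d => // h; rewrite /ball /= sub0r normrN => hd' h0.
  by rewrite E //; apply: hd => //; rewrite gtr0_norm in hd'.
apply: (@le_lt_trans _ _ C%:E); last by rewrite ltry.
apply: ge_ereal_sup => _ [h /= /andP[h0 h1'] <-]; rewrite lee_fin ler_pdivrMr //.
exact: h2.
Qed.

(** The quotients only have to be bounded near [0]: away from it they are
controlled by the local boundedness of the semigroup. *)
Lemma generator_intro x y (dl C : R) : 0 < dl ->
  (forall p, P p -> forall e : R, 0 < e -> exists2 d : R, 0 < d &
     forall h : R, 0 < h -> h < d -> p (T h x - x - (ofR h : K) *: y) <= e * h) ->
  (forall h : R, 0 < h -> h <= dl -> normR (T h x - x) <= C * h) ->
  generator P T x y.
Proof.
move=> dl0 h1 h2; apply/generatorP; split.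
  move=> p Pp e e0; have e2 : 0 < e / 2 by rewrite divr_gt0.
  have [d d0 hd] := h1 p Pp _ e2; exists d => // h h0 hd'.
  apply: le_lt_trans (hd h h0 hd') _; rewrite ltr_pM2r //; lra.
have [D D0 hD] := tfam_bounded (semigroup_tfamily 1).
exists (Num.max C ((D + 1) * normR x / dl)) => h h0 h1'.
have [hd|hd] := lerP h dl.
  apply: le_trans (h2 h h0 hd) _; rewrite ler_wpM2r ?le_max ?lexx //; lra.
apply: (@le_trans _ _ ((D + 1) * normR x / dl * h)); last first.
  by rewrite ler_wpM2r ?le_max ?lexx ?orbT //; lra.
apply: le_trans (normRB _ _) _.
have Ih : Icc 0 1 h by apply/andP; split; lra.
rewrite mulrAC ler_pdivlMr //.
apply: (@le_trans _ _ ((D + 1) * normR x * dl)).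
  by rewrite ler_wpM2r ?(ltW dl0) // mulrDl mul1r lerD2r hD.
by rewrite ler_wpM2l ?(ltW hd) // mulr_ge0 ?normR_ge0 //; lra.
Qed.

Lemma difference_quotient_cont x y : generator P T x y ->
  tcont_at P (Icc 0 1) (difference_quotient x y) 0.
Proof.
move=> /generatorP[h1 _]; apply: quotient_cont => p Pp e e0.
have [d d0 hd] := h1 p Pp e e0; exists d => // h h0 hd'; exact/ltW/hd.
Qed.

Lemma difference_quotient_bounded x y : generator P T x y ->
  bounded_on (Icc 0 1) (difference_quotient x y).
Proof. by move=> /generatorP[_ [C hC]]; exact: quotient_bounded hC. Qed.

Lemma generator_unique x y y' : generator P T x y -> generator P T x y' -> y = y'.
Proof.
move=> /generatorP[h1 _] /generatorP[h2 _]; apply: (eq_seminorms hX) => p Pp e e0.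
have e2 : 0 < e / 2 by rewrite divr_gt0.
have [d d0 hd] := h1 p Pp _ e2; have [d' d'0 hd'] := h2 p Pp _ e2.
pose h := Num.min d d' / 2; have m0 : 0 < Num.min d d' by rewrite lt_min d0.
have h0 : 0 < h by rewrite divr_gt0.
have hle : h < Num.min d d' by rewrite /h; lra.
rewrite lt_min in hle; case/andP: hle => h_d h_d'.
have A1 := hd h h0 h_d; have A2 := hd' h h0 h_d'.
have : p ((ofR h : K) *: (y - y')) < e * h.
  rewrite scalerBr; apply: le_lt_trans (seminorm_triangle p (T h x - x) _ _) _.
  by rewrite (seminormC p ((ofR h : K) *: y)); lra.
by rewrite seminorm_scaleR gtr0_norm // mulrC ltr_pM2r // => /ltW.
Qed.

(** The difference quotient of [T t x] is the image under [T t] of that of [x],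
and [T t] is continuous along bounded convergent families. *)
Lemma generator_semigroup x y (t : R) : 0 <= t -> generator P T x y ->
  generator P T (T t x) (T t y).
Proof.
move=> t0 g; have It : Icc 0 t t by rewrite /Icc /= t0 lexx.
have hF := semigroup_tfamily t; have lT := tfam_linear hF It.
have [C C0 hC] := tfam_bounded hF.
have E (h : R) : 0 < h ->
    T h (T t x) - T t x = (ofR h : K) *: T t (difference_quotient x y h).
  move=> h0; rewrite -(semigroupD x (ltW h0) t0) (addrC h) semigroupD ?(ltW h0) //.
  by rewrite -(linear_sub lT) (quotientK (fun h => T h x - x) y) ?gt_eqF // linear_scale.
have [D hD] := difference_quotient_bounded g.
apply: (@generator_intro _ _ 1 (C * D)) => //.
  move=> p Pp e e0; have I0 : Icc 0 1 (0 : R) by rewrite /Icc /= lexx ler01.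
  have [d d0 hd] := tfamily_joint hF (difference_quotient_bounded g)
    (difference_quotient_cont g) I0 It Pp e0.
  exists (Num.min d 1) => [|h h0]; first by rewrite lt_min d0 ltr01.
  rewrite lt_min => /andP[hd' h1].
  rewrite (E h h0) -scalerBr seminorm_scaleR gtr0_norm // mulrC ler_pM2r //.
  have := hd t h It; rewrite subrr normr0 subr0 gtr0_norm //.
  rewrite /difference_quotient quotient0 => A; apply/ltW/A => //.
  by rewrite /Icc /= ltW //= ltW.
move=> h h0 h1; rewrite (E h h0) normR_scaleR gtr0_norm // mulrC ler_pM2r //.
apply: le_trans (hC t It _) _; apply: ler_wpM2l => //; apply: hD.
by rewrite /Icc /= ltW.
Qed.

(** The orbit of [x] has right derivative [T s y] at [s]. Comparing it with
[s |-> s *: c] by the mean value inequality replaces the integral formula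
[T t x - x = \int_0^t T s y ds]. *)
Lemma orbit_estimate x y c (p : seminorm X) (t M : R) : generator P T x y ->
  P p -> 0 <= t -> 0 <= M -> (forall s : R, Icc 0 t s -> p (T s y - c) <= M) ->
  p (T t x - x - (ofR t : K) *: c) <= M * t.
Proof.
move=> g Pp t0 M0 hM; have hF := semigroup_tfamily t.
pose f s := T s x - (ofR s : K) *: c.
have fE s s' : f s - f s' = (T s x - T s' x) - (ofR (s - s') : K) *: c.
  by rewrite /f rmorphB scalerBl opprD addrACA -opprD.
have := @mean_value _ _ _ p f 0 t M t0 M0.
rewrite fE semigroup0 subr0; apply.
  move=> s Is e e0; have e2 : 0 < e / 2 by rewrite divr_gt0.
  have [d d0 hd] := tfam_cont hF x Is Pp e2.
  have c1 : 0 < p c + 1 by have := seminorm_ge0 p c; lra.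
  exists (Num.min d (e / 2 / (p c + 1))); first by rewrite lt_min d0 !divr_gt0.
  move=> s' Is'; rewrite lt_min => /andP[/(hd s' Is') A1].
  rewrite ltr_pdivlMr // mulrDr mulr1 => A2.
  rewrite fE; apply: le_lt_trans (seminormB _ _ _) _; rewrite seminorm_scaleR.
  by have := normr_ge0 (s' - s); lra.
move=> s s0 st e e0; have Is : Icc 0 t s by rewrite /Icc /= s0 ltW.
have I0 : Icc 0 1 (0 : R) by rewrite /Icc /= lexx ler01.
have [d d0 hd] := tfamily_joint hF (difference_quotient_bounded g)
    (difference_quotient_cont g) I0 Is Pp e0.
exists (Num.min d 1) => [|h h0]; first by rewrite lt_min d0 ltr01.
rewrite lt_min => /andP[hd' h1] _.
rewrite fE (addrC s h) addrK (addrC h) semigroupD ?(ltW h0) //.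
have lT := tfam_linear hF Is.
rewrite -(linear_sub lT) (quotientK (fun h => T h x - x) y) ?gt_eqF //.
rewrite (linear_scale lT) -scalerBr seminorm_scaleR gtr0_norm // mulrC.
rewrite ler_pM2r //.
have := hd s h Is; rewrite subrr normr0 subr0 gtr0_norm //.
rewrite /difference_quotient quotient0 => A.
have {}A : p (T s (difference_quotient x y h) - T s y) < e.
  by apply: A => //; rewrite /Icc /= ltW //= ltW.
have := seminorm_triangle p (T s y) (T s (difference_quotient x y h)) c.
by have := hM s Is; lra.
Qed.

(** The orbit estimate for [u n] involves [v n] only through its orbit on a
compact interval, which converges uniformly by bi-equicontinuity. *)
Lemma generator_closed (u v : nat -> X) x y : (forall n, generator P T (u n) (v n)) ->
  bounded_seq u -> tcvg P u x -> bounded_seq v -> tcvg P v y ->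
  generator P T x y.
Proof.
move=> g bu cu [B bv] cv.
have bu' : bounded_seq (fun n => u n - x).
  case: bu => C hC; exists (C + normR x) => n.
  by apply: le_trans (normRB _ _) _; rewrite lerD2r.
have cu' : tcvg P (fun n => u n - x) 0.
  by move=> p Pp e e0; under eq_near do rewrite subr0; exact: cu.
have bv' : bounded_seq (fun n => v n - y).
  by exists (B + normR y) => n; apply: le_trans (normRB _ _) _; rewrite lerD2r.
have cv' : tcvg P (fun n => v n - y) 0.
  by move=> p Pp e e0; under eq_near do rewrite subr0; exact: cv.
have est (p : seminorm X) (t M : R) : P p -> 0 <= t -> 0 <= M ->
    (forall s : R, Icc 0 t s -> p (T s y - y) <= M) ->
    p (T t x - x - (ofR t : K) *: y) <= M * t.
  move=> Pp t0 M0 hM; apply: ler_addeps => e e0.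
  have hF := semigroup_tfamily t.
  have t1 : 0 < t + 1 by lra.
  have e4 : 0 < e / 4 by rewrite divr_gt0.
  have e2 : 0 < e / 2 by rewrite divr_gt0.
  near \oo => n.
  have A1 : forall s : R, Icc 0 t s -> p (T s (u n - x)) < e / 4.
    by near: n; exact: (tfam_equi hF).
  have A2 : forall s : R, Icc 0 t s -> p (T s (v n - y)) < e / 2 / (t + 1).
    by near: n; apply: (tfam_equi hF) => //; rewrite divr_gt0.
  have It : Icc 0 t t by rewrite /Icc /= t0 lexx.
  have I0 : Icc 0 t 0 by rewrite /Icc /= lexx t0.
  have := A1 t It; have := A1 0 I0; rewrite semigroup0 (linear_sub (tfam_linear hF It)).
  move=> B1 B2.
  have e' : 0 < e / 2 / (t + 1) by rewrite divr_gt0.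
  have B3 : p (T t (u n) - u n - (ofR t : K) *: y) <= (M + e / 2 / (t + 1)) * t.
    apply: (orbit_estimate (g n) Pp t0); first by lra.
    move=> s Is; have := A2 s Is; rewrite (linear_sub (tfam_linear hF Is)).
    have := seminorm_triangle p (T s y) (T s (v n)) y.
    have := hM s Is; lra.
  have B4 : e / 2 / (t + 1) * t <= e / 2.
    by rewrite mulrAC ler_pdivrMr // ler_pM2l //; lra.
  have -> : T t x - x - (ofR t : K) *: y = (T t (u n) - u n - (ofR t : K) *: y)
      - ((T t (u n) - T t x) - (u n - x)).
    have -> : (T t (u n) - T t x) - (u n - x) = (T t (u n) - u n) - (T t x - x).
      by rewrite !opprD addrACA.
    by rewrite opprB [RHS]addrC addrA subrK.
  apply: le_trans (seminormB _ _ _) _.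
  have := seminormB p (T t (u n) - T t x) (u n - x); lra.
have [D D0 hD] := tfam_bounded (semigroup_tfamily 1).
apply: (@generator_intro x y 1 ((D + 1) * normR y + normR y)) => //.
  move=> p Pp e e0; have I0 : Icc 0 1 (0 : R) by rewrite /Icc /= lexx ler01.
  have [d d0 hd] := tfam_cont (semigroup_tfamily 1) y I0 Pp e0.
  exists (Num.min d 1) => [|h h0]; first by rewrite lt_min d0 ltr01.
  rewrite lt_min => /andP[hd' h1]; apply: est => //; [exact: ltW|exact: ltW|].
  move=> s /andP[s0 sh]; have := hd s; rewrite semigroup0 subr0 ger0_norm // => A.
  by apply/ltW/A; [rewrite /Icc /= s0; lra|lra].
move=> h h0 h1; have A : normR (T h x - x - (ofR h : K) *: y) <= (D + 1) * normR y * h.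
  apply: (norm_le_seminorms hX) => p Pp; apply: est => //; first exact: ltW.
    by rewrite mulr_ge0 ?normR_ge0 //; lra.
  move=> s /andP[s0 sh]; apply: le_trans (seminorm_le_norm hX _ Pp) _.
  apply: le_trans (normRB _ _) _; rewrite mulrDl mul1r lerD2r hD //.
  by rewrite /Icc /= s0; lra.
have := normR_le_sub (T h x - x) ((ofR h : K) *: y).
by rewrite normR_scaleR gtr0_norm //; lra.
Unshelve. all: by end_near. Qed.

End Generators.

(** * The convolution integral *)

Section Perturbation.
Context {R : realType} {K : scalars R} {X : completeNormedModType K}.
Variable P : set (seminorm X).
Hypothesis hX : bicontinuous_setting P.
Variable T : R -> X -> X.
Hypothesis hT : bicontinuous_semigroup P T.
(** [J] is the inverse of the generator of [T], and [C] the perturbation brought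
back to [X] by the isomorphism between the extrapolation space and [X]. The
Volterra operator then maps [F] to the [G] such that [J (G t x)] is the
convolution of [T] with [C (F r x)], and the perturbed generator consists
of the pairs [(x, y)] such that [x + C x = J y]. *)
Variables J C : X -> X.
Hypothesis generatorJ : forall x y, generator P T x y <-> x = J y.
Hypothesis hC : tfamily P 1 (fun=> C).

Implicit Types (x y : X) (u : R -> X).

Definition convolution u (t : R) (v : X) : Prop :=
  is_rint P (fun r => T (t - r) (C (u r))) 0 t v.

Lemma inverse_inj : injective J.
Proof.
move=> y y' e; apply: (generator_unique hX (x := J y) (T := T)).
  exact/generatorJ.
exact/generatorJ.
Qed.

Lemma inverse_semigroup (t : R) y : 0 <= t -> T t (J y) = J (T t y).
Proof.
by move=> t0; apply/generatorJ; apply: (generator_semigroup hT t0); exact/generatorJ.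
Qed.

Lemma inverse_biclosed : biclosed P J.
Proof.
move=> u l m bu cu bJ cJ; apply/generatorJ.
by apply: (generator_closed hX hT (u := J \o u) (v := u)) => // n; exact/generatorJ.
Qed.

Lemma perturbation_linear : linear C.
Proof. by apply: (tfam_linear hC (t := 0)); rewrite /Icc /= lexx ler01. Qed.

Lemma perturbation_bounded : exists2 D : R, 0 <= D &
  forall x, normR (C x) <= D * normR x.
Proof.
have [D D0 h] := tfam_bounded hC; exists D => // x; apply: (h 0).
by rewrite /Icc /= lexx ler01.
Qed.

Lemma perturbation_tcont_at (I : set R) u (t : R) : bounded_on I u -> I t ->
  tcont_at P I u t -> tcont_at P I (C \o u) t.
Proof.
move=> bu It cu p Pp e e0; have I0 : Icc 0 1 (0 : R) by rewrite /Icc /= lexx ler01.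
have [d d0 hd] := tfamily_joint hC bu cu It I0 Pp e0.
exists d => // s Is st; apply: (hd 0 s) => //.
by rewrite subrr normr0.
Qed.

Lemma perturbation_bounded_on (I : set R) u : bounded_on I u -> bounded_on I (C \o u).
Proof.
move=> [B hB]; have [D D0 hD] := perturbation_bounded.
exists (D * B) => t It; apply: le_trans (hD _) _.
by rewrite ler_wpM2l // hB.
Qed.

Lemma orbit_tcont (F : R -> X -> X) (b t : R) u : tfamily P b F -> t <= b ->
  tcont P (Icc 0 t) u -> bounded_on (Icc 0 t) u ->
  tcont P (Icc 0 t) (fun r => F (t - r) (u r)).
Proof.
move=> hF tb cu bu r Ir p Pp e e0.
have I' s : Icc 0 t s -> Icc 0 b (t - s) by move=> /andP[? ?]; apply/andP; split; lra.
have [d d0 hd] := tfamily_joint hF bu (cu r Ir) Ir (I' r Ir) Pp e0.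
exists d => // s Is sr; apply: hd => //; first exact: I'.
by rewrite opprB addrC addrA subrK distrC.
Qed.

Lemma orbit_bounded (F : R -> X -> X) (b t : R) u : tfamily P b F -> t <= b ->
  bounded_on (Icc 0 t) u -> bounded_on (Icc 0 t) (fun r => F (t - r) (u r)).
Proof.
move=> hF tb [B hB]; have [D D0 hD] := tfam_bounded hF; exists (D * B) => s Is.
have I' : Icc 0 b (t - s) by move: Is => /andP[? ?]; apply/andP; split; lra.
by apply: le_trans (hD _ I' _) _; rewrite ler_wpM2l // hB.
Qed.

Lemma convolution_integrand (t : R) u :
  tcont P (Icc 0 t) u -> bounded_on (Icc 0 t) u ->
  tcont P (Icc 0 t) (fun r => T (t - r) (C (u r))) /\
  bounded_on (Icc 0 t) (fun r => T (t - r) (C (u r))).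
Proof.
move=> cu bu; have hF := semigroup_tfamily hT t.
split; last exact: (orbit_bounded hF (lexx t) (perturbation_bounded_on bu)).
apply: (orbit_tcont hF (lexx t)); last exact: perturbation_bounded_on.
by move=> r Ir; apply: perturbation_tcont_at => //; exact: cu.
Qed.

Lemma convolution_unique u (t : R) v w : 0 <= t ->
  convolution u t v -> convolution u t w -> v = w.
Proof. by move=> t0; exact: (rint_unique hX t0). Qed.

Lemma convolutionB u u' (t : R) v v' : 0 <= t ->
  convolution u t v -> convolution u' t v' ->
  convolution (fun r => u r - u' r) t (v - v').
Proof.
move=> t0 h h'; apply: eq_rint (rintB h h') => r /andP[r0 rt].
rewrite (linear_sub perturbation_linear).
have Ir : Icc 0 t (t - r) by apply/andP; split; lra.
by rewrite (linear_sub (tfam_linear (semigroup_tfamily hT t) Ir)).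
Qed.

Lemma convolutionZ (k : K) u (t : R) v : 0 <= t ->
  convolution u t v -> convolution (fun r => k *: u r) t (k *: v).
Proof.
move=> t0 h; apply: eq_rint (rintZ k h) => r /andP[r0 rt].
rewrite (linear_scale perturbation_linear).
have Ir : Icc 0 t (t - r) by apply/andP; split; lra.
by rewrite (linear_scale (tfam_linear (semigroup_tfamily hT t) Ir)).
Qed.

Lemma eq_convolution u u' (t : R) v : (forall r, 0 <= r <= t -> u r = u' r) ->
  convolution u t v -> convolution u' t v.
Proof. by move=> e; apply: eq_rint => r /e ->. Qed.

(** Cut the integral at [s]: the first part is [T t] applied to a convolution
up to [s], the second one is the convolution of the translate. *)
Lemma convolution_split u (s t : R) v1 v2 v3 : 0 <= s -> 0 <= t ->
  tcont P (Icc 0 (t + s)) u -> bounded_on (Icc 0 (t + s)) u ->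
  convolution u s v1 -> convolution (fun r => u (r + s)) t v2 ->
  convolution u (t + s) v3 -> v3 = T t v1 + v2.
Proof.
move=> s0 t0 cu bu h1 h2 h3; have ts0 : 0 <= t + s by exact: addr_ge0.
have [cf bf] := convolution_integrand cu bu.
have sub1 r : Icc 0 s r -> Icc 0 (t + s) r.
  by move=> /andP[? ?]; apply/andP; split; lra.
have sub2 r : Icc s (t + s) r -> Icc 0 (t + s) r.
  by move=> /andP[? ?]; apply/andP; split; lra.
have cu1 := tcont_restrict sub1 cu; have bu1 := bounded_on_restrict sub1 bu.
have cf1 := tcont_restrict sub1 cf; have bf1 := bounded_on_restrict sub1 bf.
have cf2 := tcont_restrict sub2 cf; have bf2 := bounded_on_restrict sub2 bf.
have [w1 hw1] := rint_exists hX s0 cf1 bf1.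
have sts : s <= t + s by rewrite lerDr.
have [w2 hw2] := rint_exists hX sts cf2 bf2.
rewrite (rint_cat hX s0 sts hw1 hw2 h3); congr (_ + _).
  have hF := semigroup_tfamily hT t; have It : Icc 0 t t by rewrite /Icc /= t0 lexx.
  have [_ bg] := convolution_integrand cu1 bu1.
  have E r : 0 <= r <= s -> T (t + s - r) (C (u r)) = T t (T (s - r) (C (u r))).
    by move=> /andP[r0 rs]; rewrite -addrA (semigroupD hT _ t0) ?subr_ge0.
  apply: (rint_biclosed (tfam_linear hF It) (tfamily_biclosed hX hF It) s0 bg _ h1).
    by case: bf1 => B hB; exists B => r Ir /=; rewrite -E //; exact: hB.
  exact: eq_rint E hw1.
have : convolution (fun r => u (r + s)) t w2.
  rewrite -[X in is_rint _ _ X _ _](add0r s) in hw2.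
  apply: eq_rint (rint_shift hw2) => r _ /=.
  by rewrite opprD addrACA addrA addrK.
by move=> h; exact: convolution_unique h h2.
Qed.

End Perturbation.

(** * The Volterra equation on a short interval *)

Section Volterra.
Context {R : realType} {K : scalars R} {X : completeNormedModType K}.
Variable P : set (seminorm X).
Hypothesis hX : bicontinuous_setting P.
Variable T : R -> X -> X.
Hypothesis hT : bicontinuous_semigroup P T.
Variables J C : X -> X.
Hypothesis lJ : linear J.
Hypothesis generatorJ : forall x y, generator P T x y <-> x = J y.
Hypothesis hC : tfamily P 1 (fun=> C).
Variables t0 q : R.
Hypothesis t0_gt0 : 0 < t0.
Hypothesis q_gt0 : 0 < q.
Hypothesis q_lt1 : q < 1.
Hypothesis volterra_exists : forall F, tfamily P t0 F -> exists2 G,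
  tfamily P t0 G & forall t, Icc 0 t0 t -> forall x,
    convolution P T C (F^~ x) t (J (G t x)).
Hypothesis volterra_contraction : forall F G (c : R),
  tfamily P t0 F -> 0 < c ->
  (forall t, Icc 0 t0 t -> forall x, normR (F t x) <= c * normR x) ->
  (forall t, Icc 0 t0 t -> forall x, convolution P T C (F^~ x) t (J (G t x))) ->
  forall t, Icc 0 t0 t -> forall x, normR (G t x) <= q * c * normR x.

Implicit Types (x y : X) (u : R -> X).

Lemma norming_functional x : x <> 0 -> exists phi : {linear X -> K^o},
  [/\ phi x <> 0, forall z, normR (phi z) <= normR z &
   continuous (phi : lcs P -> K^o)].
Proof.
move=> xn0; apply: contrapT => no; apply: xn0; apply: normR_eq0.
rewrite -lee_fin (tau_norming hX); apply: ge_ereal_sup => _ [phi /= [cphi bphi] <-].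
have lphi : linear phi by move=> a y z; rewrite linearP.
have bz z : normR (phi z) <= normR z.
  by have /(opnorm_leP lphi ler01)/(_ z) := bphi; rewrite mul1r.
rewrite lee_fin; have [->|n0] := pselect (phi x = 0); first by rewrite normR0.
by case: no; exists phi.
Qed.

Lemma functional_null (phi : {linear X -> K^o}) (u : nat -> X) (e : R) :
  continuous (phi : lcs P -> K^o) -> tcvg P u 0 -> 0 < e ->
  \forall n \near \oo, `|phi (u n)| <= ofR e.
Proof.
move=> cphi /tcvgP cu e0.
have h : (phi \o u) @ \oo --> (phi 0 : K^o).
  exact: (@cvg_comp _ _ _ (u : nat -> lcs P) (phi : lcs P -> K^o) _ _ _ cu
    (cphi (0 : lcs P))).
have e0' : 0 < ofR e :> K by rewrite -(rmorph0 (@ofR R K)) ofR_lt.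
have /cvgrPdist_lt/(_ _ e0') := h.
by apply: filterS => n; rewrite linear0 sub0r normrN => /ltW.
Qed.

(** A vector-valued solution [g] of the homogeneous equation on [[0, t1]] is
turned into the operator-valued [F r z = phi z *: g (min r t1)], to which the
contraction estimate applies. *)
Lemma volterra_unique (g : R -> X) (t1 : R) : 0 <= t1 -> t1 <= t0 ->
  tcont P (Icc 0 t1) g -> bounded_on (Icc 0 t1) g ->
  (forall t, Icc 0 t1 t -> convolution P T C g t (J (g t))) ->
  forall t, Icc 0 t1 t -> g t = 0.
Proof.
move=> t10 t1t0 cg [B hB] eg t It; apply: contrapT => gn0.
have [phi [phin0 bphi cphi]] := norming_functional gn0.
have lphi : linear phi by move=> a y z; rewrite linearP.
pose m (r : R) := Num.min r t1.
have Im r : 0 <= r -> Icc 0 t1 (m r).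
  by move=> r0; rewrite /Icc /= le_min r0 t10 ge_min lexx orbT.
have mE r : Icc 0 t1 r -> m r = r by move=> /andP[_ ?]; apply/min_idPl.
have mlip r s : `|m r - m s| <= `|r - s|.
  rewrite /m; case: (leP r t1); case: (leP s t1) => ? ? //.
  - by rewrite !ler0_norm; lra.
  - by rewrite !ger0_norm; lra.
  - by rewrite subrr normr0.
have B0 : 0 <= B by apply: le_trans (hB t It); exact: normR_ge0.
pose F (r : R) z := (phi z : K) *: g (m r).
have hF : tfamily P t0 F.
  apply: (@tfamily_rank_one _ _ _ _ hX phi (g \o m) t0 1 B lphi).
  - by move=> z; rewrite mul1r -normRE ofR_le bphi.
  - exact: ler01.
  - exact: B0.
  - by move=> u _ cu e e0; exact: functional_null.
  - move=> r /andP[r0 rt] p Pp e e0; have [d d0 hd] := cg _ (Im r r0) p Pp e e0.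
    exists d => // s /andP[s0 _] sr; apply: hd; first exact: Im.
    exact: le_lt_trans (mlip s r) sr.
  - by move=> r /andP[r0 _]; apply/hB/Im.
have [G _ hG] := volterra_exists hF.
(* On [[0, t1]] the image of [F] under the Volterra operator is [F] itself. *)
have GF r z : Icc 0 t1 r -> G r z = F r z.
  move=> Ir; have /andP[r0 rt1] := Ir; apply: (inverse_inj hX generatorJ).
  have Ir0 : Icc 0 t0 r by rewrite /Icc /= r0 (le_trans rt1).
  apply: (convolution_unique hX r0 (hG r Ir0 z)).
  rewrite /F (mE r Ir) (linear_scale lJ).
  apply: eq_convolution (convolutionZ hT hC (phi z) r0 (eg r Ir)) => s /andP[s0 sr].
  by rewrite mE // /Icc /= s0 (le_trans sr).
have Fm r : 0 <= r -> F r = F (m r).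
  by move=> r0; apply/funext => z; rewrite /F (mE (m r)) //; exact: Im.
(* Beyond [t1] the function [F] is frozen, so a bound on [[0, t1]] is one on the
   whole interval and the contraction can be iterated. *)
have iter_bound n r z : Icc 0 t0 r -> normR (F r z) <= q ^+ n * (B + 1) * normR z.
  elim: n r z => [|n IH] r z Ir.
    rewrite expr0 mul1r /F.
    have /andP[r0 _] := Ir.
    rewrite -(@ofR_le R K) normR_homog !rmorphM mulrC.
    apply: ler_pM; rewrite ?ofR_ge0 ?normR_ge0 ?normr_ge0 //.
      by rewrite ofR_le; apply: le_trans (hB _ (Im r r0)) _; lra.
    by rewrite -normRE ofR_le bphi.
  have /andP[r0 rt0] := Ir; rewrite Fm // -GF; last exact: Im.
  rewrite exprS -(mulrA q).
  apply: (volterra_contraction hF _ (fun r Ir z => IH r z Ir) hG).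
    by rewrite mulr_gt0 ?exprn_gt0 //; lra.
  by have /andP[m0 mt1] := Im r r0; rewrite /Icc /= m0 (le_trans mt1).
have It0 : Icc 0 t0 t by case/andP: It => ? ?; apply/andP; split; lra.
have : F t (g t) = 0.
  apply: normR_eq0; apply: ler_addeps => e e0; rewrite add0r.
  near \oo => n; apply: le_trans (iter_bound n t (g t) It0) _.
  rewrite -mulrA mulrC; apply: ltW.
  by near: n; exact: near_geometric (ltW q_gt0) q_lt1 e0.
rewrite /F mE // => /eqP; rewrite scaler_eq0 => /orP[] /eqP //.
Unshelve. all: by end_near. Qed.

(** Picard iteration: successive iterates differ by [q ^+ n] up to a constant, so
that they converge uniformly in operator norm, and the contraction estimate
shows that the limit is a fixed point. *)
Lemma volterra_solution : exists2 S, tfamily P t0 S & forall t, Icc 0 t0 t ->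
  forall x, convolution P T C (S^~ x) t (J (S t x) - J (T t x)).
Proof.
have /choice[V hV] : forall F, exists G, tfamily P t0 F -> tfamily P t0 G /\
    forall t, Icc 0 t0 t -> forall x, convolution P T C (F^~ x) t (J (G t x)).
  move=> F; have [hF|nF] := pselect (tfamily P t0 F); last by exists F.
  by have [G hG eG] := volterra_exists hF; exists G.
pose Fn := fix Fn (n : nat) : R -> X -> X :=
  if n is n'.+1 then fun t x => T t x + V (Fn n') t x else T.
have hFn n : tfamily P t0 (Fn n).
  elim: n => [|n IH] /=; first exact: semigroup_tfamily.
  by apply: tfamily_add; [exact: semigroup_tfamily|case: (hV _ IH)].
have V_sub F G (c : R) : tfamily P t0 F -> tfamily P t0 G -> 0 < c ->
    (forall t, Icc 0 t0 t -> forall x, normR (F t x - G t x) <= c * normR x) ->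
    forall t, Icc 0 t0 t -> forall x, normR (V F t x - V G t x) <= q * c * normR x.
  move=> hF hG c0 hc; apply: (volterra_contraction (tfamily_sub hF hG) c0 hc).
  move=> t It x; have /andP[t_ge0 _] := It; rewrite (linear_sub lJ).
  by apply: (convolutionB hT hC t_ge0); [exact: (hV F hF).2|exact: (hV G hG).2].
have [D D0 hD] := tfam_bounded (hV T (semigroup_tfamily hT t0)).1.
have D1 : 0 < D + 1 by lra.
have step n t : Icc 0 t0 t -> forall x,
    normR (Fn n.+1 t x - Fn n t x) <= (D + 1) * q ^+ n * normR x.
  elim: n t => [|n IH] t It x.
    rewrite /= addrAC subrr add0r expr0 mulr1; apply: le_trans (hD t It x) _.
    by rewrite ler_wpM2r ?normR_ge0 //; lra.
  have -> : Fn n.+2 t x - Fn n.+1 t x = V (Fn n.+1) t x - V (Fn n) t x.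
    by rewrite /= opprD addrACA subrr add0r.
  rewrite exprS mulrCA; by apply: V_sub => //; rewrite mulr_gt0 // exprn_gt0.
have lim w : exists l, Icc 0 t0 w.1 -> forall n,
    normR (Fn n w.1 w.2 - l) <= (D + 1) * normR w.2 / (1 - q) * q ^+ n.
  have [It|nIt] := pselect (Icc 0 t0 w.1); last by exists 0.
  have [|l hl] := @geometric_limit _ _ _ _ hX (fun n => Fn n w.1 w.2)
    ((D + 1) * normR w.2) q (ltW q_gt0) q_lt1.
    by move=> n; rewrite mulrAC; exact: step.
  by exists l.
have {lim}/choice[S0 hS0] := lim; pose S t x := S0 (t, x).
pose c := (D + 1) / (1 - q).
have c0 : 0 < c by rewrite divr_gt0 // subr_gt0.
have hS n t x : Icc 0 t0 t -> normR (Fn n t x - S t x) <= c * q ^+ n * normR x.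
  move=> It; have := hS0 (t, x) It n; rewrite /=.
  suff -> : (D + 1) * normR x / (1 - q) * q ^+ n = c * q ^+ n * normR x by [].
  by rewrite /c; ring.
have fS : tfamily P t0 S.
  exact: (tfamily_uniform_limit hX (ltW q_gt0) q_lt1 (ltW c0) hFn hS).
exists S => // t It x; have [fG eG] := hV S fS.
suff -> : J (S t x) - J (T t x) = J (V S t x) by exact: eG.
rewrite -(linear_sub lJ); congr J; apply/eqP; rewrite -subr_eq0; apply/eqP.
apply: normR_eq0; apply: ler_addeps => e e0; rewrite add0r.
near \oo => n.
have A1 := hS n.+1 t x It.
have A2 : normR (V S t x - V (Fn n) t x) <= q * (c * q ^+ n) * normR x.
  apply: V_sub => //; first by rewrite mulr_gt0 // exprn_gt0.
  by move=> s Is y; rewrite normRC; exact: hS.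
have -> : S t x - T t x - V S t x =
    - ((Fn n.+1 t x - S t x) + (V S t x - V (Fn n) t x)).
  rewrite /= (addrAC (T t x)) -[_ + V (Fn n) t x + _]addrA (addrC (V (Fn n) t x)).
  by rewrite subrK opprD opprB.
rewrite normRN; apply: le_trans (normR_subadd _ _) _.
have : 2 * c * normR x * q ^+ n < e.
  by near: n; exact: near_geometric (ltW q_gt0) q_lt1 e0.
rewrite exprS in A1.
have Q : 0 <= c * q ^+ n * normR x 
  by rewrite mulr_ge0 ?normR_ge0 // ltW // mulr_gt0 // exprn_gt0.
have : q * (c * q ^+ n * normR x) <= 1 * (c * q ^+ n * normR x).
  by apply: ler_wpM2r => //; exact: ltW.
lra.
Unshelve. all: by end_near. Qed.

End Volterra.

(** * The perturbed semigroup *)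

Section Extension.
Context {R : realType} {K : scalars R} {X : completeNormedModType K}.
Variable P : set (seminorm X).
Hypothesis hX : bicontinuous_setting P.
Variable T : R -> X -> X.
Hypothesis hT : bicontinuous_semigroup P T.
Variables J C : X -> X.
Hypothesis lJ : linear J.
Hypothesis generatorJ : forall x y, generator P T x y <-> x = J y.
Hypothesis hC : tfamily P 1 (fun=> C).
Variable t0 : R.
Hypothesis t0_gt0 : 0 < t0.
Hypothesis uniqueness : forall (g : R -> X) (t1 : R), 0 <= t1 -> t1 <= t0 ->
  tcont P (Icc 0 t1) g -> bounded_on (Icc 0 t1) g ->
  (forall t, Icc 0 t1 t -> convolution P T C g t (J (g t))) ->
  forall t, Icc 0 t1 t -> g t = 0.
Variable S : R -> X -> X.
Hypothesis hS : tfamily P t0 S.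
Hypothesis volterraS : forall t, Icc 0 t0 t ->
  forall x, convolution P T C (S^~ x) t (J (S t x) - J (T t x)).

Implicit Types (x y : X) (u : R -> X).

(** A solution up to [t + s] restarts at time [s] with initial value [u s]: in
[convolution_split], [T t] commutes with [J]. *)
Lemma translate_solution u x (s t : R) : 0 <= s -> 0 <= t ->
  tcont P (Icc 0 (t + s)) u -> bounded_on (Icc 0 (t + s)) u ->
  convolution P T C u s (J (u s) - J (T s x)) ->
  convolution P T C u (t + s) (J (u (t + s)) - J (T (t + s) x)) <->
  convolution P T C (fun r => u (r + s)) t (J (u (t + s)) - J (T t (u s))).
Proof.
move=> s0 t_ge0 cu bu h1; have ts0 : 0 <= t + s by exact: addr_ge0.
have [cf bf] := convolution_integrand hT hC cu bu.
have [v3 h3] := rint_exists hX ts0 cf bf.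
pose u' r := u (r + s).
have I' r : Icc 0 t r -> Icc 0 (t + s) (r + s).
  by move=> /andP[? ?]; apply/andP; split; lra.
have cu' : tcont P (Icc 0 t) u'.
  move=> r Ir p Pp e e0; have [d d0 hd] := cu _ (I' r Ir) p Pp e e0.
  exists d => // r' Ir' rr; apply: hd; first exact: I'.
  by rewrite opprD addrACA subrr addr0.
have bu' : bounded_on (Icc 0 t) u' by case: bu => B hB; exists B => r /I'/hB.
have [cf' bf'] := convolution_integrand hT hC cu' bu'.
have [v2 h2] := rint_exists hX t_ge0 cf' bf'.
have E := convolution_split hX hT hC s0 t_ge0 cu bu h1 h2 h3.
have It : Icc 0 t t by rewrite /Icc /= t_ge0 lexx.
have {}E : v3 = (J (T t (u s)) - J (T (t + s) x)) + v2.
  rewrite E (linear_sub (tfam_linear (semigroup_tfamily hT t) It)).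
  by rewrite !(inverse_semigroup hT generatorJ) // (semigroupD hT).
split=> h.
  have E' := convolution_unique hX ts0 h h3.
  suff -> : J (u (t + s)) - J (T t (u s)) = v2 by exact: h2.
  rewrite E in E'; apply: (addrI (J (T t (u s)) - J (T (t + s) x))).
  by rewrite -E' /= [LHS]addrC addrA subrK.
have E' := convolution_unique hX t_ge0 h h2.
suff -> : J (u (t + s)) - J (T (t + s) x) = v3 by exact: h3.
by rewrite E -E' [RHS]addrC addrA subrK.
Qed.

Lemma local_semigroup0 x : S 0 x = x.
Proof.
have I0 : Icc 0 t0 0 by rewrite /Icc /= lexx ltW.
have h := volterraS I0 x.
apply: (inverse_inj hX generatorJ); apply/eqP; rewrite -subr_eq0; apply/eqP.
apply: normR_eq0; rewrite -{2}(semigroup0 hT x).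
have := rint_norm hX (lexx 0) h (C := normR (T 0 (C (S 0 x)))).
rewrite subrr mulr0; apply => r /andP[r1 r2].
have -> : r = 0 by apply/le_anti; rewrite r1 r2.
by rewrite subrr.
Qed.

(** Both [r |-> S (r + s) x] and [r |-> S r (S s x)] solve the Volterra equation
with initial value [S s x]. *)
Lemma local_semigroupD (t s : R) x : 0 <= t -> 0 <= s -> t + s <= t0 ->
  S (t + s) x = S t (S s x).
Proof.
move=> t_ge0 s_ge0 ts.
apply/eqP; rewrite -subr_eq0; apply/eqP.
have t1_ge0 : 0 <= t0 - s by lra.
have sub1 (r : R) : Icc 0 (t0 - s) r -> Icc 0 t0 (r + s).
  by move=> /andP[? ?]; apply/andP; split; lra.
have t1t0 : t0 - s <= t0 by lra.
have lip (r r' : R) : `|(r + s) - (r' + s)| <= 1 * `|r - r'|.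
  by rewrite opprD addrACA subrr addr0 mul1r.
have Is : Icc 0 t0 s by apply/andP; split; lra.
pose g (r : R) := S (r + s) x - S r (S s x).
have hS1 := tfamily_shorten t1t0 hS.
have c1 : tcont P (Icc 0 (t0 - s)) (fun r => S (r + s) x).
  exact: (tfam_cont (tfamily_reparam ltr01 hS sub1 lip)).
have c2 := tfam_cont hS1 (S s x).
have cg : tcont P (Icc 0 (t0 - s)) g.
  by move=> r Ir; apply: tcont_atB; [exact: c1|exact: c2].
have bg : bounded_on (Icc 0 (t0 - s)) g.
  apply: bounded_onB (tfamily_orbit_bounded (S s x) hS1).
  exact: tfamily_orbit_bounded x (tfamily_reparam ltr01 hS sub1 lip).
apply: (uniqueness (g := g) t1_ge0 t1t0 cg bg); last by apply/andP; split; lra.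
move=> r Ir; have /andP[r0 rt] := Ir.
have rst : r + s <= t0 by lra.
have Ir0 : Icc 0 t0 r by apply/andP; split; lra.
have hSr := tfamily_shorten rst hS.
have h1 := (translate_solution s_ge0 r0 (tfam_cont hSr x)
  (tfamily_orbit_bounded x hSr) (volterraS Is x)).1 (volterraS (sub1 r Ir) x).
have := convolutionB hT hC r0 h1 (volterraS Ir0 (S s x)).
by rewrite opprB addrA subrK -(linear_sub lJ).
Qed.

Lemma local_semigroup_iter n (t : R) x : 0 <= t -> n%:R * t <= t0 ->
  iter n (S t) x = S (n%:R * t) x.
Proof.
move=> t_ge0; elim: n x => [|n IH] x h; first by rewrite mul0r local_semigroup0.
have nt : 0 <= n%:R * t by rewrite mulr_ge0.
have E : n.+1%:R * t = t + n%:R * t by rewrite -natr1; ring.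
rewrite E in h *; rewrite local_semigroupD // -IH //; lra.
Qed.

Lemma local_semigroup_commute (s t : R) x : 0 <= s -> 0 <= t -> s + t <= t0 ->
  S s (S t x) = S t (S s x).
Proof.
by move=> s0 t_ge0 st; rewrite -!local_semigroupD // 1?addrC // addrC.
Qed.

(** Any number of equal steps of length at most [t0] gives the same operator
(see [extensionE]), which avoids the bookkeeping of a division with remainder. *)
Definition extension (t : R) : X -> X :=
  let n := (Num.truncn (t / t0)).+1 in iter n (S (t / n%:R)).

Lemma divn_le (n : nat) (t : R) : t <= n.+1%:R * t0 <-> t / n.+1%:R <= t0.
Proof. by rewrite ler_pdivrMr ?ltr0n // mulrC. Qed.

(** Two subdivisions are compared with their common refinement. *)
Lemma extensionE n (t : R) : 0 <= t -> t <= n.+1%:R * t0 ->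
  extension t = iter n.+1 (S (t / n.+1%:R)).
Proof.
move=> t_ge0 tn; rewrite /extension; set m := Num.truncn _.
have tm : t <= m.+1%:R * t0 by rewrite -ler_pdivrMr // ltW // truncnS_gt.
suff common k l : t <= k.+1%:R * t0 -> t <= l.+1%:R * t0 ->
    iter k.+1 (S (t / k.+1%:R)) = iter (k.+1 * l.+1) (S (t / (k.+1 * l.+1)%:R)).
  by rewrite (common m n) // (common n m) // mulnC.
move=> tk tl; apply/funext => x0; rewrite iterM; apply: eq_iter => x {x0}.
have kl : l.+1%:R * (t / (k.+1 * l.+1)%:R) = t / k.+1%:R :> R.
  by rewrite natrM invfM mulrCA [l.+1%:R * _]mulrCA divff ?pnatr_eq0 // mulr1.
rewrite local_semigroup_iter ?kl //; first by rewrite divr_ge0.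
exact/divn_le.
Qed.

Lemma extension_local (t : R) : Icc 0 t0 t -> extension t = S t.
Proof.
move=> /andP[t_ge0 tt]; rewrite (@extensionE 0%N) ?mul1r //.
by rewrite /= divr1.
Qed.

Lemma natr_bound (b : R) : exists n : nat, b <= n.+1%:R * t0.
Proof.
by exists (Num.truncn (b / t0)); rewrite -ler_pdivrMr // ltW // truncnS_gt.
Qed.

(** Use the same number of steps for [t], [s] and [t + s]; the steps commute. *)
Lemma extensionD (t s : R) : 0 <= t -> 0 <= s ->
  extension (t + s) = extension t \o extension s.
Proof.
move=> t_ge0 s_ge0; have ts0 : 0 <= t + s by exact: addr_ge0.
have [n hn] := natr_bound (t + s).
rewrite !(@extensionE n) //; [|lra|lra].
set a := t / _; set b := s / _.
have a0 : 0 <= a by rewrite divr_ge0.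
have b0 : 0 <= b by rewrite divr_ge0.
have ab : a + b <= t0 by rewrite /a /b -mulrDl; apply/divn_le.
have -> : S ((t + s) / n.+1%:R) = S a \o S b.
  by apply/funext => x; rewrite mulrDl local_semigroupD.
have comm k x : S b (iter k (S a) x) = iter k (S a) (S b x).
  by elim: k => //= k <-; rewrite local_semigroup_commute // addrC.
apply/funext => x /=; rewrite -[S a (S b _)]/((S a \o S b) _).
rewrite -![S _ (iter n _ _)]/(iter n.+1 _ _) -!iterS.
elim: n.+1 => [//|k IH]; rewrite !iterS IH /=.
by rewrite comm.
Qed.

Lemma extension0 : extension 0 = id.
Proof.
rewrite extension_local; first by apply/funext => x; exact: local_semigroup0.
by rewrite /Icc /= lexx ltW.
Qed.

Lemma extension_tfamily (b : R) : tfamily P b extension.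
Proof.
have [n hn] := natr_bound b.
have n0 : 0 < n.+1%:R :> R by rewrite ltr0n.
apply: (eq_tfamily (F := fun t => iter n.+1 (S (t / n.+1%:R)))).
  by move=> t /andP[? ?]; rewrite (@extensionE n) //; lra.
have hF : tfamily P b (fun t => S (t / n.+1%:R)).
  apply: (@tfamily_reparam _ _ _ P (fun t => t / n.+1%:R) n.+1%:R^-1 S t0 b) => //.
  - move=> t /andP[t_ge0 tb]; rewrite /Icc /= divr_ge0 //=.
    by apply/divn_le; lra.
  - by move=> s t; rewrite -mulrBl normrM mulrC (gtr0_norm (x := _^-1)) ?invr_gt0.
have it k : tfamily P b (fun t => iter k (S (t / n.+1%:R))).
  by elim: k => [|k IH]; [exact: tfamily_id|exact: (tfamily_comp hF IH)].
exact: it.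
Qed.

(** With [D] a bound on [[0, t0]], the [n] steps cost a factor
[D ^+ n <= expR (D * n)], and [n <= t / t0 + 1]. *)
Lemma extension_growth : exists M omega : R, 1 <= M /\ forall t : R, 0 <= t ->
  forall x, normR (extension t x) <= M * expR (omega * t) * normR x.
Proof.
have [D D0 hD] := tfam_bounded hS.
exists (expR D), (D / t0); split; first by have := expR_ge1Dx D; lra.
move=> t t_ge0 x; set n := Num.truncn (t / t0).
have tn : t / t0 < n.+1%:R by exact: truncnS_gt.
have nt : n%:R <= t / t0 by rewrite truncn_le divr_ge0 // ltW.
have Ia : Icc 0 t0 (t / n.+1%:R).
  by rewrite /Icc /= divr_ge0 //=; apply/divn_le; rewrite -ler_pdivrMr // ltW.
have De : D <= expR D by have := expR_ge1Dx D; lra.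
have it k : normR (iter k (S (t / n.+1%:R)) x) <= expR (k%:R * D) * normR x.
  elim: k => [|k IH]; first by rewrite mul0r expR0 mul1r.
  rewrite iterS; apply: le_trans (hD _ Ia _) _.
  rewrite -[k.+1%:R]natr1 mulrDl mul1r addrC expRD -mulrA.
  by apply: ler_pM => //; exact: normR_ge0.
apply: le_trans (it n.+1) _; rewrite ler_wpM2r ?normR_ge0 // -expRD ler_expR.
rewrite -[n.+1%:R]natr1 mulrDl mul1r addrC lerD2l.
by rewrite mulrAC -mulrA (mulrC D) ler_wpM2r.
Qed.

Lemma extension_semigroup : bicontinuous_semigroup P extension.
Proof.
have I (t : R) : 0 <= t -> Icc 0 t t by move=> t_ge0; rewrite /Icc /= t_ge0 lexx.
have lin (t : R) : 0 <= t -> linear (extension t).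
  by move=> t_ge0; exact: (tfam_linear (extension_tfamily t) (I t t_ge0)).
split.
- move=> t t_ge0; apply/bounded_operatorP; split; first exact: lin.
  have [D D0 hD] := tfam_bounded (extension_tfamily t); exists D => // x.
  exact/hD/I.
- exact: extensionD.
- exact: extension0.
- move=> x; apply/tcontP => t; rewrite /= in_itv /= andbT => t_ge0 p Pp e e0.
  have It : Icc 0 (t + 1) t by apply/andP; split; lra.
  have [d d0 hd] := tfam_cont (extension_tfamily (t + 1)) x It Pp e0.
  exists (Num.min d 1); first by rewrite lt_min d0 ltr01.
  move=> s; rewrite /= in_itv /= andbT => s_ge0; rewrite lt_min => /andP[sd s1].
  apply: hd => //; rewrite /Icc /= s_ge0 /=.
  by have := ler_norm (s - t); lra.
- have [M [w [M1 h]]] := extension_growth; exists M, w; split=> // t t_ge0.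
  apply/opnorm_leP => //; first exact: lin; last exact: h.
  by rewrite mulr_ge0 ?expR_ge0 //; lra.
- by move=> s _; apply/equi_nullP; exact: tfam_equi (extension_tfamily s).
Qed.

(** The equation is propagated step by step by [translate_solution]. *)
Lemma extension_volterra (t : R) x : 0 <= t ->
  convolution P T C (extension^~ x) t (J (extension t x) - J (T t x)).
Proof.
move=> t_ge0; have [n hn] := natr_bound t; pose h := t / n.+1%:R.
have h0 : 0 <= h by rewrite divr_ge0.
have ht0 : h <= t0 by exact/divn_le.
have Ih : Icc 0 t0 h by rewrite /Icc /= h0.
have local y s : Icc 0 t0 s ->
    convolution P T C (extension^~ y) s (J (extension s y) - J (T s y)).
  move=> Is; rewrite extension_local //.
  apply: eq_convolution (volterraS Is y) => r /andP[r0 rs].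
  rewrite extension_local // /Icc /= r0 (le_trans rs) //.
  by case/andP: Is.
suff step k : convolution P T C (extension^~ x) (k%:R * h)
    (J (extension (k%:R * h) x) - J (T (k%:R * h) x)).
  by have := step n.+1; rewrite /h mulrC divfK // pnatr_eq0.
elim: k => [|k IH]; first by rewrite mul0r; apply: local; rewrite /Icc /= lexx ltW.
have kh : 0 <= k%:R * h by rewrite mulr_ge0.
have -> : k.+1%:R * h = h + k%:R * h by rewrite -natr1; ring.
have hF := extension_tfamily (h + k%:R * h).
apply/(translate_solution kh h0 (tfam_cont hF x) (tfamily_orbit_bounded x hF) IH).
rewrite extensionD //=; apply: eq_convolution (local (extension (k%:R * h) x) h Ih).
by move=> r /andP[r0 _]; rewrite extensionD.
Qed.

End Extension.

(** * Primitives *)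

Section Primitives.
Context {R : realType} {K : scalars R} {X : completeNormedModType K}.
Variable P : set (seminorm X).
Hypothesis hX : bicontinuous_setting P.
Implicit Types (f Phi : R -> X).

Definition primitive f Phi : Prop := forall s t : R, 0 <= s -> s <= t ->
  is_rint P f s t (Phi t - Phi s).

Lemma primitive_exists f : (forall b : R, tcont P (Icc 0 b) f) ->
  (forall b : R, bounded_on (Icc 0 b) f) -> exists2 Phi, primitive f Phi & Phi 0 = 0.
Proof.
move=> cf bf.
have ex (s t : R) : 0 <= s -> s <= t -> exists v, is_rint P f s t v.
  move=> s0 st; have sub r : Icc s t r -> Icc 0 t r.
    by move=> /andP[? ?]; apply/andP; split; lra.
  exact: (rint_exists hX st (tcont_restrict sub (cf t))
    (bounded_on_restrict sub (bf t))).
have /choice[Phi hPhi] : forall t, exists v, 0 <= t -> is_rint P f 0 t v.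
  move=> t; have [t0|nt] := pselect (0 <= t); last by exists 0.
  by have [v hv] := ex 0 t (lexx 0) t0; exists v.
have prim : primitive f Phi.
  move=> s t s0 st; have [w hw] := ex s t s0 st.
  have t0 : 0 <= t by exact: le_trans st.
  rewrite (rint_cat hX s0 st (hPhi s s0) hw (hPhi t t0)).
  by rewrite addrAC subrr add0r.
exists Phi => //; have h := hPhi 0 (lexx 0); apply: (addrI (Phi 0)).
by rewrite addr0 -(rint_cat hX (lexx 0) (lexx 0) h h h).
Qed.

Lemma primitive_lipschitz f Phi (b B : R) : primitive f Phi ->
  (forall r, Icc 0 b r -> normR (f r) <= B) ->
  forall s t : R, 0 <= s -> s <= t -> t <= b -> normR (Phi t - Phi s) <= B * (t - s).
Proof.
move=> hP hB s t s0 st tb; apply: (rint_norm hX st (hP s t s0 st)).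
by move=> r /andP[? ?]; apply: hB; apply/andP; split; lra.
Qed.

Lemma primitive_bounded f Phi (b : R) : primitive f Phi -> bounded_on (Icc 0 b) f ->
  bounded_on (Icc 0 b) Phi.
Proof.
move=> hP [B hB]; exists (`|B| * b + normR (Phi 0)) => t /andP[t0 tb].
apply: le_trans (normR_le_sub _ (Phi 0)) _; rewrite lerD2r.
apply: le_trans (primitive_lipschitz hP hB (lexx 0) t0 tb) _; rewrite subr0.
apply: (@le_trans _ _ (`|B| * t)); first by rewrite ler_wpM2r // ler_norm.
by rewrite ler_wpM2l.
Qed.

Lemma primitive_tcont f Phi (b : R) : primitive f Phi -> bounded_on (Icc 0 b) f ->
  tcont P (Icc 0 b) Phi.
Proof.
move=> hP [B hB] t It p Pp e e0.
have B1 : 0 < `|B| + 1 by rewrite ltr_wpDl.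
exists (e / (`|B| + 1)) => [|s Is]; first by rewrite divr_gt0.
rewrite ltr_pdivlMr // => st.
apply: le_lt_trans (seminorm_le_norm hX _ Pp) _.
have lip r r' : Icc 0 b r -> Icc 0 b r' -> r <= r' ->
    normR (Phi r' - Phi r) <= `|B| * (r' - r).
  move=> /andP[r0 rb] /andP[r'0 r'b] rr.
  apply: le_trans (primitive_lipschitz hP hB r0 rr r'b) _.
  by rewrite ler_wpM2r ?subr_ge0 // ler_norm.
have [le|lt] := lerP t s.
  have := lip t s It Is le; rewrite ger0_norm ?subr_ge0 // in st.
  by move=> h; apply: le_lt_trans h _; lra.
have := lip s t Is It (ltW lt); rewrite normRC; rewrite ltr0_norm ?subr_lt0 // in st.
by move=> h; apply: le_lt_trans h _; lra.
Qed.

Lemma primitive_derivative f Phi (r b : R) : primitive f Phi ->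
  tcont P (Icc 0 b) f -> 0 <= r -> r < b ->
  forall p, P p -> forall e : R, 0 < e -> exists2 d : R, 0 < d &
   forall h : R, 0 < h -> h < d ->
     p (Phi (r + h) - Phi r - (ofR h : K) *: f r) <= e * h.
Proof.
move=> hP cf r0 rb p Pp e e0.
have Ir : Icc 0 b r by apply/andP; split; lra.
have [d d0 hd] := cf r Ir p Pp e e0.
exists (Num.min d (b - r)) => [|h h0]; first by rewrite lt_min d0 subr_gt0.
rewrite lt_min => /andP[hd' hb].
have rh : r <= r + h by lra.
have := rint_seminorm Pp rh (hP r (r + h) r0 rh) (c := f r) (M := e).
have -> : r + h - r = h by ring.
apply => s /andP[rs sh]; apply/ltW/hd; first by apply/andP; split; lra.
by rewrite ger0_norm; lra.
Qed.

(** A fundamental theorem of calculus, needing only one-sided derivatives: the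
increments over small cells are controlled by the mean value inequality. *)
Lemma rint_of_right_derivative f Phi (a b : R) : a <= b ->
  tcont P (Icc a b) f -> tcont P (Icc a b) Phi ->
  (forall r, a <= r -> r < b -> forall p, P p -> forall e : R, 0 < e ->
    exists2 d : R, 0 < d & forall h : R, 0 < h -> h < d -> r + h <= b ->
      p (Phi (r + h) - Phi r - (ofR h : K) *: f r) <= e * h) ->
  is_rint P f a b (Phi b - Phi a).
Proof.
move=> ab cf cPhi dPhi; apply: (rint_of_increments ab) => p Pp e e0.
have [d d0 hd] := uniform_tcont cf Pp e0.
exists d => // u xi s au uxi xis sb sud.
pose g r := Phi r - (ofR r : K) *: f xi.
have gE r r' : g r - g r' = Phi r - Phi r' - (ofR (r - r') : K) *: f xi.
  by rewrite /g rmorphB scalerBl !opprD addrACA.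
have us : u <= s by lra.
rewrite -gE; apply: (mean_value us (ltW e0)).
  move=> t /andP[ut ts] eta eta0; have e2 : 0 < eta / 2 by rewrite divr_gt0.
  have It : Icc a b t by apply/andP; split; lra.
  have [d1 d10 hd1] := cPhi t It p Pp _ e2.
  have c1 : 0 < p (f xi) + 1 by have := seminorm_ge0 p (f xi); lra.
  exists (Num.min d1 (eta / 2 / (p (f xi) + 1))); first by rewrite lt_min d10 divr_gt0.
  move=> t' /andP[ut' ts']; rewrite lt_min => /andP[A1].
  rewrite ltr_pdivlMr // mulrDr mulr1 => A2.
  have {}A1 : p (Phi t' - Phi t) < eta / 2.
    by apply: hd1 => //; apply/andP; split; lra.
  rewrite gE; apply: le_lt_trans (seminormB _ _ _) _; rewrite seminorm_scaleR.
  by have := normr_ge0 (t' - t); lra.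
move=> t ut ts eta eta0.
have [d1 d10 hd1] := dPhi t (le_trans au ut) (lt_le_trans ts sb) p Pp eta eta0.
exists d1 => // h h0 hd' ths.
have A1 := hd1 h h0 hd' (le_trans ths sb).
have A2 : p (f t - f xi) < e.
  apply: hd; [by apply/andP; split; lra|by apply/andP; split; lra|].
  by rewrite ltr_norml; apply/andP; split; lra.
rewrite gE; have -> : t + h - t = h by ring.
have -> : Phi (t + h) - Phi t - (ofR h : K) *: f xi =
    (Phi (t + h) - Phi t - (ofR h : K) *: f t) + (ofR h : K) *: (f t - f xi).
  by rewrite scalerBr addrA subrK.
apply: le_trans (seminormD _ _ _) _; rewrite seminorm_scaleR gtr0_norm //.
have : h * p (f t - f xi) <= h * e by rewrite ler_wpM2l // ltW.
lra.
Qed.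

(** The operator [U h] shifts the interval of integration, so that
[U h (Phi t) - Phi t] is the difference of the integrals of the orbit over
[[t, t + h]] and [[0, h]]. *)
Lemma orbit_primitive (U : R -> X -> X) (x : X) Phi (t : R) :
  bicontinuous_semigroup P U -> primitive (U^~ x) Phi -> Phi 0 = 0 -> 0 <= t ->
  generator P U (Phi t) (U t x - x).
Proof.
move=> hU hP P0 t_ge0.
have cU b := tfam_cont (semigroup_tfamily hU b) x.
have bU b := tfamily_orbit_bounded x (semigroup_tfamily hU b).
have shift (h : R) : 0 <= h -> U h (Phi t) = Phi (t + h) - Phi h.
  move=> h0; have th : h <= t + h by lra.
  have I : Icc 0 h h by rewrite /Icc /= h0 lexx.
  have hF := semigroup_tfamily hU h.
  have h1 : is_rint P (U^~ x) 0 t (Phi t).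
    by have := hP 0 t (lexx 0) t_ge0; rewrite P0 subr0.
  have h2 : is_rint P (fun r => U (r + h) x) 0 t (Phi (t + h) - Phi h).
    by apply: (rint_shift (f := U^~ x)); rewrite add0r; exact: hP.
  have h3 : is_rint P (U h \o U^~ x) 0 t (Phi (t + h) - Phi h).
    apply: eq_rint h2 => r /andP[r0 _] /=.
    by rewrite addrC (semigroupD hU).
  apply/esym; apply: (rint_biclosed (tfam_linear hF I)
    (tfamily_biclosed hX hF I) t_ge0 (bU t) _ h1 h3).
  have [D D0 hD] := tfam_bounded hF; have [B hB] := bU t.
  exists (D * B) => r Ir /=; apply: le_trans (hD h I _) _.
  by rewrite ler_wpM2l // hB.
have [B hB] := bU (t + 1).
apply: (@generator_intro _ _ _ _ U hU _ _ 1 (B + B)) => //.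
  move=> p Pp e e0; have e2 : 0 < e / 2 by rewrite divr_gt0.
  have tt : t < t + 1 by lra.
  have [d d0 hd] := primitive_derivative hP (cU (t + 1)) t_ge0 tt Pp e2.
  have [d' d'0 hd'] := primitive_derivative hP (cU 1) (lexx 0) ltr01 Pp e2.
  exists (Num.min d d'); first by rewrite lt_min d0.
  move=> h h0; rewrite lt_min => /andP[/(hd h h0) A1 /(hd' h h0)].
  rewrite add0r P0 subr0 (semigroup0 hU) => A2.
  rewrite shift ?(ltW h0) //.
  have -> : Phi (t + h) - Phi h - Phi t - (ofR h : K) *: (U t x - x) =
     (Phi (t + h) - Phi t - (ofR h : K) *: U t x) - (Phi h - (ofR h : K) *: x).
    by rewrite scalerBr (addrAC _ (- Phi h)) !opprD addrACA.
  by apply: le_trans (seminormB _ _ _) _; lra.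
move=> h h0 h1; rewrite shift ?(ltW h0) //.
have A1 := primitive_lipschitz hP hB t_ge0 (_ : t <= t + h) (_ : t + h <= t + 1).
have A2 := primitive_lipschitz hP hB (lexx 0) (ltW h0) (_ : h <= t + 1).
have {}A1 : normR (Phi (t + h) - Phi t) <= B * (t + h - t) by apply: A1; lra.
have {}A2 : normR (Phi h - Phi 0) <= B * (h - 0) by apply: A2; lra.
rewrite P0 !subr0 in A2; rewrite addrAC.
by apply: le_trans (normRB _ _) _; lra.
Qed.

End Primitives.

(** * The generator of the perturbed semigroup *)

Section PerturbedGenerator.
Context {R : realType} {K : scalars R} {X : completeNormedModType K}.
Variable P : set (seminorm X).
Hypothesis hX : bicontinuous_setting P.
Variable T : R -> X -> X.
Hypothesis hT : bicontinuous_semigroup P T.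
Variables J C : X -> X.
Hypothesis lJ : linear J.
Hypothesis generatorJ : forall x y, generator P T x y <-> x = J y.
Hypothesis hC : tfamily P 1 (fun=> C).
Variable t0 : R.
Hypothesis t0_gt0 : 0 < t0.
Hypothesis uniqueness : forall (g : R -> X) (t1 : R), 0 <= t1 -> t1 <= t0 ->
  tcont P (Icc 0 t1) g -> bounded_on (Icc 0 t1) g ->
  (forall t, Icc 0 t1 t -> convolution P T C g t (J (g t))) ->
  forall t, Icc 0 t1 t -> g t = 0.
Variable U : R -> X -> X.
Hypothesis hU : bicontinuous_semigroup P U.
Hypothesis volterraU : forall (t : R) x, 0 <= t ->
  convolution P T C (U^~ x) t (J (U t x) - J (T t x)).

Implicit Types (x y : X).

(** Apply [J] to the difference quotients of [U]: by the Volterra equation they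
are those of [T] at [J x], plus the means of the convolution integrand over
shrinking intervals, which tend to [C x]. Closedness of [J] concludes. *)
Lemma generator_sub_perturbed x y : generator P U x y -> x + C x = J y.
Proof.
move=> g; have gJ : generator P T (J x) x by exact/generatorJ.
pose w (h : R) := J (U h x) - J (T h x).
have I0 : Icc 0 1 (0 : R) by rewrite /Icc /= lexx ler01.
have cU := tfam_cont (semigroup_tfamily hU 1) x.
have bU := tfamily_orbit_bounded x (semigroup_tfamily hU 1).
have bg := perturbation_bounded_on hC bU.
have cg := perturbation_tcont_at hC bU I0 (cU 0 I0).
have hF := semigroup_tfamily hT 1.
have cw : tcont_at P (Icc 0 1) (quotient w (C x)) 0.
  apply: quotient_cont => p Pp e e0.
  have [d d0 hd] := tfamily_joint hF bg cg I0 I0 Pp e0.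
  exists (Num.min d 1) => [|h h0]; first by rewrite lt_min d0 ltr01.
  rewrite lt_min => /andP[hd' h1].
  have := rint_seminorm Pp (ltW h0) (volterraU x (ltW h0)) (c := C x) (M := e).
  rewrite subr0; apply => r /andP[r0 rh].
  have := hd (h - r) r; rewrite (semigroup0 hT) /= (semigroup0 hU) !subr0 => A.
  apply/ltW/A; [by apply/andP; split; lra|by apply/andP; split; lra| |].
    by rewrite ger0_norm; lra.
  by rewrite ger0_norm; lra.
have bw : bounded_on (Icc 0 1) (quotient w (C x)).
  have [D D0 hD] := tfam_bounded hF; have [B hB] := bg.
  apply: (@quotient_bounded _ _ _ _ _ (D * B)) => h h0 h1.
  have := rint_norm hX (ltW h0) (volterraU x (ltW h0)) (C := D * B).
  rewrite subr0; apply => r /andP[r0 rh].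
  have I1 : Icc 0 1 (h - r) by apply/andP; split; lra.
  apply: le_trans (hD _ I1 _) _; rewrite ler_wpM2l //; apply: hB.
  by apply/andP; split; lra.
pose h (n : nat) : R := n.+1%:R^-1.
have h0 n : 0 < h n by exact: invn_gt0.
have Ih n : Icc 0 1 (h n).
  by rewrite /Icc /= ltW //= invf_le1 ?ltr0n // ler1n.
have E n : J (difference_quotient U x y (h n)) =
    difference_quotient T (J x) x (h n) + quotient w (C x) (h n).
  rewrite /difference_quotient /quotient gt_eqF // (linear_scale lJ) -scalerDr.
  congr (_ *: _); rewrite (linear_sub lJ) (inverse_semigroup hT generatorJ) ?ltW //.
  by rewrite /w [RHS]addrC addrA subrK.
apply/esym.
have [B1 hB1] := difference_quotient_bounded g.
have [B2 hB2] := difference_quotient_bounded gJ; have [B3 hB3] := bw.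
apply: esym; apply: (inverse_biclosed hX hT generatorJ
  (u := fun n => difference_quotient U x y (h n))).
- by exists B1 => n; exact: hB1.
- have := tcont_at_tcvg (difference_quotient_cont g).
  by rewrite /difference_quotient quotient0.
- exists (B2 + B3) => n /=; rewrite E; apply: le_trans (normR_subadd _ _) _.
  by apply: lerD; [exact: hB2|exact: hB3].
move=> p Pp e e0; have e2 : 0 < e / 2 by rewrite divr_gt0.
near=> n; rewrite /= E opprD addrACA; apply: le_lt_trans (seminormD _ _ _) _.
have A1 : p (difference_quotient T (J x) x (h n) - x) < e / 2.
  near: n; have := tcont_at_tcvg (difference_quotient_cont gJ) Pp e2.
  by rewrite /difference_quotient quotient0.
have A2 : p (quotient w (C x) (h n) - C x) < e / 2.
  by near: n; have := tcont_at_tcvg cw Pp e2; rewrite quotient0.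
lra.
Unshelve. all: by end_near. Qed.

(** With [k t = x + \int_0^t U s y ds] one gets [k r + C (k r) = J (U r y)] from
the inclusion already proved, so that [r |-> T (t - r) (J (k r))] is a
primitive of the convolution integrand of [k]. Hence [k] solves the same
Volterra equation as the orbit of [x], and coincides with it. *)
Lemma perturbed_sub_generator x y : x + C x = J y -> generator P U x y.
Proof.
move=> xy.
have cU b := tfam_cont (semigroup_tfamily hU b) y.
have bU b := tfamily_orbit_bounded y (semigroup_tfamily hU b).
have [Phi hP P0] := primitive_exists hX cU bU.
pose k (t : R) := x + Phi t.
have lC := perturbation_linear hC.
(* The integrated orbit lies in the domain of the generator of [U]; add the
   identity given by the first inclusion to the hypothesis on [x]. *)
have kE t : 0 <= t -> k t + C (k t) = J (U t y).
  move=> t_ge0; have /generator_sub_perturbed := orbit_primitive hX hU hP P0 t_ge0.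
  rewrite (linear_sub lJ) -xy => h.
  by rewrite /k (linear_add lC) addrACA h [LHS]addrC subrK.
have k0 : k 0 = x by rewrite /k P0 addr0.
have ck b : tcont P (Icc 0 b) k.
  move=> t It; apply: tcont_atD; last exact: (primitive_tcont hX hP (bU b) It).
  by move=> p Pp e e0; exists 1 => // s _ _; rewrite subrr seminorm0.
have bk b : bounded_on (Icc 0 b) k.
  by apply: bounded_onD (primitive_bounded hX hP (bU b)); exists (normR x).
pose m (r : R) := J (U r y).
have mE b r : Icc 0 b r -> k r + (C \o k) r = m r.
  by move=> /andP[r0 _]; exact: kE.
have cm b : tcont P (Icc 0 b) m.
  apply: (eq_tcont (mE b)) => t It; apply: tcont_atD; first exact: ck.
  by apply: (perturbation_tcont_at hC (bk b) It); exact: ck.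
have bm b : bounded_on (Icc 0 b) m.
  apply: (eq_bounded_on (mE b)); apply: bounded_onD (bk b) _.
  exact: (perturbation_bounded_on hC (bk b)).
(* [J] passes under the integral sign because it is closed. *)
have Jk : primitive P m (J \o k).
  move=> s t s0 st; have sub r : Icc s t r -> Icc 0 t r.
    by move=> /andP[? ?]; apply/andP; split; lra.
  have bm' := bounded_on_restrict sub (bm t).
  have [w hw] := rint_exists hX st (tcont_restrict sub (cm t)) bm'.
  have wE := rint_biclosed lJ (inverse_biclosed hX hT generatorJ) st
    (bounded_on_restrict sub (bU t)) bm' (hP s t s0 st) hw.
  suff -> : (J \o k) t - (J \o k) s = w by [].
  by rewrite wE /= -(linear_sub lJ) /k opprD addrACA subrr add0r.
have hk (t : R) : 0 <= t -> convolution P T C k t (J (k t) - J (T t x)).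
  move=> t_ge0; have hF := semigroup_tfamily hT t.
  have [cf bf] := convolution_integrand hT hC (ck t) (bk t).
  pose Psi (r : R) := T (t - r) (J (k r)).
  have -> : J (k t) - J (T t x) = Psi t - Psi 0.
    rewrite /Psi subrr subr0 (semigroup0 hT) k0.
    by rewrite (inverse_semigroup hT generatorJ).
  have cJk := primitive_tcont hX Jk (bm t).
  have bJk := primitive_bounded hX Jk (bm t).
  apply: rint_of_right_derivative => //; first exact: (orbit_tcont hF).
  move=> r r0 rt p Pp e e0.
  have gr : generator P T (J (k r)) (k r) by exact/generatorJ.
  pose delta (h : R) := J (k (r + h)) - T h (J (k r)).
  (* The increment of [Psi] over [[r, r + h]] is [T (t - (r + h)) (delta h)], and
     [delta] has derivative [J (U r y) - k r = C (k r)] at [0]. *)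
  have deltaE (h : R) : delta h - (ofR h : K) *: C (k r) =
      ((J \o k) (r + h) - (J \o k) r - (ofR h : K) *: m r) -
      (T h (J (k r)) - J (k r) - (ofR h : K) *: k r).
    rewrite -(mE r) /=; last by rewrite /Icc /= r0 lexx.
    rewrite scalerDr /delta /=.
    move: (J (k r)) (J (k (r + h))) (T h (J (k r))) => c a b.
    move: (_ *: k r) (_ *: C (k r)) => u v.
    have -> : - (b - c - u) = (c - b) + u by rewrite opprD opprB opprK.
    by rewrite addrACA (addrA (a - c)) subrK opprD [- u - v + u]addrAC addNr add0r.
  have cq : tcont_at P (Icc 0 1) (quotient delta (C (k r))) 0.
    apply: quotient_cont => q Pq eta eta0; have e2 : 0 < eta / 2 by rewrite divr_gt0.
    have rr : r < r + 1 by lra.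
    have [d d0 hd] := primitive_derivative Jk (cm (r + 1)) r0 rr Pq e2.
    have [d' d'0 hd'] := ((generatorP _ _ _ _).1 gr).1 q Pq _ e2.
    exists (Num.min d d'); first by rewrite lt_min d0.
    move=> h h0; rewrite lt_min => /andP[/(hd h h0) A1 /(hd' h h0) A2].
    by rewrite deltaE; apply: le_trans (seminormB _ _ _) _; lra.
  have bq : bounded_on (Icc 0 1) (quotient delta (C (k r))).
    have [B hB] := bm (r + 1); have [D hD] := ((generatorP _ _ _ _).1 gr).2.
    apply: (@quotient_bounded _ _ _ _ _ (B + D)) => h h0 h1.
    have A1 := primitive_lipschitz hX Jk hB r0 (_ : r <= r + h) (_ : r + h <= r + 1).
    have {}A1 : normR (J (k (r + h)) - J (k r)) <= B * (r + h - r) by apply: A1; lra.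
    have := normR_triangle (J (k r)) (J (k (r + h))) (T h (J (k r))).
    by rewrite (normRC (J (k r))); have := hD h h0 h1; rewrite /delta; lra.
  have Ir : Icc 0 t (t - r) by apply/andP; split; lra.
  have I0 : Icc 0 1 (0 : R) by rewrite /Icc /= lexx ler01.
  have [d d0 hd] := tfamily_joint hF bq cq I0 Ir Pp e0.
  exists (Num.min d 1) => [|h h0]; first by rewrite lt_min d0 ltr01.
  rewrite lt_min => /andP[hd' h1] rht.
  have Irh : Icc 0 t (t - (r + h)) by apply/andP; split; lra.
  have lT := tfam_linear hF Irh.
  have -> : Psi (r + h) - Psi r =
      (ofR h : K) *: T (t - (r + h)) (quotient delta (C (k r)) h).
    rewrite -(linear_scale lT) -quotientK ?gt_eqF // /delta (linear_sub lT).
    rewrite /Psi -(semigroupD hT) ?(ltW h0) //; last by rewrite subr_ge0.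
    by congr (_ - T _ _); ring.
  rewrite -scalerBr seminorm_scaleR gtr0_norm // mulrC ler_pM2r //.
  have := hd (t - (r + h)) h Irh; rewrite quotient0 subr0 => A.
  apply/ltW/A; first by rewrite /Icc /= ltW //= ltW.
    by rewrite (_ : _ - _ = - h); [rewrite normrN gtr0_norm|ring].
  by rewrite gtr0_norm.
have kU (t : R) : Icc 0 t0 t -> k t = U t x.
  move=> It; apply/eqP; rewrite -subr_eq0; apply/eqP.
  apply: (uniqueness (g := fun r => k r - U r x) (t1 := t0)) => //; first exact: ltW.
  - move=> r Ir; apply: tcont_atB; first exact: ck.
    exact: (tfam_cont (semigroup_tfamily hU t0) x Ir).
  - exact: bounded_onB (bk t0) (tfamily_orbit_bounded x (semigroup_tfamily hU t0)).
  move=> r /andP[r0 _]; have := convolutionB hT hC r0 (hk r r0) (volterraU x r0).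
  by rewrite opprB addrA subrK -(linear_sub lJ).
have UE (h : R) : 0 < h -> h <= t0 -> U h x - x = Phi h.
  move=> h0 ht; rewrite -kU; last by rewrite /Icc /= ltW.
  by rewrite /k addrC addrA (addrC _ x) subrr add0r.
have [B hB] := bU 1.
apply: (@generator_intro _ _ _ _ U hU _ _ (Num.min t0 1) B).
- by rewrite lt_min t0_gt0 ltr01.
- move=> p Pp e e0.
  have [d d0 hd] := primitive_derivative hP (cU 1) (lexx 0) ltr01 Pp e0.
  exists (Num.min d t0) => [|h h0]; first by rewrite lt_min d0.
  rewrite lt_min => /andP[hd' ht]; rewrite UE ?(ltW ht) //.
  by have := hd h h0 hd'; rewrite add0r P0 subr0 (semigroup0 hU).
move=> h h0; rewrite le_min => /andP[ht h1]; rewrite UE //.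
have := primitive_lipschitz hX hP hB (lexx 0) (ltW h0) h1.
by rewrite P0 !subr0.
Qed.

End PerturbedGenerator.

(** * From the extrapolation space to the base space *)

Section Transport.
Context {R : realType} {K : scalars R} {X : completeNormedModType K}.
Variable P : set (seminorm X).
Hypothesis hX : bicontinuous_setting P.
Variables (T : R -> X -> X) (A : operator X X).
Hypothesis hT : bicontinuous_semigroup P T.
Hypothesis hA : forall x y : X, A x y <-> generator P T x y.
Hypothesis h0 : resolvent_set A 0.
Variables (E : extrapolation A) (B : X -> Xm1 E) (t0 : R).
Hypothesis hB : desch_schappacher P t0 T B.

Definition base_inverse (y : X) : X := Am1V E (inXm1 E y).

Definition base_perturbation (x : X) : X := Am1V E (B x).

Lemma Am1V_inj : injective (Am1V E).
Proof. exact: can_inj (@Am1VK _ _ _ _ E). Qed.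

Lemma base_inverse_linear : linear base_inverse.
Proof. by move=> a x y; rewrite /base_inverse !linearP. Qed.

(** The inclusion of [X] into the extrapolation space is [A_{-1} A^-1], hence
[base_inverse] is [A^-1] on the range of [A], and [0] in the resolvent set makes
this range the whole space. *)
Lemma generator_base_inverse x y : generator P T x y <-> x = base_inverse y.
Proof.
have AJ x' y' : A x' y' -> base_inverse y' = x'.
  by move=> /(@inXm1E _ _ _ _ E) e; rewrite /base_inverse e Am1K.
have [Res _ hRes] := h0.
split=> [/hA/AJ //|->]; apply/hA.
have [y' Ay] := (hRes (Res (- y)) (- y)).1 erefl.
rewrite scale0r sub0r => /oppr_inj yy; rewrite yy in Ay.
by rewrite (AJ _ _ Ay).
Qed.

Lemma rint_transport (f : R -> Xm1 E) (a b : R) (v : Xm1 E) :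
  is_riemann_integral (Pm1 P E) f a b v <->
  is_rint P (Am1V E \o f) a b (Am1V E v).
Proof.
have lV : linear (Am1V E) by move=> c x y; rewrite linearP.
have sumE (p : seminorm X) s : p (riemann_sum (Am1V E \o f) a s - Am1V E v) =
    seminorm_pull p (Am1V E) (riemann_sum f a s - v).
  by rewrite (riemann_sum_linear f a s lV) -linearB.
split=> [/riemann_integralP h p Pp e e0|h].
  have [|d d0 hd] := h (seminorm_pull p (Am1V E)) _ e e0; first by exists p.
  by exists d => // s hs; rewrite sumE; exact: hd.
apply/riemann_integralP => _ [p Pp <-] e e0; have [d d0 hd] := h p Pp e e0.
by exists d => // s hs; rewrite -sumE; exact: hd.
Qed.

(** The isomorphism between [X] and the extrapolation space intertwines [T] with
its extension, so the Volterra integrals are those of the base space. *)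
Lemma convolution_transport (u : R -> X) (t : R) (v : Xm1 E) :
  is_riemann_integral (Pm1 P E) (fun r => Tm1 T (t - r) (B (u r))) 0 t v <->
  convolution P T base_perturbation u t (Am1V E v).
Proof.
rewrite rint_transport /convolution.
suff -> : Am1V E \o (fun r => Tm1 T (t - r) (B (u r))) =
  (fun r => T (t - r) (base_perturbation (u r))) by [].
by apply/funext => r; rewrite /= /Tm1 Am1K.
Qed.

Lemma base_perturbation_tfamily : tfamily P 1 (fun=> base_perturbation).
Proof.
have [lB [c c0 bB]] := (bounded_operatorP B).1 (DS_bounded hB).
have normV y : normR (Am1V E y) = normR y.
  by apply: (fmorph_inj (@ofR R K)); rewrite !normRE Xm1_norm.
split.
- by move=> t _ a x y; rewrite /base_perturbation lB linearP.
- by exists c => // t _ x; rewrite normV.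
- by move=> x t _ p _ e e0; exists 1 => // s _ _; rewrite subrr seminorm0.
- move=> u bu cu p Pp e e0.
  have := @cvg_comp _ _ _ (u : nat -> lcs P) (B : lcs P -> lcs (Pm1 P E)) _ _ _
    ((tcvgP u 0).2 cu) (DS_continuous hB (x := 0)).
  move=> /tcvgP/(_ (seminorm_pull p (Am1V E)) _ e e0).
  have pP : (Pm1 P E) (seminorm_pull p (Am1V E)) by exists p.
  move=> /(_ pP); apply: filterS => n + t _.
  by rewrite (linear_zero lB) subr0.
Qed.

Lemma base_volterra_exists (F : R -> X -> X) : tfamily P t0 F -> exists2 G,
  tfamily P t0 G & forall t, Icc 0 t0 t -> forall x,
    convolution P T base_perturbation (F^~ x) t (base_inverse (G t x)).
Proof.
move=> /in_XXP hF.
have /choice[G hG] : forall w : R * X, exists y, Icc 0 t0 w.1 ->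
    is_VB P T B F w.1 w.2 (inXm1 E y).
  move=> [t x] /=; have [It|nIt] := pselect (Icc 0 t0 t); last by exists 0.
  by have [|y hy] := DS_values hB hF (t := t) _ x; [rewrite in_itv|exists y].
have eq : VB_eq P t0 T B F (fun t x => G (t, x)).
  by move=> t It x; apply: (hG (t, x)); rewrite in_itv /= in It.
exists (fun t x => G (t, x)); first by apply/in_XXP; exact: (DS_range hB hF eq).
by move=> t It x; apply/convolution_transport; apply: (hG (t, x)).
Qed.

(** The operator norm is a supremum over the unit ball, so [F] is rescaled by
[c^-1]. The bound is raised to at least [1 / 2] to have [q] positive, which keeps
the bounds obtained by iteration positive. *)
Lemma base_volterra_contraction : exists q : R, [/\ 0 < q, q < 1 &
  forall F G (c : R), tfamily P t0 F -> 0 < c ->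
  (forall t, Icc 0 t0 t -> forall x, normR (F t x) <= c * normR x) ->
  (forall t, Icc 0 t0 t -> forall x,
     convolution P T base_perturbation (F^~ x) t (base_inverse (G t x))) ->
  forall t, Icc 0 t0 t -> forall x, normR (G t x) <= q * c * normR x].
Proof.
have := DS_norm hB; set sup := ereal_sup _ => sup1.
have [q [q0 q1 supq]] : exists q : R, [/\ 0 < q, q < 1 & (sup <= q%:E)%E].
  move: sup1; case: sup => [r||] // r1.
    rewrite lte_fin in r1; exists (Num.max r 2^-1); split.
    - by rewrite lt_max invr_gt0 ltr0n orbT.
    - by rewrite gt_max r1 /= invf_lt1 ?ltr0n // ltr1n.
    - by rewrite lee_fin le_max lexx.
  exists 2^-1; split; [by rewrite invr_gt0 ltr0n| |exact: leNye].
  by rewrite invf_lt1 ?ltr0n // ltr1n.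
exists q; split=> // F G c hF c0 bF eG t It x.
have ci : 0 < c^-1 by rewrite invr_gt0.
pose F' (s : R) y := (ofR c^-1 : K) *: F s y.
pose G' (s : R) y := (ofR c^-1 : K) *: G s y.
have hF' : tfamily P t0 F' by exact: tfamily_scale.
have eq : VB_eq P t0 T B F' G'.
  move=> s Is y; rewrite in_itv /= in Is; apply/convolution_transport.
  have /andP[s0 _] := Is.
  have := convolutionZ hT base_perturbation_tfamily (ofR c^-1) s0 (eG s Is y).
  by rewrite -(linear_scale base_inverse_linear).
have hG' : tfamily P t0 G'.
  by apply/in_XXP; apply: (DS_range hB _ eq); apply/in_XXP.
have bG' : (XX_norm t0 G' <= q%:E)%E.
  apply: le_trans supq; apply: ereal_sup_ubound; exists G' => //.
  exists F'; split=> //; first exact/in_XXP.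
  apply/(XX_norm_leP hF' ler01) => s Is y.
  rewrite normR_scaleR gtr0_norm // mul1r mulrC ler_pdivrMr // mulrC.
  exact: bF.
have /(XX_norm_leP hG' (ltW q0))/(_ t It x) := bG'.
rewrite normR_scaleR gtr0_norm // mulrC ler_pdivrMr //.
by rewrite mulrAC.
Qed.

End Transport.

Theorem theorem2p1 (R : realType) (K : scalars R)
    (X : completeNormedModType K) (P : set (seminorm X))
    (hX : bicontinuous_setting P)
    (T : R -> X -> X) (hT : bicontinuous_semigroup P T)
    (A : operator X X) (hA : forall x y : X, A x y <-> generator P T x y)
    (h0 : resolvent_set A 0)
    (E : extrapolation A) (B : X -> Xm1 E)
    (t0 : R) (ht0 : 0 < t0) (hB : desch_schappacher P t0 T B) :
  exists S : R -> X -> X,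
    [/\ bicontinuous_semigroup P S,
        forall x y : X, perturbed_generator B x y <-> generator P S x y &
        forall (t : R) (x : X), 0 <= t ->
          exists2 v : Xm1 E,
            is_riemann_integral (Pm1 P E)
              (fun r : R => Tm1 T (t - r) (B (S r x))) 0 t v &
            inXm1 E (S t x) = inXm1 E (T t x) + v].
Proof.
have lJ := base_inverse_linear E.
have gJ := generator_base_inverse hA h0 E.
have hC := base_perturbation_tfamily hB.
have ex := base_volterra_exists hB.
have [q [q0 q1 contr]] := base_volterra_contraction hT hB.
have [S0 hS0 volt] := volterra_solution hX hT lJ hC q0 q1 ex contr.
have uniq := volterra_unique hX hT lJ gJ hC q0 q1 ex contr.
pose S := extension t0 S0.
have hS := extension_semigroup hX hT lJ gJ hC ht0 uniq hS0 volt.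
have voltS := extension_volterra hX hT lJ gJ hC ht0 uniq hS0 volt.
exists S; split=> // [x y|t x t_ge0].
  have pE : perturbed_generator B x y <->
      x + base_perturbation B x = base_inverse E y.
    split=> [e|e].
      by rewrite /base_inverse -e linearD Am1K.
    by apply: (@Am1V_inj _ _ _ _ E); rewrite linearD Am1K.
  split=> [/pE|g]; first exact: (perturbed_sub_generator hX hT lJ gJ hC ht0 uniq).
  by apply/pE; exact: (generator_sub_perturbed hX hT lJ gJ hC hS voltS).
exists (inXm1 E (S t x) - inXm1 E (T t x)); last by rewrite addrC subrK.
by apply/convolution_transport; rewrite linearB; exact: voltS.
Qed.
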